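(* For every special Pisot number $\alpha$ that is an algebraic unit (special Pisot unit), the tent-tile $\mathcal{F}_\alpha\subset\mathbb{K}_\alpha$ is a compact set that is the closure of its interior.
   Context: A Pisot number is an algebraic integer $\alpha$ that is a real number $>1$ all of whose Galois conjugates different from $\alpha$ have modulus $<1$. For real $\alpha>1$ put $\beta=\beta(\alpha):=\alpha/(\alpha-1)$. A Pisot number $\alpha$ is special if $\beta(\alpha)$ is also a Pisot number; a special Pisot unit is a special Pisot number that is an algebraic unit. (By a theorem of Smyth there are exactly $11$ special Pisot numbers, and all of them except $2$ are units.) Let $\alpha$ be a special Pisot unit of degree $d+1$, with real conjugates $\alpha^{(1)},\dots,\alpha^{(r)}$ (different from $\alpha$) and non-real conjugates $\alpha^{(r+1)},\overline{\alpha^{(r+1)}},\dots,\alpha^{(r+s)},\overline{\alpha^{(r+s)}}$, so $d=r+2s$. Put $\mathbb{K}_\alpha=\mathbb{R}^r\times\mathbb{C}^s\cong\mathbb{R}^d$ with the Euclidean topology. For $z\in\mathbb{Q}(\alpha)$ let $z^{(k)}$ be the image of $z$ under the field embedding $\alpha\mapsto\alpha^{(k)}$, let $\psi(z)=(z^{(1)},\dots,z^{(r+s)})^T\in\mathbb{K}_\alpha$, and let $\Psi[z]:\mathbb{K}_\alpha\to\mathbb{K}_\alpha$ be the linear map $(x_1,\dots,x_{r+s})\mapsto(z^{(1)}x_1,\dots,z^{(r+s)}x_{r+s})^T$. Define $f_L(x)=\Psi[\alpha](x)$ and $f_R(x)=\Psi[\beta](\psi(1)-x)$ on $\mathbb{K}_\alpha$;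 both are contractions. The tent-tile $\mathcal{F}_\alpha$ is the unique non-empty compact subset of $\mathbb{K}_\alpha$ with $\mathcal{F}_\alpha=f_L(\mathcal{F}_\alpha)\cup f_R(\mathcal{F}_\alpha)$. *)

(* Defs.v *)
From HB Require Import structures.
From mathcomp Require Import all_boot all_order all_algebra complex.
From mathcomp Require Import all_classical all_reals all_analysis.

Set Implicit Arguments.
Unset Strict Implicit.
Unset Printing Implicit Defensive.

Import Order.TTheory GRing.Theory Num.Theory.
Import numFieldNormedType.Exports.

Local Open Scope classical_set_scope.
Local Open Scope ring_scope.

(* The topology of the modulus on R[i]. *)
HB.instance Definition _ (R : realType) := NormedModule.copy R[i] R[i]^o.

(* [x] and [y] may live in different fields (typically R and R[i]); the
   polynomial [p] is the common minimal polynomial over the rationals. *)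
Definition galois_conj (E K : numFieldType) (x : E) (y : K) : Prop :=
  exists p : {poly rat}, [/\ p \is monic, irreducible_poly p,
    root (map_poly ratr p) x & root (map_poly ratr p) y].

Definition algebraic_integer (K : numFieldType) (x : K) : Prop :=
  integralOver (intr : int -> K) x.

(* [x != 0] is needed because 0^-1 = 0. *)
Definition algebraic_unit (K : numFieldType) (x : K) : Prop :=
  [/\ x != 0, algebraic_integer x & algebraic_integer x^-1].

Definition pisot (R : realType) (alpha : R) : Prop :=
  [/\ algebraic_integer alpha, 1 < alpha &
    forall z : R[i], galois_conj alpha z -> z != real_complex R alpha ->
      `|z| < 1].

Definition beta (R : realType) (alpha : R) : R := alpha / (alpha - 1).

Definition special_pisot (R : realType) (alpha : R) : Prop :=
  pisot alpha /\ pisot (beta alpha).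

Definition special_pisot_unit (R : realType) (alpha : R) : Prop :=
  special_pisot alpha /\ algebraic_unit alpha.

(* The families [a] and [c] list exactly once each real conjugate other than
   [alpha] and exactly one element of each pair of non-real conjugates. *)
Definition conj_enum (R : realType) (alpha : R) (r s : nat)
    (a : 'I_r -> R) (c : 'I_s -> R[i]) : Prop :=
  [/\ injective a,
      forall x : R,
        (galois_conj alpha x /\ x != alpha) <-> (exists k, x = a k),
      forall k l, k != l -> c k != c l /\ c k != (c l)^* &
      forall z : R[i],
        (galois_conj alpha z /\ z \isn't Num.real) <->
        (exists k, z = c k \/ z = (c k)^*)].

(* The image of [z], an element of Q(x) = Q[x], under the field embedding
   sending [x] to its conjugate [y]: write z = p(x) with p a rational
   polynomial and take p(y). By [embed_horner] the choice of p is irrelevant;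
   the value is junk when [z] is not in Q(x). *)
Definition embed (E K : numFieldType) (x : E) (y : K) (z : E) : K :=
  (map_poly ratr
    (xget 0 [set p : {poly rat} | (map_poly ratr p).[x] = z])).[y].

Lemma embed_horner (E K : numFieldType) (x : E) (y : K) (p : {poly rat}) :
  galois_conj x y ->
  embed x y (map_poly ratr p).[x] = (map_poly ratr p).[y].
Proof.
move=> [m [_ mirr mx my]]; rewrite /embed.
set q := xget _ _.
have qE : (map_poly ratr q).[x] = (map_poly ratr p).[x].
  by apply: (@xgetI _ 0 (fun q : {poly rat} =>
    (map_poly ratr q).[x] = (map_poly ratr p).[x]) p).
have rx : root (map_poly ratr (q - p)) x.
  by rewrite rootE rmorphB /= hornerD hornerN qE subrr.
have /dvdpP[u uE] : m %| q - p.
  rewrite -[_ %| _]negbK; apply/negP => ndv.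
  have : coprimep m (q - p) by rewrite irreducible_poly_coprime.
  rewrite -(coprimep_map (ratr : {rmorphism rat -> E})) => /coprimep_root.
  by move/(_ _ mx); move: rx; rewrite rootE => ->.
apply/eqP; rewrite -subr_eq0 -hornerN -hornerD -rmorphN -rmorphD /= uE.
by rewrite rmorphM /= hornerM (rootP my) mulr0.
Qed.

Section tent_tile.
Context (R : realType) (r s : nat).
Context (alpha : R) (a : 'I_r -> R) (c : 'I_s -> R[i]).

Local Notation K := ('rV[R]_r * 'rV[R[i]]_s)%type.

Definition psi (z : R) : K :=
  (\row_k embed alpha (a k) z, \row_k embed alpha (c k) z).

Definition Psi (z : R) (x : K) : K :=
  (\row_k ((psi z).1 0 k * x.1 0 k), \row_k ((psi z).2 0 k * x.2 0 k)).

Definition f_L (x : K) : K := Psi alpha x.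
Definition f_R (x : K) : K := Psi (beta alpha) (psi 1 - x).

Definition is_tent_tile (F : set K) : Prop :=
  [/\ F !=set0, compact F & F = f_L @` F `|` f_R @` F].

(* The attractor of the contractions [f_L] and [f_R], hence the only set
   satisfying [is_tent_tile]. The default value, a single point, is not the
   closure of its interior when r + s > 0, so it does not make statements about
   [tent_tile] trivially true. *)
Definition tent_tile : set K := xget [set 0] is_tent_tile.

End tent_tile.

(* Main.v *)
(* An upper bound on the degree (Schur-Cohn estimates for the conjugates w and
   w / (w - 1)) and Schwarz-Pick bounds for the traces of alpha, beta and
   alpha^2 leave finitely many minimal polynomials, up to exchanging alpha and
   beta; the survivors show that alpha = eta^i and beta = eta^j for one unit eta.

   Suppose the tile F has empty interior. Words in f_L, f_R with multiplier
   about eta^m form a stopping-time code, because 1/alpha + 1/beta = 1. Undoing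
   a word w maps F to copies of F, and near the origin only finitely many
   copies occur, independently of w, because conjugates and real size of their
   translations are bounded. So one ball B misses all of them. For z in
   Z[alpha], of real size at most eta^L and with conjugates near F, count the
   words w such that the inverse of f_w maps z into B. As B misses the expanded
   tiles, each z is counted on one level m only, and there a bounded number of
   times. But relative density of Z[alpha] makes each of N well separated
   levels contribute about eta^L, while the number of points z is O(eta^L).
   For N large this is a contradiction. Self-similarity then spreads an interior
   point over F. *)

Require Import Defs.
From mathcomp Require Import all_boot all_order all_algebra complex.
From mathcomp Require Import all_classical all_reals all_analysis.
From mathcomp Require Import polyrcf separable qpoly ring lra zify.
Import Order.TTheory GRing.Theory Num.Theory.
Import numFieldNormedType.Exports.
Local Open Scope classical_set_scope.
Local Open Scope ring_scope.

Set Implicit Arguments.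
Unset Strict Implicit.
Unset Printing Implicit Defensive.

(** The obstacle is that alpha and beta might a priori be multiplicatively independent. Ratios of
    multipliers of words of comparable size would then form an infinite set, and the expanded tile
    could show infinitely many shapes of copies of F near the origin. This is why the special Pisot
    units are classified: of the classification only the common unit eta is kept, which makes every
    multiplier a sign times a power of eta. Since alpha and beta are units, 1/alpha and 1/beta are
    the absolute determinants of f_L and f_R, so 1/alpha + 1/beta = 1 balances the volumes of the
    two pieces. The proof uses no measure: it counts points of Z[alpha], where the real size of a
    point plays the role of a window and its conjugates give the position in K. A word of weight n
    accounts for about eta^(L-n) points, the discrete form of the volume of its piece, and the words
    of one level add up to about eta^L. *)

Notation intp := (map_poly intr).

Lemma map_ratr_intr (K : numFieldType) (P : {poly int}) :
  map_poly ratr (intp P : {poly rat}) = intp P :> {poly K}.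
Proof.
rewrite -map_poly_comp; apply: eq_map_poly => i /=.
by rewrite ratr_int.
Qed.

Lemma irreducible_dvdp_root (K : numFieldType) (x : K) (m q : {poly rat}) :
  irreducible_poly m -> root (map_poly ratr m) x -> root (map_poly ratr q) x ->
  m %| q.
Proof.
move=> mirr mx qx; rewrite -[_ %| _]negbK; apply/negP => ndv.
have : coprimep m q by rewrite irreducible_poly_coprime.
rewrite -(coprimep_map (ratr : {rmorphism rat -> K})) => /coprimep_root.
by move/(_ _ mx); rewrite (eqP qx) eqxx.
Qed.

(** * Integral minimal polynomials *)

(** Integer coefficients make the values at integers available as integers, for instance as norms;
    irreducibility is over the rationals, to match [galois_conj]. *)
Definition int_minpoly (K : numFieldType) (x : K) (P : {poly int}) : Prop :=
  [/\ P \is monic, irreducible_poly (intp P : {poly rat}) & root (intp P) x].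

Lemma int_minpoly_dvd (K : numFieldType) (x : K) (P Q : {poly int}) :
  int_minpoly x P -> root (intp Q) x -> exists S, Q = P * S.
Proof.
move=> [Pm Pirr Px] Qx.
have : (intp P : {poly rat}) %| intp Q.
  by apply: (irreducible_dvdp_root (x := x)) => //; rewrite map_ratr_intr.
rewrite dvdp_rat_int => /dvdpP_int[S ->]; exists S.
by rewrite zprimitive_monic.
Qed.

(** Take a monic integer polynomial of least degree vanishing at x. By Gauss's lemma a rational
    factor may be taken integral; the two leading coefficients then multiply to 1, so both factors
    are monic up to sign, and the one vanishing at x has full degree. *)
Lemma int_minpoly_exists (K : numFieldType) (x : K) :
  algebraic_integer x -> exists P, int_minpoly x P.
Proof.
move=> [Q Qm Qx].
pose has_size n := `[< exists P : {poly int},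
   [/\ P \is monic, root (intp P) x & size P = n] >].
have ex_size : exists n, has_size n.
  by exists (size Q); apply/asboolP; exists Q.
case: (ex_minnP ex_size) => n /asboolP[P [Pm Px sP]] nmin.
exists P; split=> //; split.
  rewrite size_map_poly_id0 ?intr_eq0 ?lead_coef_eq0 ?monic_neq0 //.
  rewrite ltnNge; apply/negP => sP1.
  have P1 : P = 1.
    have /size1_polyC PE := sP1; move: Pm; rewrite PE monicE lead_coefC.
    by move=> /eqP ->.
  by move: Px; rewrite P1 rmorph1 (negbTE (root1 _)).
move=> q sq qP.
have [p1 [a a0 qE] [r PE]] := dvdpP_rat_int qP.
have lead1 : lead_coef p1 * lead_coef r = 1.
  by rewrite -lead_coefM -PE; apply/eqP.
have l1 : lead_coef p1 != 0.
  by apply: contra_eq_neq lead1 => ->; rewrite mul0r eq_sym oner_eq0.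
have l2 : lead_coef r != 0.
  by apply: contra_eq_neq lead1 => ->; rewrite mulr0 eq_sym oner_eq0.
have minsize (p : {poly int}) : lead_coef p ^+ 2 = 1 -> root (intp p) x ->
    (size P <= size p)%N.
  move=> lp px; rewrite sP; apply: nmin; apply/asboolP.
  exists (lead_coef p *: p); split.
  - by rewrite monicE lead_coefZ -expr2 lp.
  - by rewrite map_polyZ rootZ // intr_eq0; apply: contra_eq_neq lp => ->;
      rewrite expr0n eq_sym oner_eq0.
  - by rewrite size_scale //; apply: contra_eq_neq lp => ->;
      rewrite expr0n eq_sym oner_eq0.
have lsq : lead_coef p1 ^+ 2 = 1 /\ lead_coef r ^+ 2 = 1.
  have /intUnitRing.unitzPl : lead_coef p1 * lead_coef r = 1 by [].
  have /intUnitRing.unitzPl : lead_coef r * lead_coef p1 = 1 by rewrite mulrC.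
  by move=> /orP[] /eqP -> /orP[] /eqP ->.
have sPE : size P = (size p1 + size r).-1.
  by rewrite PE size_mul // -lead_coef_eq0.
have sp1 : size p1 = size q.
  by rewrite qE size_scale // size_rat_int_poly.
have : root (intp p1 * intp r) x by rewrite -rmorphM -PE.
rewrite rootM => /orP[] rx.
  rewrite -dvdp_size_eqp // -sp1 size_rat_int_poly eqn_leq.
  have := minsize _ lsq.1 rx; move: (size_poly_gt0 r).
  rewrite -lead_coef_eq0 l2 => r0.
  by rewrite sPE; lia.
have := minsize _ lsq.2 rx.
have := size_poly_gt0 p1; rewrite -lead_coef_eq0 l1 sPE sp1.
have := size_poly_gt0 r; rewrite -lead_coef_eq0 l2.
by move/eqP: sq; lia.
Qed.

Lemma int_minpoly_conj (E K : numFieldType) (x : E) (y : K) (P : {poly int}) :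
  int_minpoly x P -> galois_conj x y <-> root (intp P) y.
Proof.
move=> [Pm Pirr Px]; split=> [[m [mm mirr mx my]]|Py]; last first.
  exists (intp P); split; rewrite ?map_ratr_intr //.
  exact: monic_map.
have mP : m %| intp P.
  by apply: (irreducible_dvdp_root (x := x)); rewrite ?map_ratr_intr.
have : m %= intp P.
  apply: Pirr mP; rewrite neq_ltn; apply/orP; right; exact: mirr.1.
rewrite eqp_monic ?monic_map // => /eqP mE.
by rewrite -map_ratr_intr -mE.
Qed.

(** The minimal polynomial of b(x), composed with b, vanishes at x and hence at y. It carries
    conjugates of alpha to conjugates of beta. *)
Lemma galois_conj_horner (E K : numFieldType) (x : E) (y : K) (b : {poly int}) :
  galois_conj x y -> algebraic_integer (intp b).[x] ->
  galois_conj (intp b).[x] (intp b).[y].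
Proof.
move=> [m [mm mirr mx my]] /int_minpoly_exists[P PP].
apply/(int_minpoly_conj _ PP); case: PP => _ _ Px.
have : m %| intp P \Po intp b.
  apply: (irreducible_dvdp_root (x := x)) => //.
  by rewrite map_comp_poly !map_ratr_intr rootE horner_comp.
rewrite -(dvdp_map (ratr : {rmorphism rat -> K})) => /root_dvdp/(_ my).
by rewrite map_comp_poly !map_ratr_intr rootE horner_comp.
Qed.

Lemma int_minpoly_separable (K : numFieldType) (x : K) (P : {poly int}) :
  int_minpoly x P -> forall F : numFieldType, separable_poly (intp P : {poly F}).
Proof.
move=> [Pm Pirr _] F; rewrite -map_ratr_intr separable_map unlock.
rewrite irreducible_poly_coprime //; apply/negP => /dvdp_leq.
have sP := Pirr.1; have sd := lt_size_deriv (irredp_neq0 Pirr).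
rewrite leqNgt sd -size_poly_gt0 => /implyP; rewrite implybF.
by rewrite polyorder.size_deriv; case: (size _) sP => [|[]].
Qed.

Import ComplexField Normc.
Local Open Scope complex_scope.

(** * Estimates for the conjugates *)

Section complex_modulus.
Context (R : realType).
Implicit Types z w : R[i].

Lemma normc_normr z : `|z| = (normc z)%:C.
Proof. by []. Qed.

Lemma normc_ge0 z : 0 <= normc z.
Proof. by case: z => a b; exact: sqrtr_ge0. Qed.

Lemma normc_gt0 z : z != 0 -> 0 < normc z.
Proof.
move=> z0; rewrite lt_neqAle normc_ge0 andbT eq_sym.
by apply: contra z0 => /eqP/eq0_normc ->.
Qed.

Lemma normc_real (x : R) : normc x%:C = `|x|.
Proof. by rewrite /= expr0n addr0 sqrtr_sqr. Qed.

Lemma normc_lt z (e : R) : (`|z| < e%:C) = (normc z < e).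
Proof. by rewrite normc_normr ltcR. Qed.

Lemma normcJ z : normc z^* = normc z.
Proof. by case: z => a b /=; rewrite sqrrN. Qed.

Lemma normcD z w : normc (z + w) <= normc z + normc w.
Proof. exact: le_normcD. Qed.

Lemma normcB z w : normc (z - w) <= normc z + normc w.
Proof. by rewrite -[normc w]normcN; exact: normcD. Qed.

Lemma normc_dist z w : normc (z - w) = normc (w - z).
Proof. by rewrite -normcN opprB. Qed.

Lemma normcX z n : normc (z ^+ n) = normc z ^+ n.
Proof. by elim: n => [|n IH]; rewrite ?expr0 ?normc1 // !exprS normcM IH. Qed.

Lemma sqr_normc_ReIm z : normc z ^+ 2 = complex.Re z ^+ 2 + complex.Im z ^+ 2.
Proof. by case: z => a b /=; rewrite sqr_sqrtr // addr_ge0 // sqr_ge0. Qed.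

Lemma normc_prod (I : Type) (s : seq I) (F : I -> R[i]) :
  normc (\prod_(i <- s) F i) = \prod_(i <- s) normc (F i).
Proof.
elim: s => [|i s IH]; first by rewrite !big_nil normc1.
by rewrite !big_cons normcM IH.
Qed.

Lemma normc_sum (I : Type) (s : seq I) (F : I -> R[i]) :
  normc (\sum_(i <- s) F i) <= \sum_(i <- s) normc (F i).
Proof.
elim: s => [|i s IH]; first by rewrite !big_nil normc0.
rewrite !big_cons (le_trans (normcD _ _)) //; by rewrite lerD2l.
Qed.

(** Turns the Pisot condition |w / (w - 1)| < 1 on the conjugates of beta into a half-plane for
    w. *)
Lemma normc_lt_half z : (normc z < normc (1 - z)) = (complex.Re z < 2^-1).
Proof.
rewrite -(ltr_pXn2r (_ : (0 < 2)%N)) ?nnegrE ?normc_ge0 // !sqr_normc_ReIm.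
have -> : complex.Re (1 - z) = 1 - complex.Re z by case: z.
have -> : complex.Im (1 - z) = - complex.Im z by case: z => a b /=; rewrite sub0r.
by rewrite sqrrN ltrD2r; apply/idP/idP => h; nra.
Qed.

End complex_modulus.

Section trace_inequality.
Context (R : realType).
Implicit Types (us : seq R[i]).

Definition in_punctured_disc us :=
  forall u, u \in us -> u != 0 /\ normc u < 1.

Lemma in_punctured_disc_cons u us :
  in_punctured_disc (u :: us) -> (u != 0 /\ normc u < 1) /\ in_punctured_disc us.
Proof.
move=> h; split; first by apply: h; rewrite mem_head.
by move=> v vus; apply: h; rewrite inE vus orbT.
Qed.

Lemma prod_normc_gt0 us :
  in_punctured_disc us -> 0 < \prod_(u <- us) normc u.
Proof.
elim: us => [_|u us IH /in_punctured_disc_cons[[u0 u1] /IH h]].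
  by rewrite big_nil ltr01.
by rewrite big_cons mulr_gt0 // normc_gt0.
Qed.

Lemma prod_normc_lt1 us : (0 < size us)%N ->
  in_punctured_disc us -> \prod_(u <- us) normc u < 1.
Proof.
elim: us => [//|u us IH] _ /in_punctured_disc_cons[[u0 u1] hus].
rewrite big_cons; case: us IH hus => [|v us] IH hus.
  by rewrite big_nil mulr1.
have := IH isT hus; have := prod_normc_gt0 hus; have := normc_gt0 u0.
set a := normc u in u1 *; set b := \prod_(_ <- _) _ => a0 b0 b1.
nra.
Qed.

(* The logarithmic derivative at 0 of the Blaschke product with zeros [us] is
   minus the sum below, so this is the Schwarz-Pick bound |B'(0)| <= 1 - |B(0)|^2. *)
Lemma blaschke_trace us : in_punctured_disc us ->
  let S := normc (\sum_(u <- us) (u^-1 - u^*)) in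
  let p := \prod_(u <- us) normc u in
  S * p <= 1 - p ^+ 2 /\ ((1 < size us)%N -> S * p < 1 - p ^+ 2).
Proof.
elim: us => [|u us IH].
  by rewrite /= !big_nil normc0 mul0r expr1n subrr.
move=> /in_punctured_disc_cons[[u0 u1] hus] /=.
have [IH1 _] := IH hus.
rewrite !big_cons.
set T := \sum_(_ <- _) _ in IH1 *; set p := \prod_(_ <- _) _ in IH1 *.
have q0 := normc_gt0 u0.
have p0 : 0 < p := prod_normc_gt0 hus.
have uE : normc (u^-1 - u^*) * normc u = 1 - normc u ^+ 2.
  rewrite -normcM mulrBl mulVf // [_^* * _]mulrC -sqr_normc.
  have -> : 1 - `|u| ^+ 2 = (1 - normc u ^+ 2)%:C.
    by rewrite normc_normr rmorphB rmorphXn rmorph1.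
  rewrite normc_real ger0_norm // subr_ge0 expr_le1 ?ltW //.
have tri : normc (u^-1 - u^* + T) * (normc u * p) <=
   (1 - normc u ^+ 2) * p + normc T * p * normc u.
  apply: (le_trans (ler_wpM2r _ (normcD _ _))); first by rewrite ltW // mulr_gt0.
  by rewrite mulrDl mulrA uE lerD2l mulrA -mulrA [normc u * p]mulrC mulrA.
have tri2 : normc (u^-1 - u^* + T) * (normc u * p) <=
   (1 - normc u ^+ 2) * p + (1 - p ^+ 2) * normc u.
  by apply: (le_trans tri); rewrite lerD2l ler_wpM2r // ltW.
set q := normc u in q0 u1 tri2 *.
have p1 : p <= 1.
  case: us IH hus @T @p IH1 p0 tri tri2 => [|v us] _ hus T p _ _ _ _.
    by rewrite /p big_nil.
  by rewrite ltW // prod_normc_lt1.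
(* The slack gained by adding one zero; it is positive as soon as p and q are both below 1, hence
   the strict bound for two or more zeros. *)
have key : 1 - (q * p) ^+ 2 - ((1 - q ^+ 2) * p + (1 - p ^+ 2) * q) =
   (1 - q * p) * ((1 - q) * (1 - p)) by ring.
have qp1 : 0 < 1 - q * p by nra.
split=> [|s1].
  apply: (le_trans tri2); rewrite -subr_ge0 key; apply: mulr_ge0; first exact: ltW.
  by apply: mulr_ge0; rewrite subr_ge0 // ltW.
apply: (le_lt_trans tri2); rewrite -subr_gt0 key; apply: mulr_gt0 => //.
apply: mulr_gt0; rewrite subr_gt0 //.
by apply: prod_normc_lt1 => //; case: us s1 {IH hus T p IH1 p0 tri tri2 p1 key qp1}.
Qed.

(** [A] and [B] are the traces of y and 1/y. As the product of the moduli is 1/y, the Schwarz-Pick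
    bound becomes |B - A + y - 1/y| < y - 1/y. For integral traces this leaves few values of B -
    A. *)
Lemma trace_inverse_bound (y A B : R) us :
  1 < y -> in_punctured_disc us -> (1 < size us)%N ->
  y * \prod_(u <- us) normc u = 1 ->
  y%:C + \sum_(u <- us) u = A%:C -> y%:C^-1 + \sum_(u <- us) u^-1 = B%:C ->
  B - A < 0 /\ A - B < 2 * (y - y^-1).
Proof.
move=> y1 hus s1 yp trA trB.
have [_ /(_ s1)] := blaschke_trace hus.
set p := \prod_(_ <- _) _ in yp *.
have y0 : y != 0 by rewrite gt_eqF // (lt_trans ltr01).
have pE : p = y^-1 by apply: (mulfI y0); rewrite yp divff.
have sumE : \sum_(u <- us) (u^-1 - u^*) = (B - A + (y - y^-1))%:C.
  rewrite sumrB.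
  have -> : \sum_(u <- us) u^-1 = (B - y^-1)%:C.
    by rewrite rmorphB /= fmorphV /= -trB addrC addKr.
  have -> : \sum_(u <- us) u^* = (\sum_(u <- us) u)^* by rewrite rmorph_sum.
  have -> : \sum_(u <- us) u = (A - y)%:C.
    by rewrite rmorphB /= -trA addrC addKr.
  by rewrite conjc_real -rmorphB; congr _%:C; ring.
rewrite sumE normc_real pE.
have : 1 - y^-1 ^+ 2 = (y - y^-1) * y^-1 by field.
move=> ->; rewrite ltr_pM2r ?invr_gt0 ?(lt_trans ltr01) // ltr_norml.
by move=> /andP[h1 h2]; split; lra.
Qed.

End trace_inequality.

(** * Power sums of the roots from the extreme coefficients *)

Section symmetric_functions.
Context (F : fieldType).
Implicit Types (xs : seq F).

Local Notation "'pol' xs" := (\prod_(x <- xs) ('X - x%:P)) (at level 10).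

Lemma coef_XsubCM (p : {poly F}) x k :
  (('X - x%:P) * p)`_k = (if k is k'.+1 then p`_k' else 0) - x * p`_k.
Proof. by rewrite mulrBl coefB coefXM coefCM; case: k. Qed.

Lemma prod_XsubC_low xs : 0 \notin xs ->
  (pol xs)`_1 = - (pol xs)`_0 * \sum_(x <- xs) x^-1 /\
  2 * (pol xs)`_2 = (pol xs)`_0 *
     ((\sum_(x <- xs) x^-1) ^+ 2 - \sum_(x <- xs) x^-1 ^+ 2).
Proof.
elim: xs => [|x xs IH]; first by rewrite !big_nil !coef1 /= !(mulr0, expr0n, subrr).
rewrite inE negb_or eq_sym => /andP[x0 /IH[h1 h2]].
rewrite !big_cons !coef_XsubCM sub0r.
split; first by rewrite h1; field.
have -> : 2 * ((pol xs)`_1 - x * (pol xs)`_2) =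
   2 * (pol xs)`_1 - x * (2 * (pol xs)`_2) by ring.
by rewrite h2 h1; field.
Qed.

(** The factor X^2 shifts the indices, so that the three top coefficients make sense for every
    length and the induction can start at the empty list. *)
Lemma prod_XsubC_high xs :
  [/\ ('X^2 * pol xs)`_(size xs).+2 = 1,
      ('X^2 * pol xs)`_(size xs).+1 = - \sum_(x <- xs) x &
      2 * ('X^2 * pol xs)`_(size xs) =
        (\sum_(x <- xs) x) ^+ 2 - \sum_(x <- xs) x ^+ 2].
Proof.
elim: xs => [|x xs [h2 h1 h0]].
  rewrite !big_nil mulr1 !coefXn /=; split=> //; first by rewrite oppr0.
  by rewrite mulr0 expr0n subrr.
have E : 'X^2 * pol (x :: xs) = ('X - x%:P) * ('X^2 * pol xs).
  by rewrite big_cons mulrCA.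
have sz : (size ('X^2 * pol xs)%R <= (size xs).+3)%N.
  by rewrite mulrC size_mulXn ?monic_neq0 ?monic_prod_XsubC // size_prod_XsubC.
rewrite E !coef_XsubCM h2 h1 (nth_default _ sz) !big_cons; split.
- by rewrite mulr0 subr0.
- by ring.
- by rewrite mulrBr h0; ring.
Qed.

(** Logarithmic derivative. At c = 1 it yields the trace of beta, because z / (z - 1) = 1 - 1 / (1 -
    z). *)
Lemma deriv_prod_XsubC xs (c : F) : c \notin xs ->
  (pol xs)^`().[c] = (pol xs).[c] * \sum_(x <- xs) (c - x)^-1.
Proof.
elim: xs => [|x xs IH]; first by rewrite !big_nil -[1]/(1%:P) derivC horner0 mulr0.
rewrite inE negb_or -subr_eq0 => /andP[x0 /IH h].
rewrite !big_cons derivM derivXsubC mul1r hornerD !hornerM h hornerXsubC.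
by field.
Qed.

End symmetric_functions.

Section degree_bound.
Context (R : realType).
Implicit Types w : R[i].

(* With s = w^2 / (w - 1) the sum and product of w and w / (w - 1), the
   Schur-Cohn criterion |s| |1 - s| < 1 - |s|^2 yields |s|^3 |1 - s| < 1/4. *)
Lemma conjugate_region_bound w : normc w < 1 -> normc w < normc (1 - w) ->
  4 * normc w ^+ 6 * normc (w ^+ 2 - w + 1) <= normc (1 - w) ^+ 4.
Proof.
set r := normc w; set q := normc (1 - w); set g := normc _.
have r0 : 0 <= r := normc_ge0 _.
have q0 : 0 <= q := normc_ge0 _.
have g0 : 0 <= g := normc_ge0 _.
move=> r1 rq.
have e4 (x : R) : x ^+ 4 = x ^+ 2 ^+ 2 by rewrite -exprM.
have gE : g ^+ 2 = 1 - r ^+ 2 - q ^+ 2 + r ^+ 4 + q ^+ 4 - r ^+ 2 * q ^+ 2.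
  rewrite !e4 /g /r /q !sqr_normc_ReIm.
  case: w {r q g r0 q0 g0 r1 rq} => x y.
  have -> : (x +i* y) ^+ 2 - x +i* y + 1 = (x ^+ 2 - y ^+ 2 - x + 1) +i* (2 * x * y - y).
    by rewrite expr2; apply/eqP; rewrite eq_complex /=; apply/andP; split; apply/eqP; ring.
  have -> : 1 - x +i* y = (1 - x) +i* (- y).
    by apply/eqP; rewrite eq_complex /=; apply/andP; split; apply/eqP; ring.
  by move=> /=; ring.
have u1 : r ^+ 2 < 1 by rewrite expr_lt1.
have up : r ^+ 2 < q ^+ 2 by rewrite ltr_pXn2r.
have u0 : 0 <= r ^+ 2 by rewrite sqr_ge0.
have pu2 : 0 < q ^+ 2 - r ^+ 4.
  by rewrite e4; nra.
(* The Schur-Cohn inequality times q^2, with |s| = r^2 / q and |1 - s| = g / q. *)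
have schur : r ^+ 2 * g < q ^+ 2 - r ^+ 4.
  rewrite -(ltr_pXn2r (_ : (0 < 2)%N)) ?nnegrE ?mulr_ge0 ?(ltW pu2) //.
  rewrite exprMn gE -subr_gt0.
  have -> : (q ^+ 2 - r ^+ 4) ^+ 2 - (r ^+ 2) ^+ 2 *
     (1 - r ^+ 2 - q ^+ 2 + r ^+ 4 + q ^+ 4 - r ^+ 2 * q ^+ 2) =
     (1 - r ^+ 2) * (q ^+ 2 - r ^+ 2) * (q ^+ 2 + r ^+ 2 + q ^+ 2 * r ^+ 2) by ring.
  by rewrite !mulr_gt0 ?subr_gt0 // ltr_wpDr ?mulr_ge0 ?sqr_ge0 //;
    rewrite ltr_wpDr // (le_lt_trans u0).
have : 4 * r ^+ 6 * g <= 4 * r ^+ 4 * (q ^+ 2 - r ^+ 4).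
  have -> : 4 * r ^+ 6 * g = 4 * r ^+ 4 * (r ^+ 2 * g) by ring.
  by apply: ler_wpM2l (ltW schur); apply: mulr_ge0 => //; apply: exprn_ge0.
move=> /le_trans -> //; rewrite -subr_ge0.
(* This is 4 t (1 - t) <= 1 at t = |s|^2 = r^4 / q^2, cleared of denominators. *)
have -> : q ^+ 4 - 4 * r ^+ 4 * (q ^+ 2 - r ^+ 4) = (q ^+ 2 - 2 * r ^+ 4) ^+ 2 by ring.
exact: sqr_ge0.
Qed.

Lemma prod_conjugate_region_bound (ws : seq R[i]) :
  (forall w, w \in ws -> normc w < 1 /\ normc w < normc (1 - w)) ->
  4 ^+ size ws * (\prod_(w <- ws) normc w) ^+ 6 *
    \prod_(w <- ws) normc (w ^+ 2 - w + 1)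
  <= (\prod_(w <- ws) normc (1 - w)) ^+ 4.
Proof.
elim: ws => [|w ws IH] h; first by rewrite !big_nil !expr1n !mul1r.
have [w1 w2] : normc w < 1 /\ normc w < normc (1 - w) by apply: h; rewrite mem_head.
have {}IH := IH (fun v hv => h v (mem_behead (s := w :: ws) hv)).
rewrite !big_cons [size _]/= (exprS 4) !exprMn.
set a := 4 ^+ _ in IH *; set b := \prod_(_ <- _) _ in IH *.
set c := \prod_(_ <- _) normc (_ + _) in IH *; set d := \prod_(_ <- _) normc (_ - _) in IH *.
have -> : 4 * a * (normc w ^+ 6 * b ^+ 6) * (normc (w ^+ 2 - w + 1) * c) =
  (4 * normc w ^+ 6 * normc (w ^+ 2 - w + 1)) * (a * b ^+ 6 * c) by ring.
have x0 : 0 <= 4 * normc w ^+ 6 * normc (w ^+ 2 - w + 1).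
  by apply: mulr_ge0; [apply: mulr_ge0 => //; apply: exprn_ge0|]; exact: normc_ge0.
have y0 : 0 <= a * b ^+ 6 * c.
  apply: mulr_ge0; first apply: mulr_ge0.
  - exact: exprn_ge0.
  - by apply/exprn_ge0/prodr_ge0 => ? _; exact: normc_ge0.
  - by apply: prodr_ge0 => ? _; exact: normc_ge0.
exact: ler_pM x0 y0 (conjugate_region_bound w1 w2) IH.
Qed.

End degree_bound.

(** Multiplying by u^n clears the powers of y = 1/u: up to a power of the variable, [b] is Q with
    its coefficients reversed. *)
Lemma horner_inverse (K : numFieldType) (u y : K) (Q : {poly int}) n :
  u * y = 1 -> (size Q <= n.+1)%N ->
  exists b : {poly int}, u ^+ n * (intp Q).[y] = (intp b).[u].
Proof.
move=> uy; elim/poly_ind: Q n => [|Q c IH] n sQ.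
  by exists 0; rewrite !rmorph0 !horner0 mulr0.
have hc : u ^+ n * c%:~R = (intp (c *: 'X^n)).[u].
  by rewrite map_polyZ map_polyXn hornerZ hornerXn mulrC.
rewrite rmorphD rmorphM /= map_polyX map_polyC hornerD hornerMX hornerC mulrDr hc.
case: n sQ hc => [|n] sQ hc.
  have -> : Q = 0.
    apply/eqP; rewrite -size_poly_eq0 -leqn0 -ltnS.
    have [->|Q0] := eqVneq Q 0; first by rewrite size_poly0.
    by move: sQ; rewrite size_MXaddC (negbTE Q0).
  by exists (c *: 'X^0); rewrite rmorph0 horner0 mul0r mulr0 add0r.
have [|b bE] := IH n.
  have [->|Q0] := eqVneq Q 0; first by rewrite size_poly0.
  by move: sQ; rewrite size_MXaddC (negbTE Q0).
exists (b + c *: 'X^(n.+1)).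
rewrite rmorphD hornerD -bE exprS.
have -> : u * u ^+ n * ((intp Q).[y] * y) = (u * y) * (u ^+ n * (intp Q).[y]) by ring.
by rewrite uy mul1r.
Qed.

(** Multiply the monic equation of y, of degree m + 1, by u^m: the leading term becomes y and the
    others become integer polynomials in u. *)
Lemma integral_inverse_horner (K : numFieldType) (u y : K) :
  u * y = 1 -> algebraic_integer y ->
  exists b : {poly int}, (intp b).[u] = y.
Proof.
move=> uy [Q Qm Qy].
have [m sQ] : exists m, size Q = m.+1.
  by exists (size Q).-1; rewrite prednK // size_poly_gt0 monic_neq0.
have lQ : Q`_m = 1 by move: Qm; rewrite monicE /lead_coef sQ => /eqP.
case: m sQ lQ => [|m] sQ lQ.
  have Q1 : Q = 1 by rewrite [Q]size1_polyC ?sQ // lQ.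
  by move: Qy; rewrite Q1 rmorph1 (negbTE (root1 _)).
have sQ' : (size (Q - 'X^(m.+1))%R <= m.+1)%N.
  apply/leq_sizeP => j; rewrite leq_eqVlt => /orP[/eqP <-|mj].
    by rewrite coefB coefXn lQ eqxx subrr.
  by rewrite coefB coefXn gtn_eqF // subr0 nth_default // sQ.
have [b bE] := horner_inverse uy sQ'.
exists (- b); rewrite rmorphN hornerN -bE rmorphB hornerD hornerN /= (rootP Qy).
rewrite map_polyXn hornerXn sub0r mulrN opprK exprS mulrCA -exprMn uy.
by rewrite expr1n mulr1.
Qed.

Lemma algebraic_integerD (K : numFieldType) (x y : K) :
  algebraic_integer x -> algebraic_integer y -> algebraic_integer (x + y).
Proof. exact: (@integral_add _ _ (intr : {rmorphism int -> K})). Qed.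

Lemma algebraic_integer_int (K : numFieldType) (c : int) :
  algebraic_integer (c%:~R : K).
Proof. exact: (@integral_id _ _ (intr : {rmorphism int -> K})). Qed.

(** Applied at c = 0 and c = 1. The identity inverts X - c modulo P, hence inverts w - c at every
    conjugate w at once; evaluated at c it shows that P(c) divides 1. *)
Lemma int_minpoly_unit (K : numFieldType) (x : K) (c : int) (P : {poly int}) :
  int_minpoly x P -> x != c%:~R -> algebraic_integer (x - c%:~R)^-1 ->
  (P.[c] = 1 \/ P.[c] = -1) /\
  exists b S : {poly int}, ('X - c%:P) * b = 1 + P * S.
Proof.
move=> PP xc hy.
have xcV : (x - c%:~R) * (x - c%:~R)^-1 = 1 by rewrite mulfV // subr_eq0.
have [b bE] := integral_inverse_horner xcV hy.
pose B := ('X - c%:P) * (b \Po ('X - c%:P)) - 1.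
have Bx : root (intp B) x.
  rewrite rootE /B rmorphB rmorphM /= map_comp_poly rmorphB /= map_polyX map_polyC.
  by rewrite rmorph1 hornerD hornerN hornerM horner_comp !hornerE bE xcV subrr.
have [S SE] := int_minpoly_dvd PP Bx.
have E : ('X - c%:P) * (b \Po ('X - c%:P)) = 1 + P * S.
  by rewrite -SE /B [RHS]addrC subrK.
split; last by exists (b \Po ('X - c%:P)), S.
have : P.[c] * (- S.[c]) = 1.
  have /(congr1 (fun p => p.[c])) := E.
  rewrite hornerM hornerXsubC subrr mul0r hornerD hornerM -[1]/(1%:P) hornerC.
  by move=> /eqP; rewrite eq_sym addrC addr_eq0 => /eqP h; rewrite mulrN h opprK.
move=> h; have /intUnitRing.unitzPl : - S.[c] * P.[c] = 1 by rewrite mulrC.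
by move=> /orP[] /eqP ->; [left|right].
Qed.

Section unit_roots.
Context (R : realType) (x : R) (P : {poly int}).
Hypothesis xP : int_minpoly x P.

Lemma int_minpoly_split : exists ws : seq R[i],
  [/\ intp P = \prod_(z <- x%:C :: ws) ('X - z%:P),
      uniq (x%:C :: ws) & forall z, root (intp P) z = (z \in x%:C :: ws)].
Proof.
have [Pm Pirr Px] := xP.
have [r rE] := closed_field_poly_normal (intp P : {poly R[i]}).
have {}rE : intp P = \prod_(z <- r) ('X - z%:P).
  by rewrite rE (monicP _) ?scale1r // monic_map.
have rootr z : root (intp P) z = (z \in r) by rewrite rE root_prod_XsubC.
have ur : uniq r by rewrite -separable_prod_XsubC -rE; exact: int_minpoly_separable xP _.
have xr : x%:C \in r.
  rewrite -rootr rootE; have := rmorph_root (real_complex R) Px.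
  rewrite -map_poly_comp rootE; congr (_.[_] == 0); apply: eq_map_poly => i /=.
  by rewrite rmorph_int.
have pr := perm_to_rem xr.
exists (rem x%:C r); split.
- by rewrite rE (perm_big _ pr).
- by rewrite -(perm_uniq pr).
- by move=> z; rewrite rootr (perm_mem pr).
Qed.

End unit_roots.

Lemma intp_real_complex (R : realType) (p : {poly int}) (x : R) :
  (intp p).[x%:C] = ((intp p).[x])%:C.
Proof.
rewrite -horner_map -map_poly_comp; congr (_.[_]); apply: eq_map_poly => i /=.
by rewrite rmorph_int.
Qed.

(** * The resultant with the sixth cyclotomic polynomial *)

Section cyclotomic_value.
Context (R : realType).

Lemma exists_sixth_root : exists w : R[i], w ^+ 2 - w + 1 = 0.
Proof.
exists ((1 + sqrtc (-3)) / 2).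
have h : sqrtc (-3) ^+ 2 = -3 :> R[i] by rewrite sqr_sqrtc.
have -> : ((1 + sqrtc (-3)) / 2) ^+ 2 - (1 + sqrtc (-3)) / 2 + 1 =
  (sqrtc (-3) ^+ 2 + 3) / 4 :> R[i] by field.
by rewrite h addNr mul0r.
Qed.

Lemma sixth_root_horner (P : {poly int}) : exists a b : int, forall z : R[i], z ^+ 2 - z + 1 = 0 ->
    (intp P).[z] = a%:~R + b%:~R * z.
Proof.
elim/poly_ind: P => [|P c [a [b h]]].
  by exists 0, 0 => z _; rewrite rmorph0 horner0; ring.
exists (c - b), (a + b) => z z0.
rewrite rmorphD rmorphM /= map_polyX map_polyC hornerD hornerMX hornerC h // rmorphB rmorphD /=.
have zz : z ^+ 2 = z - 1 by apply/eqP; rewrite -subr_eq0 opprB addrA addrAC z0.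
have -> : (a%:~R + b%:~R * z) * z = a%:~R * z + b%:~R * z ^+ 2 by ring.
by rewrite zz; ring.
Qed.

Lemma sixth_root_normc (w : R[i]) : w ^+ 2 - w + 1 = 0 -> normc w = 1.
Proof.
move=> w0; have w3 : w ^+ 3 = -1.
  apply/eqP; rewrite -addr_eq0; apply/eqP.
  have -> : w ^+ 3 + 1 = (w + 1) * (w ^+ 2 - w + 1) by ring.
  by rewrite w0 mulr0.
apply/eqP; rewrite -(@pexpr_eq1 _ _ 3) ?normc_ge0 // -normcX w3.
by rewrite normcN normc1.
Qed.

(** The product equals |P(w) P(1 - w)| for the primitive sixth roots of unity w and 1 - w. With P(w)
    = a + b w this is the norm a^2 + a b + b^2 of an Eisenstein integer, a nonzero integer. *)
Lemma prod_sixth_root_ge1 (xs : seq R[i]) (P : {poly int}) :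
  intp P = \prod_(x <- xs) ('X - x%:P) ->
  (forall w : R[i], w ^+ 2 - w + 1 = 0 -> w \notin xs) ->
  1 <= \prod_(x <- xs) normc (x ^+ 2 - x + 1).
Proof.
move=> PE xsN; have [w w0] := exists_sixth_root.
have [a [b h]] := sixth_root_horner P.
have w0' : (1 - w) ^+ 2 - (1 - w) + 1 = 0 by rewrite -w0; ring.
have Pv z : (intp P).[z] = \prod_(x <- xs) (z - x).
  by rewrite PE horner_prod; apply: eq_bigr => x _; rewrite hornerXsubC.
have -> : \prod_(x <- xs) normc (x ^+ 2 - x + 1) =
   normc ((intp P).[w] * (intp P).[1 - w]).
  rewrite !Pv -big_split normc_prod; apply: eq_bigr => x _ /=; congr normc.
  have -> : (w - x) * (1 - w - x) = x ^+ 2 - x + 1 - (w ^+ 2 - w + 1) by ring.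
  by rewrite w0 subr0.
have P0 (z : R[i]) : z ^+ 2 - z + 1 = 0 -> (intp P).[z] != 0.
  move=> z0; have := xsN z z0; apply: contra.
  by rewrite PE -rootE root_prod_XsubC.
have E : (intp P).[w] * (intp P).[1 - w] = (a ^+ 2 + a * b + b ^+ 2)%:~R.
  rewrite !h // !(rmorphD, rmorphM, rmorphXn) /=.
  have -> : (a%:~R + b%:~R * w) * (a%:~R + b%:~R * (1 - w)) =
    a%:~R ^+ 2 + a%:~R * b%:~R + b%:~R ^+ 2
     - b%:~R ^+ 2 * (w ^+ 2 - w + 1) :> R[i] by ring.
  by rewrite w0 mulr0 subr0.
have : (intp P).[w] * (intp P).[1 - w] != 0 by rewrite mulf_neq0 ?P0.
rewrite E; set n := (_ + _)%R => n0.
have -> : n%:~R = (n%:~R : R)%:C by rewrite rmorph_int.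
rewrite normc_real -intr_norm -[1]/(1%:~R) ler_int.
by move: n0; rewrite intr_eq0; lia.
Qed.

End cyclotomic_value.

(** [ws] are the conjugates other than x. [sr_half] puts the conjugates w / (w - 1) of beta in the
    unit disc; [sr_coef0] and [sr_val1] record that x and x - 1 have norm 1 or -1. *)
Record special_roots (R : realType) (x : R) (P : {poly int}) (ws : seq R[i]) :
    Prop := SpecialRoots {
  sr_gt1 : 1 < x;
  sr_minpoly : int_minpoly x P;
  sr_split : intp P = \prod_(z <- x%:C :: ws) ('X - z%:P);
  sr_disc : in_punctured_disc ws;
  sr_half : forall w, w \in ws -> normc w < normc (1 - w);
  sr_coef0 : P`_0 = 1 \/ P`_0 = -1;
  sr_val1 : P.[1] = -1 }.

Lemma intr_horner (K : numFieldType) (P : {poly int}) (c : int) :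
  (P.[c])%:~R = (intp P).[c%:~R] :> K.
Proof. by rewrite horner_map. Qed.

Lemma special_pisot_unit_gt1 (R : realType) (x : R) :
  special_pisot_unit x -> 1 < x.
Proof. by move=> [[[_ x1 _] _] _]. Qed.

Lemma special_pisot_unit_inverses (R : realType) (x : R) :
  special_pisot_unit x ->
  [/\ x != 0%:~R, algebraic_integer (x - 0%:~R)^-1, x != 1%:~R &
      algebraic_integer (x - 1%:~R)^-1].
Proof.
move=> sx; have x1 := special_pisot_unit_gt1 sx.
have [[px [bint _ _]] [x0 _ xV]] := sx; split=> //.
- by rewrite subr0.
- by rewrite gt_eqF.
- have -> : (x - 1%:~R)^-1 = beta x + (-1)%:~R.
    by rewrite /beta; field; rewrite subr_eq0 gt_eqF.
  by apply: algebraic_integerD bint _; exact: algebraic_integer_int.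
Qed.

Lemma special_pisot_unit_roots (R : realType) (x : R) :
  special_pisot_unit x -> exists P ws, special_roots x P ws.
Proof.
move=> sx; have x1 := special_pisot_unit_gt1 sx.
have [x0 xV x10 x1V] := special_pisot_unit_inverses sx.
have [[[xint _ xconj] [bint b1 bconj]] _] := sx.
have [P xP] := int_minpoly_exists xint.
have [P0 _] := int_minpoly_unit xP x0 xV.
have [P1 [b [S bE]]] := int_minpoly_unit xP x10 x1V.
have [ws [PE uxs Proot]] := int_minpoly_split xP.
have wsP w : w \in ws -> [/\ root (intp P) w, w != x%:C & w != 0].
  move=> wws; split.
  - by rewrite Proot inE wws orbT.
  - by move: uxs => /= /andP[xws _]; apply: contraNneq xws => <-.
  - apply: contraPneq P0 => w0; have : root (intp P) w by rewrite Proot inE wws orbT.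
    rewrite w0 rootE -[0]/(0%:~R) -intr_horner intr_eq0 => /eqP ->.
    by case.
have discws : in_punctured_disc ws.
  move=> w /wsP[rw wx w0]; split=> //.
  rewrite -normc_lt; apply: xconj => //.
  by apply/(int_minpoly_conj _ xP).
exists P, ws; split=> //.
- move=> w wws; have [rw wx w0] := wsP w wws; have [_ w1] := discws w wws.
  have w10 : w - 1 != 0.
    by rewrite subr_eq0; apply: contraTneq w1 => ->; rewrite normc1 ltxx.
  (* Modulo P, [b] inverts X - 1, and beta = 1 + 1 / (x - 1); so [b + 1] represents beta at every
     root. *)
  have bhorner (K : numFieldType) (z : K) : root (intp P) z -> z - 1 != 0 ->
      (intp (b + 1)).[z] = z / (z - 1).
    move=> rz z1; rewrite rmorphD rmorph1 hornerD -polyC1 hornerC.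
    have : (z - 1) * (intp b).[z] = 1.
      have /(congr1 (fun p => (intp p : {poly K}).[z])) := bE.
      rewrite rmorphM rmorphB rmorphD rmorphM rmorph1 /= map_polyX -polyC1.
      by rewrite hornerM hornerXsubC hornerD hornerM (rootP rz) mul0r addr0 hornerC.
    by move=> h; apply: (mulfI z1); rewrite mulrDr h mulrCA mulfV // mulr1; ring.
  have xb : (intp (b + 1)).[x] = beta x.
    by rewrite bhorner ?subr_eq0 //; case: xP.
  have wb := bhorner _ w rw w10.
  have : galois_conj (intp (b + 1)).[x] (intp (b + 1)).[w].
    apply: galois_conj_horner; last by rewrite xb.
    by apply/(int_minpoly_conj _ xP).
  rewrite xb wb => /bconj.
  have nb : w / (w - 1) != (beta x)%:C.
    apply: contra_neq wx; rewrite /beta rmorphM fmorphV rmorphB rmorph1 /= => h.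
    have xC : (x%:C - 1) != 0 :> R[i].
      by rewrite -(rmorph1 (real_complex R)) -rmorphB fmorph_eq0 subr_eq0.
    have /eqP : w * (x%:C - 1) = x%:C * (w - 1).
      by apply/eqP; rewrite -eqr_div //; exact/eqP.
    rewrite !mulrBr !mulr1 [w * _]mulrC -subr_eq0 => /eqP h2.
    by apply/eqP; rewrite -subr_eq0 -oppr_eq0; apply/eqP; rewrite -h2; ring.
  move=> /(_ nb); rewrite normc_lt normcM normcV ltr_pdivrMr ?normc_gt0 // mul1r.
  by rewrite normc_dist.
- by rewrite -horner_coef0.
(* The sign of P(1): the cofactor Q of X - x is positive at infinity and has no real root beyond 1,
   its roots lying in the open disc. So Q(1) > 0 and P(1) = Q(1) (1 - x) < 0. *)
- case: P1 => // P1; exfalso.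
  have [_ _ Px] := xP; have /factor_theorem[Q QE] := Px.
  have PEC : map_poly (real_complex R) Q = \prod_(z <- ws) ('X - z%:P).
    apply: (mulIf (x := 'X - x%:C%:P)); first by rewrite polyXsubC_eq0.
    have {}PE : intp P = ('X - x%:C%:P) * \prod_(z <- ws) ('X - z%:P) by rewrite PE big_cons.
    rewrite [RHS]mulrC -PE -map_polyXsubC -rmorphM /= -QE -map_poly_comp.
    by apply: eq_map_poly => i /=; rewrite rmorph_int.
  have Qm : Q \is monic.
    by rewrite -(map_monic (real_complex R)) PEC monic_prod_XsubC.
  have Q1 : 0 < Q.[1].
    rewrite ltNge; apply/negP => Q1.
    have [|N HN] := poly_pinfty_gt_lc (p := Q); first by rewrite (monicP Qm).
    have lN : 1 <= Num.max 1 N by rewrite le_max lexx.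
    have [|t] := polyrcf.poly_ivt (p := Q) lN.
      rewrite mulr_le0_ge0 //; apply: le_trans (HN _ _).
        by rewrite (monicP Qm).
      by rewrite le_max lexx orbT.
    rewrite in_itv /= => /andP[t1 _] rt.
    have : t%:C \in ws.
      by rewrite -root_prod_XsubC -PEC; exact: rmorph_root.
    move=> /discws[_]; rewrite normc_real ltNge => /negP; apply.
    by rewrite (le_trans t1) // ler_norm.
  have : (P.[1])%:~R = Q.[1] * (1 - x) :> R.
    by rewrite intr_horner QE hornerM hornerXsubC.
  rewrite P1 => h; have : Q.[1] * (1 - x) < 0 by rewrite pmulr_rlt0 // subr_lt0.
  by rewrite -h ltr10.
Qed.

(** * Classification of the special Pisot units *)

Section special_bounds.
Context (R : realType) (x : R) (P : {poly int}) (ws : seq R[i]).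
Hypothesis sr : special_roots x P ws.

Local Notation n := (size ws).

Let x1 : 1 < x. Proof. exact: sr_gt1 sr. Qed.
Let x0 : 0 < x. Proof. exact: lt_trans ltr01 x1. Qed.
Let xm1 : 0 < x - 1. Proof. by rewrite subr_gt0. Qed.

Lemma sr_horner (z : R[i]) :
  (intp P).[z] = (z - x%:C) * \prod_(w <- ws) (z - w).
Proof.
rewrite (sr_split sr) horner_prod big_cons hornerXsubC; congr (_ * _).
by apply: eq_bigr => w _; rewrite hornerXsubC.
Qed.

Lemma sr_root : (intp P).[x] = 0.
Proof. by have [_ _ /rootP] := sr_minpoly sr. Qed.

Lemma sr_size : size P = n.+2.
Proof.
have := congr1 (fun p : {poly R[i]} => size p) (sr_split sr).
rewrite size_prod_XsubC size_map_poly_id0 // intr_eq0 lead_coef_eq0 monic_neq0 //.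
by case: (sr_minpoly sr).
Qed.

Lemma sr_monic : P`_n.+1 = 1.
Proof.
have [Pm _ _] := sr_minpoly sr.
by move: Pm; rewrite monicE /lead_coef sr_size => /eqP.
Qed.

Lemma sr_coef0_sqr : P`_0 * P`_0 = 1.
Proof. by case: (sr_coef0 sr) => ->. Qed.

Lemma sr_norm : x * \prod_(w <- ws) normc w = 1.
Proof.
have := congr1 (@normc R) (sr_horner 0).
rewrite horner_coef0 coef_map /= sub0r normcM normcN normc_prod normc_real.
rewrite (ger0_norm (ltW x0)) => E.
have -> : x * \prod_(w <- ws) normc w = normc ((P`_0)%:~R : R[i]).
  by rewrite E; congr (_ * _); apply: eq_bigr => w _; rewrite sub0r normcN.
by case: (sr_coef0 sr) => ->; rewrite ?rmorphN ?normcN rmorph1 normc1.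
Qed.

Lemma sr_norm1 : (x - 1) * \prod_(w <- ws) normc (1 - w) = 1.
Proof.
have := congr1 (@normc R) (sr_horner 1).
rewrite -[1 in LHS]/(1%:~R) -intr_horner (sr_val1 sr) normcM normc_prod.
have -> : normc (1 - x%:C) = x - 1.
  have -> : 1 - x%:C = (1 - x)%:C by rewrite rmorphB rmorph1.
  by rewrite normc_real distrC ger0_norm // ltW.
by move=> <-; rewrite rmorphN normcN rmorph1 normc1.
Qed.

(** Multiply the region bound over all conjugates, then trade each product for a value at x by means
    of norms: x and x - 1 have norm 1 or -1, and x^2 - x + 1 has a norm of modulus at least 1. *)
Lemma sr_degree_bound : 4 ^+ n * (x - 1) ^+ 4 <= x ^+ 6 * (x ^+ 2 - x + 1).
Proof.
have disc := sr_disc sr; have half := sr_half sr.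
have bound : 4 ^+ n * (\prod_(w <- ws) normc w) ^+ 6 *
    \prod_(w <- ws) normc (w ^+ 2 - w + 1) <= (\prod_(w <- ws) normc (1 - w)) ^+ 4.
  apply: prod_conjugate_region_bound => w wws.
  by split; [have [] := disc w wws | exact: half].
have : 1 <= \prod_(z <- x%:C :: ws) normc (z ^+ 2 - z + 1).
  apply: (prod_sixth_root_ge1 (sr_split sr)) => z /sixth_root_normc z1.
  rewrite inE negb_or; apply/andP; split.
    apply: contra_eq_neq z1 => ->; rewrite normc_real gtr0_norm //.
    by rewrite gt_eqF.
  by apply: contra_eqN z1 => /disc[_ ?]; rewrite lt_eqF.
rewrite big_cons.
have -> : normc (x%:C ^+ 2 - x%:C + 1) = x ^+ 2 - x + 1.
  have -> : x%:C ^+ 2 - x%:C + 1 = (x ^+ 2 - x + 1)%:C.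
    by rewrite rmorphD rmorphB rmorphXn rmorph1.
  by rewrite normc_real ger0_norm //; nra.
move: bound (sr_norm) (sr_norm1).
set A := \prod_(w <- ws) normc w; set B := \prod_(w <- ws) normc (_ + _).
set C := \prod_(w <- ws) normc (_ - _) => bound hA hC hB.
have A0 : 0 <= A by apply: prodr_ge0 => ? _; exact: normc_ge0.
have q0 : 0 < x ^+ 2 - x + 1 by nra.
have c0 : 0 <= 4 ^+ n * (x - 1) ^+ 4 :> R.
  by apply: mulr_ge0; apply: exprn_ge0 => //; exact: ltW.
have -> : 4 ^+ n * (x - 1) ^+ 4 = (4 ^+ n * (x - 1) ^+ 4) * (x * A) ^+ 6.
  by rewrite hA expr1n mulr1.
have e : (4 ^+ n * A ^+ 6 * B) * (x - 1) ^+ 4 <= 1.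
  have hC4 : ((x - 1) * C) ^+ 4 = 1 by rewrite hC expr1n.
  rewrite -[leRHS]hC4 exprMn [leLHS]mulrC; apply: ler_wpM2l => //.
  by apply: exprn_ge0; exact: ltW.
apply: (@le_trans _ _ (((4 ^+ n * (x - 1) ^+ 4) * (x * A) ^+ 6) * ((x ^+ 2 - x + 1) * B))).
  by apply: ler_peMr hB; apply: mulr_ge0 => //; rewrite hA expr1n.
have -> : (4 ^+ n * (x - 1) ^+ 4) * (x * A) ^+ 6 * ((x ^+ 2 - x + 1) * B) =
   (x ^+ 6 * (x ^+ 2 - x + 1)) * ((4 ^+ n * A ^+ 6 * B) * (x - 1) ^+ 4) by ring.
apply: ler_piMr e; apply: mulr_ge0; last exact: ltW.
by apply: exprn_ge0; exact: ltW.
Qed.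

Lemma sr_neq0 : 0 \notin x%:C :: ws.
Proof.
rewrite inE negb_or; apply/andP; split.
  rewrite eq_sym -(rmorph0 (real_complex R)); apply: contraTneq x1 => /complexI ->.
  by rewrite -leNgt ler01.
by apply/negP => /(sr_disc sr)[]; rewrite eqxx.
Qed.

Lemma sr_neq1 : 1 \notin x%:C :: ws.
Proof.
rewrite inE negb_or; apply/andP; split.
  rewrite eq_sym -(rmorph1 (real_complex R)); apply: contraTneq x1 => /complexI ->.
  by rewrite ltxx.
by apply/negP => /(sr_disc sr)[_]; rewrite normc1 ltxx.
Qed.

Lemma sr_sum : \sum_(z <- x%:C :: ws) z = - (P`_n)%:~R.
Proof.
have [_ h _] := prod_XsubC_high (x%:C :: ws).
move: h; rewrite -(sr_split sr) coefXnM /= subSS subn1 /= coef_map => ->.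
by rewrite opprK.
Qed.

Lemma sr_sum_sqr : (0 < n)%N ->
  \sum_(z <- x%:C :: ws) z ^+ 2 = (P`_n ^+ 2 - 2 * P`_n.-1)%:~R.
Proof.
move=> n0; have [_ _] := prod_XsubC_high (x%:C :: ws).
rewrite -(sr_split sr) coefXnM /= sr_sum.
rewrite ltnS ltnNge n0 /= subSS subn1 coef_map /= => E.
rewrite rmorphB rmorphXn rmorphM /= -[2%:~R]/2 E sqrrN; ring.
Qed.

Lemma sr_sum_inv : \sum_(z <- x%:C :: ws) z^-1 = - (P`_0 * P`_1)%:~R.
Proof.
have [h _] := prod_XsubC_low sr_neq0.
move: h; rewrite -(sr_split sr) !coef_map /= => h.
rewrite rmorphM /= h mulrA mulrN -rmorphM sr_coef0_sqr rmorph1 mulN1r opprK.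
by [].
Qed.

Lemma sr_sum_inv_sqr :
  \sum_(z <- x%:C :: ws) z^-1 ^+ 2 = (P`_1 ^+ 2 - 2 * P`_0 * P`_2)%:~R.
Proof.
have [_] := prod_XsubC_low sr_neq0.
rewrite -(sr_split sr) sr_sum_inv !coef_map /= => h.
have p00 : (P`_0)%:~R * (P`_0)%:~R = 1 :> R[i] by rewrite -rmorphM sr_coef0_sqr.
rewrite rmorphB rmorphXn !rmorphM /= -[2%:~R]/2.
rewrite rmorphM /= in h; move: h p00; set S := \sum_(_ <- _) _.
set a0 : R[i] := (P`_0)%:~R; set a1 : R[i] := (P`_1)%:~R; set a2 : R[i] := (P`_2)%:~R.
move=> h p00; have : 2 * a0 * a2 = (a0 * a0) * ((a0 * a0) * a1 ^+ 2 - S).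
  by transitivity (a0 * (2 * a2)); [ring | rewrite h; ring].
by rewrite p00 !mul1r => ->; ring.
Qed.

Lemma sr_sum_shift_inv : \sum_(z <- x%:C :: ws) (1 - z)^-1 = - (P^`().[1])%:~R.
Proof.
have := deriv_prod_XsubC sr_neq1; rewrite -(sr_split sr) deriv_map.
rewrite -[1 in X in X -> _]/(1%:~R) -!intr_horner (sr_val1 sr) => ->.
by rewrite rmorphN mulN1r opprK.
Qed.

Lemma int_trace_gap (k : int) (y : R) :
  (k%:~R : R) < 0 -> - k%:~R < 2 * (y - y^-1) ->
  k <= -1 /\ - k%:~R < 2 * (y - y^-1).
Proof. by move=> h1 h2; split=> //; move: h1; rewrite ltrz0; lia. Qed.

(** [T] is the trace of 1/x - x. *)
Lemma sr_trace : (1 < n)%N ->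
  let T := P`_n - P`_0 * P`_1 in T <= -1 /\ - T%:~R < 2 * (x - x^-1).
Proof.
move=> n1 T; apply: int_trace_gap => //.
all: have := @trace_inverse_bound _ x (- (P`_n)%:~R) (- (P`_0 * P`_1)%:~R) ws
  x1 (sr_disc sr) n1 sr_norm.
all: have := sr_sum; have := sr_sum_inv; rewrite !big_cons => -> ->.
all: rewrite !rmorphN !rmorph_int => /(_ erefl erefl)[h1 h2].
all: by rewrite /T rmorphB /=; lra.
Qed.

(** [T] is the trace of 1/beta - beta, computed through 1/beta = 1 - 1/x and beta = 1 - 1 / (1 -
    x). *)
Lemma sr_trace_beta : (1 < n)%N ->
  let T := P`_0 * P`_1 - P^`().[1] in
  T <= -1 /\ - T%:~R < 2 * (x / (x - 1) - (x - 1) / x).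
Proof.
move=> n1 T.
have xx1 : x / (x - 1) - (x - 1) / x = x / (x - 1) - (x / (x - 1))^-1.
  by rewrite invf_div.
have w1 w : w \in ws -> w - 1 != 0.
  move=> /(sr_disc sr)[_ h]; rewrite subr_eq0.
  by apply: contraTneq h => ->; rewrite normc1 ltxx.
have xC1 : x%:C - 1 != 0 :> R[i].
  by rewrite -(rmorph1 (real_complex R)) -rmorphB fmorph_eq0 gt_eqF.
have xC0 : x%:C != 0 :> R[i] by rewrite fmorph_eq0 gt_eqF.
have all1 z : z \in x%:C :: ws -> z - 1 != 0.
  by rewrite inE => /orP[/eqP->|/w1].
have all0 z : z \in x%:C :: ws -> z != 0.
  by move=> h; apply: contraNneq sr_neq0 => <-.
pose us := [seq w / (w - 1) | w <- ws].
have hus : in_punctured_disc us.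
  move=> u /mapP[w wws ->]; have [w0 _] := sr_disc sr wws; have wm := w1 w wws.
  split; first by rewrite mulf_neq0 // invr_eq0.
  rewrite normcM normcV ltr_pdivrMr ?normc_gt0 // mul1r normc_dist.
  exact: (sr_half sr).
have prodE : x / (x - 1) * \prod_(u <- us) normc u = 1.
  rewrite big_map; have -> : \prod_(w <- ws) normc (w / (w - 1)) =
      (\prod_(w <- ws) normc w) / \prod_(w <- ws) normc (1 - w).
    rewrite -prodf_div; apply: eq_bigr => w _.
    by rewrite normcM normcV normc_dist.
  have -> : x / (x - 1) * (\prod_(w <- ws) normc w / \prod_(w <- ws) normc (1 - w))
    = (x * \prod_(w <- ws) normc w) / ((x - 1) * \prod_(w <- ws) normc (1 - w)).
    by rewrite mulf_div.
  by rewrite sr_norm sr_norm1 divr1.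
have sumE : \sum_(z <- x%:C :: ws) z / (z - 1) = (n.+1%:Z + P^`().[1])%:~R.
  transitivity (\sum_(z <- x%:C :: ws) (1 - (1 - z)^-1)).
    apply: eq_big_seq => z /all1 z1; have z2 : 1 - z != 0 by rewrite -opprB oppr_eq0.
    by field; rewrite z1 z2.
  rewrite sumrB sr_sum_shift_inv opprK rmorphD /= big_const_seq count_predT.
  by rewrite iter_addr addr0.
have sumVE : \sum_(z <- x%:C :: ws) (z / (z - 1))^-1 = (n.+1%:Z + P`_0 * P`_1)%:~R.
  transitivity (\sum_(z <- x%:C :: ws) (1 - z^-1)).
    by apply: eq_big_seq => z zin; field; rewrite (all1 z zin) (all0 z zin).
  rewrite sumrB sr_sum_inv opprK rmorphD /= big_const_seq count_predT.
  by rewrite iter_addr addr0.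
have y1 : 1 < x / (x - 1) by rewrite ltr_pdivlMr //; lra.
have := @trace_inverse_bound _ (x / (x - 1)) (n.+1%:Z + P^`().[1])%:~R
  (n.+1%:Z + P`_0 * P`_1)%:~R us y1 hus _ prodE.
rewrite size_map n1 !big_map !rmorph_int -sumE -sumVE !big_cons.
have -> : (x / (x - 1))%:C = x%:C / (x%:C - 1).
  by rewrite rmorphM fmorphV rmorphB rmorph1.
move=> /(_ isT erefl erefl)[h1 h2]; rewrite xx1; apply: int_trace_gap.
  by move: h1; rewrite /T !rmorphD rmorphN /=; lra.
by move: h2; rewrite /T !rmorphD rmorphN /=; lra.
Qed.

(** [T] is the trace of x^(-2) - x^2, by Newton's identities at both ends of P. *)
Lemma sr_trace_sqr : (1 < n)%N ->
  let T := P`_1 ^+ 2 - 2 * P`_0 * P`_2 - (P`_n ^+ 2 - 2 * P`_n.-1) in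
  T <= -1 /\ - T%:~R < 2 * (x ^+ 2 - x ^- 2).
Proof.
move=> n1 T; pose us := [seq w ^+ 2 | w <- ws].
have hus : in_punctured_disc us.
  move=> u /mapP[w wws ->]; have [w0 w1] := sr_disc sr wws.
  by rewrite expf_neq0 // normcX expr_lt1 // normc_ge0.
have prodE : x ^+ 2 * \prod_(u <- us) normc u = 1.
  transitivity ((x * \prod_(w <- ws) normc w) ^+ 2); last by rewrite sr_norm expr1n.
  rewrite big_map exprMn -prodrXl; congr (_ * _).
  by apply: eq_bigr => w _; rewrite normcX.
have y1 : 1 < x ^+ 2 by rewrite expr_gt1 // ltW.
have := sr_sum_inv_sqr; have := sr_sum_sqr (ltnW n1); rewrite !big_cons => sS sV.
have trA : (x ^+ 2)%:C + \sum_(u <- us) u = ((P`_n ^+ 2 - 2 * P`_n.-1)%:~R : R)%:C.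
  by rewrite big_map rmorph_int -sS rmorphXn.
have trB : (x ^+ 2)%:C^-1 + \sum_(u <- us) u^-1 =
    ((P`_1 ^+ 2 - 2 * P`_0 * P`_2)%:~R : R)%:C.
  rewrite big_map rmorph_int -sV rmorphXn exprVn; congr (_ + _).
  by apply: eq_bigr => w _; rewrite exprVn.
have us1 : (1 < size us)%N by rewrite size_map.
have [h1 h2] := trace_inverse_bound y1 hus us1 prodE trA trB.
by apply: int_trace_gap; rewrite /T [(_ - _)%:~R]rmorphB; lra.
Qed.

(** The left side is the trace of x, to which every other conjugate contributes a real part below
    1/2. *)
Lemma sr_trace_lt : (0 < n)%N -> - (P`_n)%:~R < x + n%:R / 2.
Proof.
move=> n0; have := congr1 (@complex.Re R) sr_sum.
have -> : complex.Re (- (P`_n)%:~R : R[i]) = - (P`_n)%:~R.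
  by rewrite -(rmorph_int (real_complex R)) -rmorphN.
rewrite big_cons raddfD /= => <-; rewrite ltrD2l.
have half w : w \in ws -> complex.Re w < 2^-1.
  by move=> /(sr_half sr); rewrite normc_lt_half.
elim: ws n0 half => [//|w [|v us] IH] _ half.
  by rewrite big_seq1 mul1r; apply: half; rewrite mem_head.
rewrite big_cons raddfD /= [ltRHS](_ : _ = 2^-1 + (size (v :: us))%:R / 2); last first.
  by rewrite /= [in LHS]mulrS mulrDl mul1r.
apply: ltrD; first by apply: half; rewrite mem_head.
by apply: IH => // u hu; apply: half; rewrite inE hu orbT.
Qed.

End special_bounds.

Lemma bump0 k : bump 0 k = k.+1.
Proof. by []. Qed.

Section classification.
Context (R : realType) (x : R) (P : {poly int}) (ws : seq R[i]).
Hypothesis sr : special_roots x P ws.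
Hypothesis x2 : x <= 2.

Let x1 : 1 < x. Proof. exact: sr_gt1 sr. Qed.

Lemma trace_gap_mul (k : R) : k < 2 * (x - x^-1) -> k * x < 2 * (x ^+ 2 - 1).
Proof.
have x0 : 0 < x := lt_trans ltr01 x1.
move=> h; have -> : 2 * (x ^+ 2 - 1) = 2 * (x - x^-1) * x.
  by field; rewrite gt_eqF.
by rewrite ltr_pM2r.
Qed.

Lemma special_lower_bound : (1 < size ws)%N -> x < 2 * (x ^+ 2 - 1).
Proof.
move=> n1; have [h1 h2] := sr_trace sr n1.
rewrite -[x in x < _]mul1r; apply: trace_gap_mul; apply: le_lt_trans h2.
by rewrite -rmorphN -[1]/(1%:~R) ler_int; lia.
Qed.

(* 32/25 is slightly below the positive root of 2 x^2 - x - 2. *)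
Lemma special_rational_lower_bound : (1 < size ws)%N -> 32 / 25 <= x.
Proof.
move=> n1; have gt1 := x1; have lb := special_lower_bound n1.
rewrite leNgt; apply/negP => h.
have : (x - 32 / 25) * (2 * x + 39 / 25) <= 0 by apply: mulr_le0_ge0; lra.
lra.
Qed.

(* Used with [c] an upper bound of x^2 / (x - 1) on the range left for [x]. *)
Lemma special_degree_bound (c a b : R) : x ^+ 2 <= c * (x - 1) -> 0 <= c ->
  c ^+ 2 <= a -> c * (c - 1) <= b -> 4 ^+ size ws <= a * b.
Proof.
move=> s1 c0 ca cb; have gt1 := x1; have y0 : 0 < x - 1 by lra.
have := sr_degree_bound sr.
have s2 : x ^+ 2 - x + 1 <= (c - 1) * (x - 1) by lra.
have q0 : 0 <= x ^+ 2 - x + 1 by nra.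
have p2 : 0 <= x ^+ 2 by apply: sqr_ge0.
have y4 : 0 < (x - 1) ^+ 4 by rewrite exprn_gt0.
have cx : 0 <= c * (x - 1) by rewrite mulr_ge0 // ltW.
have s3 : x ^+ 6 <= (c * (x - 1)) ^+ 3.
  by rewrite [leLHS](exprM x 2 3); apply: lerXn2r; rewrite ?nnegrE.
have x6 : 0 <= x ^+ 6 by rewrite exprn_ge0 //; lra.
have s4 : x ^+ 6 * (x ^+ 2 - x + 1) <= (c * (x - 1)) ^+ 3 * ((c - 1) * (x - 1)).
  exact: ler_pM.
have s5 : (c * (x - 1)) ^+ 3 * ((c - 1) * (x - 1)) =
    (c ^+ 2 * (c * (c - 1))) * (x - 1) ^+ 4 by ring.
move=> h; rewrite -(ler_pM2r y4); apply: (le_trans h); apply: (le_trans s4).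
rewrite s5 ler_pM2r //; apply: ler_pM => //; first exact: sqr_ge0.
have : 0 <= (c - 1) * (x - 1) := le_trans q0 s2.
by rewrite pmulr_lge0 // => ?; rewrite mulr_ge0.
Qed.

Lemma special_degree_le4 : (size ws <= 4)%N.
Proof.
rewrite leqNgt; apply/negP => n5.
have gt1 := x1; have lb := special_rational_lower_bound (leq_trans (isT : (1 < 5)%N) n5).
have : 4 ^+ size ws <= 35 * 29 :> R.
  (* On [32/25, 2] the quotient x^2 / (x - 1) is largest at 32/25, just below 59/10. The bounds 35
     and 29 suffice because 35 * 29 = 1015 < 4^5. *)
  apply: (@special_degree_bound (59 / 10)); last 3 first; try lra.
  have : 0 <= (x - 32 / 25) * (2 - x) by rewrite mulr_ge0 // subr_ge0.
  lra.
rewrite leNgt => /negP; apply; apply: (@lt_le_trans _ _ (4 ^+ 5)).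
  by rewrite !exprS expr0; lra.
by rewrite ler_eXn2l // ltr1n.
Qed.

Lemma special_degree4_bound : size ws = 4 -> x ^+ 2 < (17 / 4) * (x - 1) -> False.
Proof.
(* (73/4) * 14 = 255.5 is just below 4^4; 17/4 is chosen to reach this. *)
move=> n4 s1; have : 4 ^+ size ws <= (73 / 4) * 14 :> R.
  by apply: (@special_degree_bound (17 / 4)); try lra; apply: ltW.
by rewrite n4 !exprS expr0; lra.
Qed.

Lemma sr_sum_coef : \sum_(i < (size ws).+2) P`_i = -1.
Proof.
rewrite -(sr_val1 sr) horner_coef (sr_size sr).
by apply: eq_bigr => i _; rewrite expr1n mulr1.
Qed.

Lemma sr_sum_deriv : P^`().[1] = \sum_(i < (size ws).+1) P`_i.+1 *+ i.+1.
Proof.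
rewrite (@horner_coef_wide _ (size ws).+1).
  by apply: eq_bigr => i _; rewrite expr1n mulr1 coef_deriv.
by rewrite polyorder.size_deriv (sr_size sr).
Qed.

Lemma sr_root_coef : \sum_(i < (size ws).+2) (P`_i)%:~R * x ^+ i = 0.
Proof.
transitivity (intp P).[x]; last exact: sr_root sr.
rewrite (@horner_coef_wide _ (size ws).+2).
  by apply: eq_bigr => i _; rewrite coef_map.
by rewrite -(sr_size sr) size_poly.
Qed.

(** In the first case beta y = y^(k+1); in the second, y and beta y are the square and the cube of 1
    / (y - 1). *)
Definition special_equation (y : R) : Prop :=
  (exists2 k, (0 < k <= 4)%N & y ^+ k * (y - 1) = 1) \/ y * (y - 1) ^+ 2 = 1.

Lemma special_degree0 : size ws = 0 -> False.
Proof.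
move=> n0; have := sr_sum_coef; have := sr_monic sr; rewrite n0.
rewrite !big_ord_recl big_ord0 /= !bump0 => ->.
by case: (sr_coef0 sr) => ->.
Qed.

Lemma special_degree1 : size ws = 1 -> special_equation x.
Proof.
have gt1 := x1; have le2 := x2; move=> n1.
have := sr_root_coef; have := sr_sum_coef; have := sr_monic sr; rewrite n1.
rewrite !big_ord_recl !big_ord0 /= !bump0 => p2.
have := sr_coef0 sr.
rewrite p2; set p0 := P`_0; set p1 := P`_1.
move=> [] -> h.
  have -> : p1 = -3 by lia.
  move=> E; exfalso.
  have : 1 - 3 * x + x ^+ 2 = 0.
    by rewrite -E expr0 expr1 rmorphN /=; ring.
  have : 0 <= (x - 1) * (2 - x) by rewrite mulr_ge0 ?subr_ge0 // ltW.
  clear E h; nra.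
have -> : p1 = -1 by lia.
move=> E; left; exists 1 => //.
rewrite rmorphN /= in E; rewrite expr1 -[RHS]addr0 -E; ring.
Qed.

(** On ]1, 2] the bound 2 (x - 1/x) is at most 3, so only -1 and -2 remain, and -2 requires x to
    exceed the golden ratio. *)
Lemma special_trace_ge : (1 < size ws)%N ->
  let T := P`_(size ws) - P`_0 * P`_1 in
  T = -1 \/ (T = -2 /\ 0 < x ^+ 2 - x - 1).
Proof.
move=> n1 T; have gt1 := x1; have le2 := x2; have [h1 /trace_gap_mul h2] := sr_trace sr n1.
rewrite -/T in h1 h2.
have h3 : -3 < T.
  rewrite ltNge; apply/negP => h3; have : 3 <= - T%:~R :> R.
    by rewrite -rmorphN (ler_int _ 3); lia.
  move=> h4; have : 3 * x < 2 * (x ^+ 2 - 1).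
    by apply: le_lt_trans h2; rewrite ler_wpM2r //; lra.
  nra.
have [T1|T2] : T = -1 \/ T = -2 by lia.
  by left.
by right; split=> //; move: h2; rewrite T2 rmorphN opprK /= -[2%:~R]/2; lra.
Qed.

Lemma special_degree2 : size ws = 2 -> special_equation x.
Proof.
move=> n2; have n1 : (1 < size ws)%N by rewrite n2.
have gt1 := x1; have le2 := x2; have lb := special_rational_lower_bound n1.
have := special_trace_ge n1.
have := sr_root_coef; have := sr_sum_coef; have := sr_monic sr; rewrite n2.
rewrite !big_ord_recl !big_ord0 /= !bump0 => p3.
have := sr_coef0 sr; rewrite p3.
move: P`_0 P`_1 P`_2 => p0 p1 p2 [] -> hsum hroot hT.
  (* Here p1 + p2 = -3 is odd, so the difference p2 - p1 must be -1. *)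
  have [e1 e2] : p1 = -1 /\ p2 = -2 by lia.
  exfalso; move: hroot; rewrite e1 e2 !rmorphN /= => hroot.
  have : 1 - x - 2 * x ^+ 2 + x ^+ 3 = 0 by rewrite -hroot; ring.
  have : x ^+ 2 * (2 - x) >= 0 by apply: mulr_ge0; nra.
  nra.
have e1 : p1 = -1 - p2 by lia.
have E : x ^+ 3 - x - 1 + p2%:~R * (x * (x - 1)) = 0.
  by rewrite -hroot e1 rmorphB !rmorphN /=; ring.
have xx : 0 < x * (x - 1) by apply: mulr_gt0; lra.
have h1 : p2 < 1.
  rewrite ltNge; apply/negP => h; have : (1 : R) <= p2%:~R by rewrite (ler_int _ 1).
  move=> h'; have : x * (x - 1) <= p2%:~R * (x * (x - 1)) by rewrite ler_peMl // ltW.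
  nra.
have h2 : -3 < p2.
  rewrite ltNge; apply/negP => h; have : p2%:~R <= (-3 : R) by rewrite (ler_int _ _ (-3)).
  move=> h'; have : p2%:~R * (x * (x - 1)) <= -3 * (x * (x - 1)) by rewrite ler_wpM2r // ltW.
  have : 0 <= x * (x - 1) * (2 - x) by rewrite mulr_ge0 //; lra.
  nra.
have [e|[e|e]] : p2 = 0 \/ p2 = -1 \/ p2 = -2 by lia.
all: move: E; rewrite e ?rmorphN /= => E.
(* The cubic x^3 - x - 1 divides x^5 - x^4 - 1, with cofactor x^2 - x + 1. *)
- left; exists 4 => //; apply/eqP; rewrite -subr_eq0.
  have -> : x ^+ 4 * (x - 1) - 1 = (x ^+ 2 - x + 1) * (x ^+ 3 - x - 1 + 0 * (x * (x - 1))) by ring.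
  by rewrite E mulr0.
- left; exists 2 => //; apply/eqP; rewrite -subr_eq0 -[X in _ == X]E; apply/eqP; ring.
- right; apply/eqP; rewrite -subr_eq0 -[X in _ == X]E; apply/eqP; ring.
Qed.

Lemma special_degree3 : size ws = 3 -> special_equation x.
Proof.
move=> n3; have n1 : (1 < size ws)%N by rewrite n3.
have gt1 := x1; have le2 := x2; have lb := special_rational_lower_bound n1.
have := special_trace_ge n1.
have [] := sr_trace_beta sr n1; rewrite sr_sum_deriv; have := sr_trace_lt sr (ltnW n1).
have := sr_root_coef; have := sr_sum_coef; have := sr_monic sr; rewrite n3.
rewrite !big_ord_recl !big_ord0 /= !bump0 => p4.
have := sr_coef0 sr; rewrite p4.
move: P`_0 P`_1 P`_2 P`_3 => p0 p1 p2 p3 [] -> hsum hroot hlt hTb _ hT.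
  (* With constant coefficient 1 the trace of beta forces p3 <= -5, while the trace of x, below 2 +
     3/2, forces p3 >= -3. *)
  have {}hlt : - p3%:~R < x + 3 / 2 := hlt.
  have : -4 < p3.
    rewrite ltNge; apply/negP => h; have : p3%:~R <= (-4 : R) by rewrite (ler_int _ _ (-4)).
    by clear - hlt le2; move=> h'; lra.
  by lia.
have x3 : 0 < x ^+ 3 - x.
  have -> : x ^+ 3 - x = x * (x - 1) * (x + 1) by ring.
  by rewrite !mulr_gt0 //; lra.
case: hT => [T1|[T2 golden]].
  have e2 : p2 = 0 by lia.
  have e1 : p1 = -1 - p3 by lia.
  have E : x ^+ 4 - x - 1 + p3%:~R * (x ^+ 3 - x) = 0.
    by rewrite -hroot e1 e2 rmorphB !rmorphN /=; ring.
  have h1 : p3 < 0.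
    rewrite ltNge; apply/negP => h; have : (0 : R) <= p3%:~R by rewrite ler0z.
    move=> h'; have : 0 <= p3%:~R * (x ^+ 3 - x) by rewrite mulr_ge0 // ltW.
    have : 0 <= (x - 32 / 25) * (x ^+ 3 + x ^+ 2 + x) by rewrite mulr_ge0 //; nra.
    nra.
  have h2 : -3 < p3.
    rewrite ltNge; apply/negP => h; have : p3%:~R <= (-3 : R) by rewrite (ler_int _ _ (-3)).
    move=> h'; have : p3%:~R * (x ^+ 3 - x) <= -3 * (x ^+ 3 - x) by rewrite ler_wpM2r // ltW.
    have : 0 <= x ^+ 3 * (2 - x) by rewrite mulr_ge0 ?exprn_ge0 //; lra.
    have : 0 < (x - 1) * (x ^+ 2 + x - 1) by rewrite mulr_gt0 //; nra.
    nra.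
  (* The sign of [E] leaves -1 and -2, and the trace of beta excludes -2. *)
  have e : p3 = -1 by lia.
  left; exists 3 => //; move: E; rewrite e rmorphN /= => E.
  by apply/eqP; rewrite -subr_eq0 -[X in _ == X]E; apply/eqP; ring.
exfalso.
have e2 : p2 = 1 by lia.
have e1 : p1 = -2 - p3 by lia.
have E : x ^+ 4 + x ^+ 2 - 2 * x - 1 + p3%:~R * (x ^+ 3 - x) = 0.
  by rewrite -hroot e1 e2 rmorphB !rmorphN /=; ring.
have [h|h] : -2 <= p3 \/ p3 <= -3 by lia.
  have : (-2 : R) <= p3%:~R by rewrite (ler_int _ (-2)).
  move=> h'; have : -2 * (x ^+ 3 - x) <= p3%:~R * (x ^+ 3 - x) by rewrite ler_wpM2r // ltW.
  (* At p3 = -2 the left side of [E] is (x^2 - x)^2 - 1, positive beyond the golden ratio. *)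
  have : 0 < (x ^+ 2 - x - 1) * (x ^+ 2 - x + 1) by rewrite mulr_gt0 //; nra.
  nra.
have : p3%:~R <= (-3 : R) by rewrite (ler_int _ _ (-3)).
move=> h'; have : p3%:~R * (x ^+ 3 - x) <= -3 * (x ^+ 3 - x) by rewrite ler_wpM2r // ltW.
have : 0 <= x ^+ 2 * ((x - 1) * (2 - x)).
  by rewrite !mulr_ge0 ?exprn_ge0 //; lra.
nra.
Qed.

Lemma special_degree4 : size ws = 4 -> special_equation x.
Proof.
move=> n4; have n1 : (1 < size ws)%N by rewrite n4.
have gt1 := x1; have le2 := x2; have lb := special_rational_lower_bound n1.
(* The degree bound keeps x below the golden ratio, hence trace difference -1: the cut 29/18 lies
   between the smaller root of 4 x^2 - 17 x + 17 and the golden ratio. *)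
have small : 17 / 4 * (x - 1) <= x ^+ 2.
  by rewrite leNgt; apply/negP => /(special_degree4_bound n4).
have xs : x <= 29 / 18.
  rewrite leNgt; apply/negP => h.
  have : 0 <= (x - 29 / 18) * (2 - x) by rewrite mulr_ge0 //; lra.
  nra.
have ngold : x ^+ 2 - x - 1 <= 0.
  have : (x - 29 / 18) * (x + 11 / 18) <= 0 by apply: mulr_le0_ge0; lra.
  by move=> h; lra.
have := special_trace_ge n1.
have [] := sr_trace_sqr sr n1.
have [] := sr_trace_beta sr n1; rewrite sr_sum_deriv; have := sr_trace_lt sr (ltnW n1).
have := sr_root_coef; have := sr_sum_coef; have := sr_monic sr; rewrite n4.
rewrite !big_ord_recl !big_ord0 /= !bump0 => p5.
have := sr_coef0 sr; rewrite p5.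
move: P`_0 P`_1 P`_2 P`_3 P`_4 => p0 p1 p2 p3 p4 [] -> hsum hroot hlt hTb _ hTs hTs' hT.
  (* With constant coefficient 1 the trace of beta gives p3 >= 4, then that of x^2 gives p4 <= -5,
     against the trace of x. *)
  have {}hlt : - p4%:~R < x + 4 / 2 := hlt.
  have : -4 < p4.
    rewrite ltNge; apply/negP => h; have : p4%:~R <= (-4 : R) by rewrite (ler_int _ _ (-4)).
    by clear - hlt le2; move=> h'; lra.
  have T1 : p1 = p4 + 1.
    by clear hTs hTs' hTb; case: hT => [h|[_]]; [lia | rewrite ltNge ngold].
  have Ts : p1 ^+ 2 - 2 * 1 * p2 - (p4 ^+ 2 - 2 * p3) = 2 * p4 + 1 - 2 * p2 + 2 * p3.
    by rewrite T1; ring.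
  by rewrite Ts in hTs; clear hTs' Ts; lia.
have T1 : p4 + p1 = -1.
  clear hTs hTs' hTb; by case: hT => [?|[_]]; [lia | rewrite ltNge ngold].
have e1 : p1 = -1 - p4 by clear hTs hTs' hTb; lia.
have e2 : p2 = - p3 by clear hTs hTs' hTb; lia.
have Ts : p1 ^+ 2 - 2 * -1 * p2 - (p4 ^+ 2 - 2 * p3) = 2 * p4 + 1.
  by rewrite e1 e2; ring.
rewrite Ts in hTs hTs'.
have hTb2 : - 2 * p4 - 2 <= p3 by clear hTs hTs' Ts; lia.
have E : x ^+ 5 + p4%:~R * (x ^+ 4 - x) + p3%:~R * (x ^+ 3 - x ^+ 2) - x - 1 = 0.
  by rewrite -hroot e1 e2 rmorphB !rmorphN /=; ring.
have xsq : (- (2 * p4 + 1))%:~R * x ^+ 2 < 2 * (x ^+ 2 ^+ 2 - 1).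
  have -> : 2 * (x ^+ 2 ^+ 2 - 1) = 2 * (x ^+ 2 - x ^- 2) * x ^+ 2.
    by field; rewrite gt_eqF //; lra.
  by rewrite ltr_pM2r ?exprn_gt0 ?rmorphN //; lra.
clear hTs' Ts hT hsum hroot hlt hTb.
have h4 : -3 < p4.
  rewrite ltNge; apply/negP => h; have : (5 : R) <= (- (2 * p4 + 1))%:~R.
    by rewrite (ler_int _ 5); lia.
  move=> h'; have : 5 * x ^+ 2 <= (- (2 * p4 + 1))%:~R * x ^+ 2 by rewrite ler_wpM2r // sqr_ge0.
  have x2b : x ^+ 2 <= 13 / 5 by nra.
  have : x ^+ 2 ^+ 2 <= 13 / 5 * x ^+ 2 by rewrite [leLHS]expr2 ler_wpM2r // sqr_ge0.
  lra.
have cub : 0 < x ^+ 3 - x ^+ 2.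
  have -> : x ^+ 3 - x ^+ 2 = x ^+ 2 * (x - 1) by ring.
  by rewrite mulr_gt0 ?exprn_gt0 //; lra.
have [e4|e4] : p4 = -1 \/ p4 = -2 by lia.
  have [e3|h3] : p3 = 0 \/ 1 <= p3 by lia.
    left; exists 4 => //; move: E; rewrite e4 e3 rmorphN /= => E.
    by apply/eqP; rewrite -subr_eq0 -[X in _ == X]E; apply/eqP; ring.
  exfalso; have : (1 : R) <= p3%:~R by rewrite (ler_int _ 1).
  move=> h'; have : x ^+ 3 - x ^+ 2 <= p3%:~R * (x ^+ 3 - x ^+ 2) by rewrite ler_peMl // ltW.
  move: E; rewrite e4 rmorphN /= => E.
  have x2b : 8 / 5 <= x ^+ 2 by nra.
  have x4b : 64 / 25 <= x ^+ 4.
    have -> : x ^+ 4 = x ^+ 2 * x ^+ 2 by rewrite -exprD.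
    have : (8 / 5) * (8 / 5) <= x ^+ 2 * x ^+ 2 by apply: ler_pM; lra.
    lra.
  have : 0 <= (x - 32 / 25) * (x ^+ 4 + x ^+ 2) by apply: mulr_ge0; lra.
  nra.
have xsq2 : 2 < x ^+ 2.
  move: xsq; have -> : - (2 * p4 + 1) = 3 by rewrite e4.
  rewrite -[3%:~R]/3 => h; rewrite ltNge; apply/negP => x2b.
  have : x ^+ 2 ^+ 2 <= 2 * x ^+ 2 by rewrite [leLHS]expr2 ler_wpM2r // sqr_ge0.
  lra.
have [e3|h3] : p3 = 2 \/ 3 <= p3 by lia.
  left; exists 2 => //; move: E; rewrite e4 e3 rmorphN /= => E.
  (* The equation factors as (x^2 - x + 1) (x^3 - x^2 - 1) = 0. *)
  have q0 : x ^+ 2 - x + 1 != 0 by rewrite gt_eqF //; nra.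
  apply/eqP; rewrite -subr_eq0 -(mulrI_eq0 _ (mulfI q0)) -[X in _ == X]E.
  by apply/eqP; ring.
exfalso; have : (3 : R) <= p3%:~R by rewrite (ler_int _ 3).
move=> h'; have : 3 * (x ^+ 3 - x ^+ 2) <= p3%:~R * (x ^+ 3 - x ^+ 2) by rewrite ler_wpM2r // ltW.
move: E; rewrite e4 rmorphN /= => E.
have x14 : 7 / 5 <= x by nra.
have x3b : 14 / 5 <= x ^+ 3 by rewrite exprS; nra.
have : 0 <= (x - 7 / 5) * (x ^+ 3 * (x - 1) + x * (2 * x - 1)).
  by apply: mulr_ge0; [lra | apply: addr_ge0; apply: mulr_ge0; lra].
have : 0 <= (x ^+ 3 - 14 / 5) * (x - 1) by rewrite mulr_ge0 //; lra.
nra.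
Qed.

End classification.

Lemma special_pisot_unit_equation (R : realType) (x : R) :
  special_pisot_unit x -> x <= 2 -> special_equation x.
Proof.
move=> /special_pisot_unit_roots[P [ws sr]] x2.
have := special_degree_le4 sr x2.
case e : (size ws) => [|[|[|[|[|//]]]]] _.
- by case: (special_degree0 sr).
- exact: (special_degree1 sr).
- exact: (special_degree2 sr).
- exact: (special_degree3 sr).
- exact: (special_degree4 sr).
Qed.

(** * The ring Z[alpha] and its embeddings *)

Definition zring (R : realType) (x z : R) : Prop :=
  exists p : {poly int}, z = (intp p).[x].

Section zring_closure.
Context (R : realType) (x : R).

Lemma zringD (y z : R) : zring x y -> zring x z -> zring x (y + z).
Proof. by move=> [p ->] [q ->]; exists (p + q); rewrite rmorphD hornerD. Qed.

Lemma zringN (y : R) : zring x y -> zring x (- y).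
Proof. by move=> [p ->]; exists (- p); rewrite rmorphN hornerN. Qed.

Lemma zringB (y z : R) : zring x y -> zring x z -> zring x (y - z).
Proof. by move=> hy hz; apply: zringD => //; exact: zringN. Qed.

Lemma zringM (y z : R) : zring x y -> zring x z -> zring x (y * z).
Proof. by move=> [p ->] [q ->]; exists (p * q); rewrite rmorphM hornerM. Qed.

Lemma zring_int (c : int) : zring x c%:~R.
Proof. by exists c%:P; rewrite map_polyC hornerC. Qed.

Lemma zring1 : zring x 1. Proof. exact: (zring_int 1). Qed.

Lemma zring0 : zring x 0. Proof. exact: (zring_int 0). Qed.

Lemma zring_gen : zring x x.
Proof. by exists 'X; rewrite map_polyX hornerX. Qed.

Lemma zringX (y : R) n : zring x y -> zring x (y ^+ n).
Proof.
move=> hy; elim: n => [|n IH]; first exact: zring1.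
by rewrite exprS; exact: zringM.
Qed.

End zring_closure.

(** Hence beta and 1/beta lie in Z[x] too, so both contractions and their inverses act on
    Z[alpha]. *)
Lemma special_pisot_unit_zring (R : realType) (x : R) : special_pisot_unit x ->
  zring x x^-1 /\ zring x (x - 1)^-1.
Proof.
move=> sx; have [x0 xV x10 x1V] := special_pisot_unit_inverses sx.
have [[[xint _ _] _] _] := sx; have [P xP] := int_minpoly_exists xint.
have inv (c : int) : x != c%:~R -> algebraic_integer (x - c%:~R)^-1 ->
    zring x (x - c%:~R)^-1.
  move=> xc xcV; have [_ [b [S bE]]] := int_minpoly_unit xP xc xcV.
  exists b; apply: (mulfI (x := x - c%:~R)); first by rewrite subr_eq0.
  rewrite mulfV ?subr_eq0 //.
  have /(congr1 (fun p => (intp p : {poly R}).[x])) := bE.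
  rewrite rmorphM rmorphB rmorphD rmorphM rmorph1 /= map_polyX map_polyC /=.
  rewrite hornerM hornerXsubC hornerD hornerM -polyC1 hornerC.
  by have [_ _ /rootP ->] := xP; rewrite mul0r addr0 => ->.
by split; [have := inv _ x0 xV; rewrite subr0 | exact: inv x10 x1V].
Qed.

Lemma beta_gt1 (R : realType) (x : R) : 1 < x -> 1 < beta x.
Proof. by move=> x1; rewrite /beta ltr_pdivlMr; lra. Qed.

Lemma beta_subr1 (R : realType) (x : R) : 1 < x -> beta x - 1 = (x - 1)^-1.
Proof. by move=> x1; rewrite /beta; field; rewrite subr_eq0 gt_eqF. Qed.

Lemma betaK (R : realType) (x : R) : 1 < x -> beta (beta x) = x.
Proof.
move=> x1; rewrite {1}/beta beta_subr1 // invrK /beta divfK //.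
by rewrite subr_eq0 gt_eqF.
Qed.

Lemma special_pisot_unit_beta (R : realType) (x : R) :
  special_pisot_unit x -> special_pisot_unit (beta x).
Proof.
move=> sx; have x1 := special_pisot_unit_gt1 sx.
have [[px pb] [x0 _ xV]] := sx; have [bint b1 _] := pb.
split; first by split=> //; rewrite betaK.
split=> //; first by rewrite gt_eqF // (lt_trans ltr01).
have -> : (beta x)^-1 = (-1)%:~R * x^-1 + 1%:~R.
  by rewrite /beta; field; rewrite x0 subr_eq0 gt_eqF.
apply: algebraic_integerD; last exact: algebraic_integer_int.
have := @integral_mul _ _ (intr : {rmorphism int -> R}) (-1)%:~R x^-1.
by apply=> //; exact: algebraic_integer_int.
Qed.

(* Both numbers are powers of the same unit: [x] itself, or [(x - 1)^-1]. *)
Lemma special_equation_powers (R : realType) (x : R) : 1 < x -> special_equation x ->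
  exists y i j, [/\ (0 < i)%N, (0 < j)%N, x = y ^+ i, beta x = y ^+ j &
    y = x \/ y = (x - 1)^-1].
Proof.
move=> x1 [[k /andP[k0 _] E]|E].
  exists x, 1, k.+1; split=> //; last by left.
  have xm : x - 1 != 0 by rewrite subr_eq0 gt_eqF.
  by apply: (mulIf xm); rewrite /beta divfK // exprS -mulrA E mulr1.
have xm : x - 1 != 0 by rewrite subr_eq0 gt_eqF.
have xE : x = (x - 1)^-1 ^+ 2.
  by apply: (mulIf (expf_neq0 2 xm)); rewrite -exprMn mulVf // expr1n.
exists (x - 1)^-1, 2, 3; split=> //; last by right.
by rewrite exprSr -xE.
Qed.

(** Since (x - 1) (beta x - 1) = 1, one of x and beta x is at most 2; the classification is applied
    to that one. *)
Lemma special_pisot_unit_powers (R : realType) (x : R) : special_pisot_unit x ->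
  exists y i j, [/\ (0 < i)%N, (0 < j)%N, x = y ^+ i & beta x = y ^+ j] /\
    [/\ 1 < y, zring x y & zring x y^-1].
Proof.
move=> sx; have x1 := special_pisot_unit_gt1 sx.
have [zV z1V] := special_pisot_unit_zring sx.
have z1 : zring x (x - 1) := zringB (zring_gen x) (zring1 x).
have zb : zring x (beta x) by exact: zringM (zring_gen x) z1V.
have zbV : zring x (beta x)^-1 by rewrite invf_div; exact: zringM.
have gt1 (y : R) i : (0 < i)%N -> 1 < y ^+ i -> 0 < y -> 1 < y.
  by move=> i0; rewrite ltNge => yi y0; rewrite ltNge; apply: contra yi => y1;
     rewrite exprn_ile1 // ltW.
have xm : 0 < x - 1 by rewrite subr_gt0.
have x0 : 0 < x := lt_trans ltr01 x1.
have [x2|x2] := leP x 2.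
  have [y [i [j [i0 j0 xi bj hy]]]] :=
    special_equation_powers x1 (special_pisot_unit_equation sx x2).
  exists y, i, j; split=> //; split.
  - by apply: (gt1 _ i) => //; [rewrite -xi | case: hy => -> //; rewrite invr_gt0].
  - by case: hy => ->; [exact: zring_gen |].
  - by case: hy => ->; rewrite ?invrK.
have b2 : beta x <= 2 by rewrite /beta ler_pdivrMr //; lra.
have b1 := beta_gt1 x1.
have [y [i [j [i0 j0 bi xj hy]]]] :=
  special_equation_powers b1 (special_pisot_unit_equation (special_pisot_unit_beta sx) b2).
rewrite betaK // in xj; rewrite beta_subr1 // invrK in hy.
exists y, j, i; split=> //; split.
- by apply: (gt1 _ i) => //; [rewrite -bi | case: hy => -> //; exact: lt_trans b1].
- by case: hy => ->.
- by case: hy => ->.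
Qed.

Section interpolation.
Context (R : realType).
Implicit Types (xs : seq R[i]) (p : {poly R[i]}).

Lemma interpolation (F : fieldType) (xs : seq F) (f : F -> F) : uniq xs ->
  exists2 p : {poly F}, (size p <= size xs)%N & forall x, x \in xs -> p.[x] = f x.
Proof.
elim: xs => [|x xs IH]; first by exists 0; rewrite ?size_poly0.
move=> /= /andP[xxs /IH[p sp pE]].
pose Q := \prod_(y <- xs) ('X - y%:P).
have Qx : Q.[x] != 0 by rewrite -[_ == _]/(root Q x) root_prod_XsubC.
exists (p + ((f x - p.[x]) / Q.[x]) *: Q).
  apply: (leq_trans (size_polyD _ _)); rewrite geq_max (leq_trans sp) //=.
  by apply: (leq_trans (size_scale_leq _ _)); rewrite size_prod_XsubC.
move=> y; rewrite inE hornerD hornerZ => /orP[/eqP->|yxs].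
  by rewrite divfK // addrC subrK.
have /rootP -> : root Q y by rewrite root_prod_XsubC.
by rewrite mulr0 addr0 pE.
Qed.

(** Coefficients depend linearly on the values at the fixed nodes: [B] adds up the moduli of all
    coefficients of the Lagrange basis. *)
Lemma coef_bound xs : uniq xs -> exists2 B : R, 0 <= B &
  forall p M, (size p <= size xs)%N -> (forall x, x \in xs -> normc p.[x] <= M) ->
  forall i, 0 <= M -> normc p`_i <= B * M.
Proof.
move=> uxs.
have /choice[l lP] : forall x : R[i], exists q : {poly R[i]},
    (size q <= size xs)%N /\ forall y, y \in xs -> q.[y] = (y == x)%:R.
  by move=> x; have [q sq qE] := interpolation (fun y => (y == x)%:R) uxs; exists q.
exists (\sum_(x <- xs) \sum_(i < size xs) normc (l x)`_i).
  by apply: sumr_ge0 => x _; apply: sumr_ge0 => i _; exact: normc_ge0.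
move=> p M sp pM i M0.
have pE : p = \sum_(x <- xs) p.[x] *: l x.
  apply/eqP; rewrite -subr_eq0; apply/eqP.
  apply: (roots_geq_poly_eq0 (rs := xs)) => //; last first.
    apply: (leq_trans (size_polyD _ _)); rewrite geq_max sp size_polyN.
    apply: (leq_trans (size_sum _ _ _)); apply/bigmax_leqP_seq => x _ _.
    by apply: (leq_trans (size_scale_leq _ _)); have [] := lP x.
  apply/allP => y yxs; rewrite rootE hornerD hornerN horner_sum subr_eq0; apply/eqP.
  rewrite (big_rem y) //= hornerZ (lP y).2 // eqxx mulr1 big1_seq ?addr0 // => x /andP[_].
  rewrite mem_rem_uniq // inE => /andP[xy xxs].
  by rewrite hornerZ (lP x).2 // eq_sym (negbTE xy) mulr0.
have [isz|isz] := ltnP i (size xs); last first.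
  rewrite nth_default ?(leq_trans sp) // normc0 mulr_ge0 //.
  by apply: sumr_ge0 => x _; apply: sumr_ge0 => j _; exact: normc_ge0.
rewrite pE coef_sum; apply: (le_trans (normc_sum _ _)).
rewrite mulr_suml [leLHS]big_seq [leRHS]big_seq; apply: ler_sum => x xxs.
rewrite coefZ normcM mulrC; apply: ler_pM; rewrite ?normc_ge0 ?pM //.
rewrite (bigD1 (Ordinal isz)) //= lerDl.
by apply: sumr_ge0 => j _; exact: normc_ge0.
Qed.

End interpolation.

Section conjugates.
Context (R : realType) (alpha : R) (r s : nat) (a : 'I_r -> R) (c : 'I_s -> R[i]).
Hypothesis hconj : conj_enum alpha a c.
Hypothesis halpha : special_pisot_unit alpha.

Local Notation I := ('I_r + 'I_s)%type.

(** Real and non-real conjugates are put together in R[i], so that both factors of K can be handled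
    coordinate by coordinate. *)
Definition conjugate (k : I) : R[i] :=
  match k with inl k => (a k)%:C | inr k => c k end.

Definition sigma (k : I) (z : R) : R[i] := embed alpha (conjugate k) z.

Lemma galois_conj_real_complex (x : R) :
  galois_conj alpha x <-> galois_conj alpha x%:C.
Proof.
have [[[xint _ _] _] _] := halpha; have [P xP] := int_minpoly_exists xint.
rewrite !(int_minpoly_conj _ xP) !rootE intp_real_complex.
by rewrite -(rmorph0 (real_complex R)) (inj_eq (@complexI R)).
Qed.

Lemma conjugateP k : galois_conj alpha (conjugate k) /\ conjugate k != alpha%:C.
Proof.
have [_ ha _ hc] := hconj; case: k => k /=.
  have [] := (ha (a k)).2; first by exists k.
  move=> /galois_conj_real_complex g aa; split=> //.
  by rewrite (inj_eq (@complexI R)).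
have [] := (hc (c k)).2; first by exists k; left.
move=> g nr; split=> //; apply: contraNneq nr => ->.
by apply/complex_realP; exists alpha.
Qed.

Lemma conjugate_exhaust (z : R[i]) : galois_conj alpha z ->
  [\/ z = alpha%:C, exists k, z = conjugate k | exists k, z = conjc (c k)].
Proof.
have [_ ha _ hc] := hconj => gz.
have [/complex_realP[x zx]|nr] := boolP (z \is Num.real).
  have [xa|xa] := eqVneq x alpha; first by constructor 1; rewrite zx xa.
  constructor 2; rewrite zx in gz.
  have [k xk] := (ha x).1 (conj ((galois_conj_real_complex x).2 gz) xa).
  by exists (inl k); rewrite zx xk.
have [k [zk|zk]] := (hc z).1 (conj gz nr); last by constructor 3; exists k.
by constructor 2; exists (inr k).
Qed.

Lemma sigma_horner k (p : {poly int}) :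
  sigma k (intp p).[alpha] = (intp p).[conjugate k].
Proof.
have [g _] := conjugateP k.
by have := embed_horner (intp p) g; rewrite !map_ratr_intr.
Qed.

Lemma sigmaD k y z : zring alpha y -> zring alpha z ->
  sigma k (y + z) = sigma k y + sigma k z.
Proof.
by move=> [p ->] [q ->]; rewrite -hornerD -rmorphD !sigma_horner rmorphD hornerD.
Qed.

Lemma sigmaN k y : zring alpha y -> sigma k (- y) = - sigma k y.
Proof.
by move=> [p ->]; rewrite -hornerN -rmorphN !sigma_horner rmorphN hornerN.
Qed.

Lemma sigmaB k y z : zring alpha y -> zring alpha z ->
  sigma k (y - z) = sigma k y - sigma k z.
Proof. by move=> hy hz; rewrite sigmaD ?sigmaN //; exact: zringN. Qed.

Lemma sigmaM k y z : zring alpha y -> zring alpha z ->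
  sigma k (y * z) = sigma k y * sigma k z.
Proof.
by move=> [p ->] [q ->]; rewrite -hornerM -rmorphM !sigma_horner rmorphM hornerM.
Qed.

Lemma sigma1 k : sigma k 1 = 1.
Proof.
have -> : 1 = (intp 1).[alpha] :> R by rewrite rmorph1 -polyC1 hornerC.
by rewrite sigma_horner rmorph1 -polyC1 hornerC.
Qed.

Lemma sigma0 k : sigma k 0 = 0.
Proof.
have -> : 0 = (intp 0).[alpha] :> R by rewrite rmorph0 horner0.
by rewrite sigma_horner rmorph0 horner0.
Qed.

Lemma sigmaX k y n : zring alpha y -> sigma k (y ^+ n) = sigma k y ^+ n.
Proof.
move=> hy; elim: n => [|n IH]; first by rewrite !expr0 sigma1.
by rewrite !exprS sigmaM ?IH //; exact: zringX.
Qed.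

Lemma sigma_gen k : sigma k alpha = conjugate k.
Proof.
have -> : sigma k alpha = sigma k (intp 'X).[alpha] by rewrite map_polyX hornerX.
by rewrite sigma_horner map_polyX hornerX.
Qed.

Lemma sigmaV k y : zring alpha y -> zring alpha y^-1 -> y != 0 ->
  sigma k y^-1 = (sigma k y)^-1 /\ sigma k y != 0.
Proof.
move=> hy hyV y0; have E : sigma k y * sigma k y^-1 = 1.
  by rewrite -sigmaM // mulfV // sigma1.
have s0 : sigma k y != 0.
  by apply: contra_eq_neq E => ->; rewrite mul0r eq_sym oner_eq0.
by split=> //; apply: (mulfI s0); rewrite E mulfV.
Qed.

Lemma sigma_inl_real k z : zring alpha z ->
  sigma (inl k) z = (embed alpha (a k) z)%:C.
Proof.
move=> [p ->]; rewrite sigma_horner /= intp_real_complex; congr _%:C.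
have [_ ha _ _] := hconj; have [g _] := (ha (a k)).2 (ex_intro _ k erefl).
by have := embed_horner (intp p) g; rewrite !map_ratr_intr => <-.
Qed.

Lemma normc_conjugate_lt1 k : normc (conjugate k) < 1.
Proof.
have [[[_ _ h] _] _] := halpha; have [g kn] := conjugateP k.
by rewrite -normc_lt; exact: h.
Qed.

Lemma horner_conj (p : {poly int}) (z : R[i]) : (intp p).[conjc z] = conjc (intp p).[z].
Proof.
rewrite -horner_map -map_poly_comp; congr (_.[_]); apply: eq_map_poly => i /=.
by rewrite rmorph_int.
Qed.

Lemma zring_roots : exists xs : seq R[i],
  [/\ uniq xs, alpha%:C \in xs,
      forall z, (z \in xs) <-> galois_conj alpha z &
      forall z, zring alpha z ->
        exists2 p : {poly int}, (size p <= size xs)%N & z = (intp p).[alpha]].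
Proof.
have [[[xint _ _] _] _] := halpha; have [P xP] := int_minpoly_exists xint.
have [ws [PE uxs rP]] := int_minpoly_split xP.
exists (alpha%:C :: ws); split=> //; first by rewrite mem_head.
  by move=> z; rewrite (int_minpoly_conj _ xP) rP.
move=> z [p ->]; have [Pm _ Px] := xP.
exists (Pdiv.Ring.rmodp p P).
  have sP : size P = (size (alpha%:C :: ws)).+1.
    have := congr1 (fun p : {poly R[i]} => size p) PE.
    rewrite size_prod_XsubC => <-.
    by rewrite size_map_poly_id0 // intr_eq0 lead_coef_eq0 monic_neq0.
  by have := Pdiv.Ring.ltn_rmodpN0 p (monic_neq0 Pm); rewrite sP ltnS.
rewrite {1}(Pdiv.RingMonic.rdivp_eq Pm p) rmorphD rmorphM hornerD hornerM (rootP Px).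
by rewrite mulr0 add0r.
Qed.

(** Discreteness of Z[alpha] under all its embeddings together: a representative reduced modulo the
    minimal polynomial has bounded values at all conjugates, hence bounded integer coefficients. *)
Lemma zring_finite (M : R) : exists l : seq R, forall z, zring alpha z ->
  `|z| <= M -> (forall k, normc (sigma k z) <= M) -> z \in l.
Proof.
have [xs [uxs axs xsE zE]] := zring_roots.
have [B B0 hB] := coef_bound uxs.
have [N hN] : exists N : nat, B * M < N%:R.
  by exists (Num.truncn (B * M)).+1; exact: truncnS_gt.
pose val (f : {ffun 'I_(size xs) -> 'I_(2 * N).+1}) : R :=
  \sum_i ((f i)%:Z - N%:Z)%:~R * alpha ^+ i.
exists [seq val f | f : {ffun 'I_(size xs) -> 'I_(2 * N).+1}].
move=> z hz zM sM; have [p sp zp] := zE z hz.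
have M0 : 0 <= M := le_trans (normr_ge0 _) zM.
have coefN i : `|p`_i| <= N%:Z.
  have : normc (intp p : {poly R[i]})`_i <= B * M.
    apply: hB => //; first by rewrite (leq_trans (size_poly _ _)).
    move=> x /xsE/conjugate_exhaust[->|[k ->]|[k ->]].
    - by rewrite intp_real_complex -zp normc_real.
    - by rewrite -sigma_horner -zp.
    - by rewrite horner_conj normcJ -(sigma_horner (inr k)) -zp.
  rewrite coef_map /= -(rmorph_int (real_complex R)) normc_real -intr_norm.
  move=> /le_lt_trans/(_ hN); rewrite -[N%:R]/((N%:Z)%:~R : R) ltr_int; exact: ltW.
have bnd i : (absz (p`_i + N%:Z)%R < (2 * N).+1)%N by have := coefN i; lia.
apply/fintype.imageP; exists [ffun i : 'I_(size xs) => Ordinal (bnd i)] => //.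
rewrite /val zp (horner_coef_wide _ (_ : (_ <= size xs)%N)); last first.
  by rewrite (leq_trans (size_poly _ _)).
apply: eq_bigr => i _; rewrite ffunE coef_map /=; congr (_%:~R * _).
by have := coefN i; move: (p`_i) => u /= hu; rewrite gez0_abs; lia.
Qed.

Lemma c_nonreal k : c k \isn't Num.real.
Proof. by have [_ _ _ hc] := hconj; case: ((hc (c k)).2 (ex_intro _ k (or_introl erefl))). Qed.

Lemma conjugate_inj : injective conjugate.
Proof.
have [ainj _ cinj _] := hconj; move=> [k|k] [l|l] /= E.
- by congr inl; apply: ainj; apply: complexI.
- by have := c_nonreal l; rewrite -E; case/negP; apply/complex_realP; exists (a k).
- by have := c_nonreal k; rewrite E; case/negP; apply/complex_realP; exists (a l).
- by congr inr; apply/eqP; apply: contraT => /cinj[/eqP].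
Qed.

Lemma conjc_c_neq k l : conjc (c k) != conjugate l.
Proof.
have [_ _ cinj _] := hconj; case: l => [l|l] /=.
  apply: contraNneq (c_nonreal k) => E.
  by rewrite -[c k]conjcK E; apply/complex_realP; exists (a l); rewrite conjc_real.
have [->|kl] := eqVneq k l.
  apply: contraNneq (c_nonreal l) => E; apply/complex_realP; exists (complex.Re (c l)).
  by case: (c l) E => x y [] /eqP; rewrite -subr_eq0 -opprD oppr_eq0 -mulr2n mulrn_eq0 => /eqP ->.
by rewrite eq_sym; have [] := cinj _ _ (contra_neq (@esym _ _ _) kl : l != k).
Qed.

Lemma galois_conj_conj (k : 'I_s) : galois_conj alpha (conjc (c k) : R[i]).
Proof.
have [_ _ _ hc] := hconj.
by have [] := (hc (conjc (c k))).2 (ex_intro _ k (or_intror erefl)).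
Qed.

(** Interpolate the prescribed values by a real polynomial and round its coefficients down. Each
    coefficient moves by at most 1, which costs the sum of the powers of alpha at alpha and at most
    [n] at a conjugate. *)
Lemma zring_relatively_dense : exists R0 : R, forall (x : R) (y : I -> R[i]),
  (forall k, complex.Im (y (inl k)) = 0) ->
  exists z, [/\ zring alpha z, `|z - x| <= R0 & forall k, normc (sigma k z - y k) <= R0].
Proof.
have [xs [uxs axs xsE _]] := zring_roots.
pose n := size xs.
exists (\sum_(i < n) `|alpha| ^+ i + n%:R) => x y yreal.
(* Prescribed so as to commute with complex conjugation. *)
pose f (z : R[i]) : R[i] :=
  if z == alpha%:C then x%:C
  else if [pick k | conjugate k == z] is Some k then y k
  else if [pick k | conjc (c k) == z] is Some k then conjc (y (inr k)) else 0.
have [p sp pE] := interpolation f uxs.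
(* Taking real parts averages p with its conjugate polynomial; as [f] commutes with conjugation, the
   values at the nodes survive. *)
pose t i := complex.Re p`_i.
pose m i := Num.floor (t i).
have mt i : `|(m i)%:~R - t i| <= 1.
  by have /andP[h1 h2] := floor_itv (t i); rewrite ler_norml; move: h2; rewrite rmorphD /= -/(m i); lra.
have tE (z : R[i]) : \sum_(i < n) (t i)%:C * z ^+ i = (p.[z] + conjc p.[conjc z]) / 2.
  have E : conjc p.[conjc z] = \sum_(i < n) conjc p`_i * z ^+ i.
    rewrite (horner_coef_wide _ sp) rmorph_sum; apply: eq_bigr => i _.
    by rewrite rmorphM rmorphXn /= conjcK.
  transitivity ((p.[z] + \sum_(i < n) conjc p`_i * z ^+ i) / 2); last by rewrite -E.
  rewrite (horner_coef_wide _ sp) -big_split /= mulr_suml.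
  by apply: eq_bigr => i _; rewrite -mulrDl addcJ; field.
pose q : {poly int} := \poly_(i < n) m i.
have qE (K : numFieldType) (z : K) : (intp q).[z] = \sum_(i < n) (m i)%:~R * z ^+ i.
  rewrite (horner_coef_wide _ (_ : (_ <= n)%N)).
    by apply: eq_bigr => i _; rewrite coef_map coef_poly ltn_ord.
  by rewrite (leq_trans (size_poly _ _)) // size_poly.
have txs : \sum_(i < n) (t i)%:C * alpha%:C ^+ i = x%:C.
  rewrite tE conjc_real pE // /f eqxx conjc_real; field; exact: isT.
have tys k : \sum_(i < n) (t i)%:C * conjugate k ^+ i = y k.
  have kxs : conjugate k \in xs by apply/xsE; have [] := conjugateP k.
  rewrite tE pE //.
  have -> : f (conjugate k) = y k.
    rewrite /f (negbTE (conjugateP k).2); case: pickP => [l /eqP/conjugate_inj -> //|].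
    by move=> /(_ k); rewrite eqxx.
  have -> : p.[conjc (conjugate k)] = conjc (y k).
    case: k kxs => k kxs.
      have -> : conjc (conjugate (inl k)) = conjugate (inl k) by exact: conjc_real.
      rewrite pE // /f (negbTE (conjugateP (inl k)).2).
      case: pickP => [l /eqP/(@conjugate_inj _ (inl k)) -> //|/(_ (inl k))]; last by rewrite eqxx.
      by have := yreal k; case: (y (inl k)) => u v /= ->; rewrite oppr0.
    rewrite pE /=; last by apply/xsE; exact: galois_conj_conj.
    rewrite /f; case: eqP => [E|_].
      by have := c_nonreal k; rewrite -[c k]conjcK E conjc_real; case/negP;
        apply/complex_realP; exists alpha.
    case: pickP => [l /eqP E|_]; first by have := conjc_c_neq k l; rewrite E eqxx.
    case: pickP => [l /eqP E|/(_ k)]; last by rewrite eqxx.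
    have /conjugate_inj [->//] : conjugate (inr l) = conjugate (inr k).
    by rewrite /= -[c l]conjcK E conjcK.
  by rewrite conjcK; field.
exists ((intp q).[alpha]); split; first by exists q.
  have -> : x = \sum_(i < n) t i * alpha ^+ i.
    apply: complexI; rewrite -txs rmorph_sum; apply: eq_bigr => i _.
    by rewrite rmorphM rmorphXn.
  rewrite qE -sumrB; apply: (le_trans (ler_norm_sum _ _ _)).
  rewrite -[leLHS]addr0; apply: lerD => //; apply: ler_sum => i _.
  by rewrite -mulrBl normrM normrX ler_piMl ?exprn_ge0.
move=> k; rewrite sigma_horner qE -tys -sumrB; apply: (le_trans (normc_sum _ _)).
apply: (@le_trans _ _ n%:R); last first.
  by rewrite lerDr; apply: sumr_ge0 => i _; rewrite exprn_ge0.
have -> : n%:R = \sum_(i < n) (1 : R) by rewrite sumr_const card_ord.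
apply: ler_sum => i _; rewrite -mulrBl normcM normcX.
have -> : (m i)%:~R - (t i)%:C = ((m i)%:~R - t i)%:C by rewrite rmorphB rmorph_int.
rewrite normc_real mulr_ile1 ?exprn_ge0 ?normc_ge0 //.
by rewrite exprn_ile1 ?normc_ge0 // ltW // normc_conjugate_lt1.
Qed.

End conjugates.

(** * The topology of the representation space *)

Section space.
Context (R : realType) (r s : nat).
Local Notation K := ('rV[R]_r * 'rV[R[i]]_s)%type.
Local Notation I := ('I_r + 'I_s)%type.
Implicit Types (u v w : K) (k : I).

Definition coord v k : R[i] :=
  match k with inl k => (v.1 0 k)%:C | inr k => v.2 0 k end.

Lemma coordD u v k : coord (u + v) k = coord u k + coord v k.
Proof. by case: k => k /=; rewrite !mxE // rmorphD. Qed.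

Lemma coordN v k : coord (- v) k = - coord v k.
Proof. by case: k => k /=; rewrite !mxE // rmorphN. Qed.

Lemma coordB u v k : coord (u - v) k = coord u k - coord v k.
Proof. by rewrite coordD coordN. Qed.

Lemma coord0 k : coord 0 k = 0.
Proof. by case: k => k /=; rewrite !mxE. Qed.

Lemma coord_inj u v : (forall k, coord u k = coord v k) -> u = v.
Proof.
case: u v => [u1 u2] [v1 v2] h; congr (_, _); apply/rowP => k.
  by apply: complexI; exact: (h (inl k)).
exact: (h (inr k)).
Qed.

Lemma normc_coord_inl v (k : 'I_r) : normc (coord v (inl k)) = `|v.1 0 k|.
Proof. exact: normc_real. Qed.

Lemma normc_coord_inr v (k : 'I_s) : normc (coord v (inr k)) = normc (v.2 0 k).
Proof. by []. Qed.

(** A real-valued norm on the whole of K, whose factors carry norms with values in R and in R[i]. *)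
Definition normK v : R := \sum_k normc (coord v k).

Lemma normK_ge0 v : 0 <= normK v.
Proof. by apply: sumr_ge0 => k _; exact: normc_ge0. Qed.

Lemma normK0 : normK 0 = 0.
Proof. by apply: big1 => k _; rewrite coord0 normc0. Qed.

Lemma normKD u v : normK (u + v) <= normK u + normK v.
Proof.
rewrite /normK -big_split; apply: ler_sum => k _; rewrite coordD.
exact: normcD.
Qed.

Lemma normKN v : normK (- v) = normK v.
Proof. by apply: eq_bigr => k _; rewrite coordN normcN. Qed.

Lemma normKB u v : normK (u - v) <= normK u + normK v.
Proof. by rewrite -[normK v]normKN; exact: normKD. Qed.

Lemma normK_dist u v : normK (u - v) = normK (v - u).
Proof. by rewrite -normKN opprB. Qed.

Lemma normK_tri w u v : normK (u - v) <= normK (u - w) + normK (w - v).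
Proof. by apply: le_trans (normKD _ _); rewrite addrA subrK. Qed.

Lemma coord_le_normK v k : normc (coord v k) <= normK v.
Proof.
rewrite /normK (bigD1 k) //= lerDl.
by apply: sumr_ge0 => j _; exact: normc_ge0.
Qed.

Lemma normK_le v (e : R) : (forall k, normc (coord v k) <= e) ->
  normK v <= #|{: I}|%:R * e.
Proof.
move=> h; rewrite mulr_natl -sumr_const; apply: ler_sum => k _; exact: h.
Qed.

Lemma normK_scale (m : R) (l : I -> R[i]) u v :
  (forall k, normc (l k) <= m) -> (forall k, coord u k = l k * coord v k) ->
  normK u <= m * normK v.
Proof.
move=> lm ul; rewrite /normK mulr_sumr; apply: ler_sum => k _.
by rewrite ul normcM ler_wpM2r // normc_ge0.
Qed.

Lemma normK_eq0 v : normK v = 0 -> v = 0.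
Proof.
move=> v0; apply: coord_inj => k; rewrite coord0; apply: eq0_normc; apply/eqP.
by rewrite eq_le normc_ge0 andbT -v0 coord_le_normK.
Qed.

Lemma nbhs_normK v (A : set K) :
  nbhs v A <-> exists2 e, 0 < e & forall u, normK (u - v) < e -> A u.
Proof.
split.
  case: v => v1 v2 [[B1 B2] /= [/nbhs_ballP[e1 /= e10 h1] /nbhs_ballP[e2 /= e20 h2]] BA].
  have e2E : e2 = (complex.Re e2)%:C by rewrite RRe_real // gtr0_real.
  have e2' : 0 < complex.Re e2 by rewrite -ltcR -e2E.
  exists (Num.min e1 (complex.Re e2)); first by rewrite lt_min e10.
  move=> [u1 u2]; rewrite lt_min => /andP[hu1 hu2]; apply: BA; split.
    apply: h1; split=> // i j; rewrite ord1 /ball /=.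
    have := coord_le_normK ((u1, u2) - (v1, v2)) (inl j).
    rewrite normc_coord_inl /= !mxE => /le_lt_trans/(_ hu1).
    by rewrite distrC.
  apply: h2; split=> // i j; rewrite ord1 /ball /=.
  have := coord_le_normK ((u1, u2) - (v1, v2)) (inr j).
  rewrite normc_coord_inr [_.2]/= !mxE => /le_lt_trans/(_ hu2).
  by rewrite e2E normc_normr ltcR normc_dist.
move=> [e e0 eA]; case: v eA => v1 v2 eA.
pose d := e / (#|{: I}|.+1)%:R.
have d0 : 0 < d by rewrite divr_gt0.
have dC : 0 < d%:C :> R[i] by rewrite -(rmorph0 (real_complex R)) ltcR.
exists (ball v1 d, ball v2 d%:C) => /=.
  by split; apply/nbhs_ballP; [exists d | exists d%:C].
move=> [u1 u2] /= [h1 h2]; apply: eA.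
apply: (@le_lt_trans _ _ (#|{: I}|%:R * d)).
  apply: normK_le => -[] k.
    rewrite normc_coord_inl [_.1]/= !mxE.
    by rewrite distrC ltW //; have := h1.2 0 k.
  rewrite normc_coord_inr [_.2]/= !mxE normc_dist -lecR -normc_normr ltW //.
  by have := h2.2 0 k.
rewrite mulrCA gtr_pMr // ltr_pdivrMr // mul1r ltr_nat.
by rewrite ltnSn.
Qed.

Lemma closed_normK (A : set K) : closed A <->
  forall v, (forall e, 0 < e -> exists2 u, A u & normK (u - v) < e) -> A v.
Proof.
split=> [cA v h|h v cv].
  apply: cA => B /nbhs_normK[e e0 eB]; have [u Au uv] := h e e0.
  by exists u; split=> //; exact: eB.
apply: h => e e0; have [|u [Au Bu]] := cv [set u | normK (u - v) < e].
  by apply/nbhs_normK; exists e.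
by exists u.
Qed.

Lemma hausdorff_normK : hausdorff_space K.
Proof.
move=> u v huv; apply/eqP; rewrite -subr_eq0; apply/eqP/normK_eq0/eqP.
rewrite eq_le normK_ge0 andbT leNgt; apply/negP => e0.
set e := normK _ in e0.
have e2 : 0 < e / 2 by rewrite divr_gt0.
have [||w [/= h1 h2]] := huv [set w | normK (w - u) < e / 2] [set w | normK (w - v) < e / 2].
- by apply/nbhs_normK; exists (e / 2).
- by apply/nbhs_normK; exists (e / 2).
have := normK_tri w u v; rewrite [normK (u - w)]normK_dist -/e; lra.
Qed.

Lemma compact_normK_bounded (A : set K) : compact A ->
  exists M, forall v, A v -> normK v <= M.
Proof.
move=> cA; have cont : continuous (normK : K -> R).
  move=> v B /nbhs_ballP[e /= e0 eB]; apply/nbhs_normK; exists e => // u uv.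
  apply: eB; rewrite /ball /=.
  have := normKB u (u - v); rewrite subKr; have := normKD (u - v) v; rewrite subrK.
  by rewrite ltr_distl; lra.
have cont' : {within A, continuous (normK : K -> R)} by apply: continuous_subspaceT.
have [M [_ hM]] := compact_bounded (continuous_compact cont' cA).
exists (M + 1) => v Av; have := hM (M + 1); rewrite ltrDl ltr01 => /(_ isT).
move=> /(_ (normK v)) h; apply: le_trans (ler_norm _) _; apply: h.
by exists v.
Qed.

Lemma compact_disc (e : R) : compact [set z : R[i] | normc z <= e].
Proof.
pose f (p : R * R) : R[i] := p.1 +i* p.2.
pose Q := [set p : R * R | `[-e, e]%classic p.1 /\ `[-e, e]%classic p.2].
have cQ : compact Q by apply: compact_setX; exact: segment_compact.
have cf : continuous f.
  move=> p B /nbhs_ballP[d /= d0 dB].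
  have dE : d = (complex.Re d)%:C by rewrite RRe_real // gtr0_real.
  have d' : 0 < complex.Re d / 2 by rewrite divr_gt0 // -ltcR -dE.
  exists (ball p.1 (complex.Re d / 2), ball p.2 (complex.Re d / 2)) => /=.
    by split; exact: nbhsx_ballx.
  move=> [x y] /= [hx hy]; apply: dB; rewrite /ball /= /ball_ /= dE normc_normr ltcR.
  have -> : f p - f (x, y) = (p.1 - x)%:C + 'i%C * (p.2 - y)%:C.
    by rewrite /f; case: p {hx hy} => p1 p2; apply/eqP; rewrite eq_complex /=;
      apply/andP; split; apply/eqP; ring.
  apply: (le_lt_trans (normcD _ _)); rewrite normcM !normc_real.
  have -> : normc ('i%C : R[i]) = 1 by rewrite /= expr0n expr1n add0r sqrtr1.
  by rewrite mul1r; move: hx hy; rewrite /ball /=; lra.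
have cfQ : compact (f @` Q) by apply: continuous_compact => //; exact: continuous_subspaceT.
apply: (subclosed_compact _ cfQ).
  move=> z cz; rewrite /= leNgt; apply/negP => ez.
  have d0 : 0 < normc z - e by rewrite subr_gt0.
  have [|w [/= we wz]] := cz [set w | normc (z - w) < normc z - e].
    apply/nbhs_ballP; exists (normc z - e)%:C => /=.
      by rewrite -(rmorph0 (real_complex R)) ltcR.
    by move=> w; rewrite /ball /= /ball_ /= normc_normr ltcR.
  have := normcD (z - w) w; rewrite subrK; lra.
move=> z /= ze; exists (complex.Re z, complex.Im z); last by case: z {ze}.
have h x y : x ^+ 2 <= normc z ^+ 2 -> y = x -> `[-e, e]%classic y.
  move=> h ->; rewrite /= in_itv /= -ler_norml; apply: le_trans ze.
  by rewrite -(ler_pXn2r (_ : (0 < 2)%N)) ?nnegrE ?normc_ge0 // real_normK ?num_real.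
by split; apply: h (erefl _); rewrite sqr_normc_ReIm ?lerDl ?lerDr sqr_ge0.
Qed.

Definition box (e : R) : set K := [set v | forall k, normc (coord v k) <= e].

Lemma compact_box e : compact (box e).
Proof.
have -> : box e =
    [set v1 : 'rV[R]_r | forall j : 'I_r, `[-e, e]%classic (v1 ord0 j)] `*`
    [set v2 : 'rV[R[i]]_s | forall j : 'I_s, [set z : R[i] | normc z <= e] (v2 ord0 j)].
  apply/seteqP; split=> [v vb|v [v1 v2]].
    split=> k /=; last exact: (vb (inr k)).
    by rewrite in_itv /= -ler_norml -normc_real; exact: (vb (inl k)).
  case=> k; last exact: (v2 k).
  by have := v1 k; rewrite /= in_itv /= -ler_norml -normc_real.
apply: compact_setX.
  have h := @rV_compact R r (fun=> `[-e, e]%classic) (fun=> @segment_compact R (-e) e).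
  refine h.
have h := @rV_compact R[i] s (fun=> [set z : R[i] | normc z <= e]) (fun=> @compact_disc e).
refine h.
Qed.

End space.

(** * Words in the two contractions *)

Section words.
Context (R : realType) (alpha : R) (r s : nat) (a : 'I_r -> R) (c : 'I_s -> R[i]).
Hypothesis hconj : conj_enum alpha a c.
Hypothesis halpha : special_pisot_unit alpha.
Local Notation K := ('rV[R]_r * 'rV[R[i]]_s)%type.
Local Notation I := ('I_r + 'I_s)%type.
Local Notation sg := (sigma alpha a c).
Local Notation zr := (zring alpha).
Implicit Types (w : seq bool) (v : K) (k : I) (x z t : R).

Lemma coord_psi z k : zr z -> coord (psi alpha a c z) k = sg k z.
Proof.
move=> hz; case: k => k; rewrite /coord /psi /= mxE //.
by rewrite (sigma_inl_real hconj halpha).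
Qed.

Lemma coord_Psi z v k : zr z ->
  coord (Psi alpha a c z v) k = sg k z * coord v k.
Proof.
move=> hz; case: k => k; rewrite /coord /Psi /psi /= !mxE //.
by rewrite rmorphM (sigma_inl_real hconj halpha).
Qed.

(** The common shape, with x and t in Z[alpha], of the contractions, their words, the inverses of
    words and the mixed composites. *)
Definition affine (x t : R) v : K := Psi alpha a c x v + psi alpha a c t.

Lemma coord_affine x t v k : zr x -> zr t ->
  coord (affine x t v) k = sg k x * coord v k + sg k t.
Proof. by move=> hx ht; rewrite coordD coord_Psi // coord_psi. Qed.

Lemma affine_lipschitz x t : zr x -> zr t -> exists2 C, 0 < C &
  forall u v, normK (affine x t u - affine x t v) <= C * normK (u - v).
Proof.
move=> hx ht; exists (1 + \sum_(k : I) normc (sg k x)).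
  by rewrite ltr_wpDr // sumr_ge0 // => k _; exact: normc_ge0.
move=> u v; apply: (normK_scale (l := fun k => sg k x)) => k.
  rewrite (bigD1 k) //= addrCA lerDl addr_ge0 //.
  by apply: sumr_ge0 => l _; exact: normc_ge0.
by rewrite !coordB !coord_affine //; ring.
Qed.

Let a1 : 1 < alpha. Proof. exact: special_pisot_unit_gt1. Qed.
Let a0 : alpha != 0. Proof. by rewrite gt_eqF // (lt_trans ltr01). Qed.
Let am1 : alpha - 1 != 0. Proof. by rewrite subr_eq0 gt_eqF. Qed.
Let b0 : beta alpha != 0. Proof. by rewrite mulf_neq0 // invr_eq0. Qed.

Lemma zring_alphaV : zr alpha^-1.
Proof. by have [] := special_pisot_unit_zring halpha. Qed.

Lemma zring_beta : zr (beta alpha).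
Proof.
by have [_ ?] := special_pisot_unit_zring halpha; apply: zringM => //; exact: zring_gen.
Qed.

Lemma zring_betaV : zr (beta alpha)^-1.
Proof.
rewrite invf_div; apply: zringM; last exact: zring_alphaV.
by apply: zringB; [exact: zring_gen | exact: zring1].
Qed.

#[local] Hint Resolve zring_gen zring1 zring0 zring_alphaV zring_beta zring_betaV : core.

Definition tent_map (b : bool) : K -> K :=
  if b then f_R alpha a c else f_L alpha a c.

Definition slope (b : bool) : R := if b then - beta alpha else alpha.
Definition shift (b : bool) : R := if b then beta alpha else 0.

Lemma zring_slope b : zr (slope b).
Proof. by case: b; [apply: zringN; exact: zring_beta | exact: zring_gen]. Qed.

Lemma zring_slopeV b : zr (slope b)^-1.
Proof.
case: b; last exact: zring_alphaV.
by rewrite /slope invrN; apply: zringN; exact: zring_betaV.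
Qed.

Lemma zring_shift b : zr (shift b).
Proof. by case: b; [exact: zring_beta | exact: zring0]. Qed.

#[local] Hint Resolve zring_slope zring_slopeV zring_shift : core.

Lemma slope_neq0 b : slope b != 0.
Proof. by case: b; rewrite ?oppr_eq0. Qed.

Lemma tent_mapE b v : tent_map b v = affine (slope b) (shift b) v.
Proof.
apply: coord_inj => k; rewrite coord_affine //.
case: b => /=; last first.
  by rewrite (sigma0 hconj halpha) addr0 coord_Psi //; exact: zring_gen.
rewrite coord_Psi // coordB coord_psi; last exact: zring1.
rewrite (sigma1 hconj halpha) (sigmaN hconj halpha) //; ring.
Qed.

(* [Fword w] is the action of [fword w] on Z[alpha] itself, inside R, and [Gword w]
   its inverse: there the letters act as the inverses of x / alpha and
   1 - x / beta, the contractions of [0, 1] inverse to the tent map. *)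
Fixpoint fword w v : K :=
  if w is b :: w' then tent_map b (fword w' v) else v.

Fixpoint kappa w : R := if w is b :: w' then slope b * kappa w' else 1.

Fixpoint Fword w x : R :=
  if w is b :: w' then slope b * Fword w' x + shift b else x.

Definition Gword w x : R := (x - Fword w 0) / kappa w.

Definition fwordV w v : K := affine (kappa w)^-1 (Gword w 0) v.

Lemma kappa_neq0 w : kappa w != 0.
Proof. by elim: w => [|b w IH] /=; rewrite ?oner_eq0 // mulf_neq0 // slope_neq0. Qed.

Lemma zring_kappa w : zr (kappa w).
Proof.
by elim: w => [|b w IH] /=; [exact: zring1 | apply: zringM IH; exact: zring_slope].
Qed.

Lemma zring_kappaV w : zr (kappa w)^-1.
Proof.
elim: w => [|b w IH] /=; first by rewrite invr1; exact: zring1.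
by rewrite invfM; apply: zringM IH; exact: zring_slopeV.
Qed.

#[local] Hint Resolve zring_kappa zring_kappaV kappa_neq0 : core.

Lemma zring_Fword w x : zr x -> zr (Fword w x).
Proof.
move=> hx; elim: w => [//|b w IH] /=.
by apply: zringD; [apply: zringM => //; exact: zring_slope | exact: zring_shift].
Qed.

Lemma FwordE w x : Fword w x = kappa w * x + Fword w 0.
Proof. by elim: w => [|b w IH] /=; [ring | rewrite IH; ring]. Qed.

Lemma GwordE w x : Gword w x = (kappa w)^-1 * x + Gword w 0.
Proof. by rewrite /Gword; ring. Qed.

Lemma zring_Gword w x : zr x -> zr (Gword w x).
Proof.
move=> hx; apply: zringM; last exact: zring_kappaV.
by apply: zringB => //; apply: zring_Fword; exact: zring0.
Qed.

Lemma FwordK w x : Gword w (Fword w x) = x.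
Proof. by rewrite /Gword FwordE; field; exact: kappa_neq0. Qed.

Let zF0 w : zr (Fword w 0). Proof. by apply: zring_Fword; exact: zring0. Qed.
Let zG0 w : zr (Gword w 0). Proof. by apply: zring_Gword; exact: zring0. Qed.

#[local] Hint Resolve zF0 zG0 : core.

Lemma fword_affine w v : fword w v = affine (kappa w) (Fword w 0) v.
Proof.
apply: coord_inj => k; elim: w => [|b w IH] /=.
  rewrite coord_affine; [|exact: zring1|exact: zring0].
  by rewrite (sigma1 hconj halpha) (sigma0 hconj halpha) mul1r addr0.
have zs := zring_slope b; have zt := zring_shift b; have zk := zring_kappa w.
have zsF := zringM zs (zF0 w).
rewrite tent_mapE (coord_affine _ k zs zt) IH (coord_affine _ k zk (zF0 w)).
rewrite (coord_affine _ k (zringM zs zk) (zringD zsF zt)).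
rewrite (sigmaM hconj halpha k zs zk) (sigmaD hconj halpha k zsF zt).
by rewrite (sigmaM hconj halpha k zs (zF0 w)); ring.
Qed.

Lemma coord_fword w v k :
  coord (fword w v) k = sg k (kappa w) * coord v k + sg k (Fword w 0).
Proof. by rewrite fword_affine coord_affine // zring_kappa. Qed.

Lemma coord_fwordV w v k :
  coord (fwordV w v) k = (sg k (kappa w))^-1 * (coord v k - sg k (Fword w 0)).
Proof.
rewrite coord_affine // /Gword sub0r.
have [kV _] := sigmaV hconj halpha k (zring_kappa w) (zring_kappaV w) (kappa_neq0 w).
rewrite (sigmaM hconj halpha) ?(sigmaN hconj halpha) ?kV //; last exact: zringN.
by ring.
Qed.

Lemma sigma_kappa_neq0 w k : sg k (kappa w) != 0.
Proof.
by have [_ ] := sigmaV hconj halpha k (zring_kappa w) (zring_kappaV w) (kappa_neq0 w).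
Qed.

Lemma fwordK w v : fwordV w (fword w v) = v.
Proof.
apply: coord_inj => k; rewrite coord_fwordV coord_fword addrK mulKf //.
exact: sigma_kappa_neq0.
Qed.

Lemma fwordVK w v : fword w (fwordV w v) = v.
Proof.
apply: coord_inj => k; rewrite coord_fword coord_fwordV mulVKf ?subrK //.
exact: sigma_kappa_neq0.
Qed.

Lemma coord_fword_sub w u v k :
  coord (fword w u - fword w v) k = sg k (kappa w) * coord (u - v) k.
Proof. by rewrite !coordB !coord_fword; ring. Qed.

(** Both alpha and beta are Pisot. The image of beta is a conjugate of beta, and differs from it
    because alpha is recovered as beta / (beta - 1). *)
Lemma normc_sigma_slope_lt1 k b : normc (sg k (slope b)) < 1.
Proof.
case: b => /=; last first.
  by rewrite (sigma_gen hconj halpha); exact: normc_conjugate_lt1 hconj halpha k.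
rewrite (sigmaN hconj halpha) // normcN.
have [[_ [bint _ hb]] _] := halpha; rewrite -normc_lt.
have [p pE] := zring_beta.
have [g gn] := conjugateP hconj halpha k.
have gc : galois_conj (beta alpha) (sg k (beta alpha)).
  rewrite pE (sigma_horner hconj halpha); apply: galois_conj_horner g _.
  by rewrite -pE.
apply: hb => //; apply: contra gn => /eqP E.
have h : sg k (beta alpha) * (conjugate a c k - 1) = conjugate a c k.
  rewrite -(sigma_gen hconj halpha) -(sigma1 hconj halpha k) -(sigmaB hconj halpha).
  - rewrite -(sigmaM hconj halpha) //.
      by rewrite /beta divfK.
    by apply: zringB; [exact: zring_gen | exact: zring1].
  - exact: zring_gen.
  - exact: zring1.
have bb : (beta alpha)%:C * (alpha%:C - 1) = alpha%:C.
  by rewrite -(rmorph1 (real_complex R)) -rmorphB -rmorphM /= /beta divfK.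
have b1 : (beta alpha)%:C - 1 != 0 :> R[i].
  by rewrite -(rmorph1 (real_complex R)) -rmorphB fmorph_eq0 subr_eq0 gt_eqF // beta_gt1.
apply/eqP/(mulfI b1); rewrite !mulrBl !mul1r.
rewrite E in h; move: h bb; rewrite !mulrBr !mulr1 => h bb.
by rewrite -{2}h -{2}bb; ring.
Qed.

(** The floor 1/2 keeps [m] positive and covers an empty index set. *)
Lemma contraction_factor (f : I -> R) : (forall k, f k < 1) ->
  exists2 m, 0 < m < 1 & forall k, f k <= m.
Proof.
move=> f1; exists (\big[Num.max/2^-1]_k f k).
  apply/andP; split; last by apply/bigmax_ltP; split=> [|k _] //; rewrite invf_lt1 ?ltr1n.
  by apply: (@lt_le_trans _ _ 2^-1); [rewrite invr_gt0 | exact: bigmax_ge_id].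
by move=> k; exact: le_bigmax.
Qed.

Lemma tent_contraction : exists2 m, 0 < m < 1 &
  forall b k, normc (sg k (slope b)) <= m.
Proof.
have [m1 /andP[m10 m11] h1] := contraction_factor (fun k => normc_sigma_slope_lt1 k true).
have [m2 /andP[m20 m21] h2] := contraction_factor (fun k => normc_sigma_slope_lt1 k false).
exists (Num.max m1 m2); first by rewrite lt_max m10 gt_max m11 m21.
by move=> [] k; rewrite le_max ?h1 ?h2 ?orbT.
Qed.

(** The attractor is obtained as the intersection of a decreasing sequence of compact sets. *)
Lemma tent_tile_exists : exists F, is_tent_tile alpha a c F.
Proof.
have [m /andP[m0 m1] hm] := tent_contraction.
(* Solves m (1 + e) = e, so both maps send the box into itself; the 1 comes from the reflection in
   [f_R]. *)
pose e := m / (1 - m).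
have e0 : 0 < e by rewrite divr_gt0 // subr_gt0.
have eE : m * (1 + e) = e by rewrite /e; field; rewrite subr_eq0 gt_eqF.
have boxf b v : box e v -> box e (tent_map b v).
  move=> vb k; rewrite tent_mapE coord_affine //.
  case: b => /=; last first.
    rewrite (sigma0 hconj halpha) addr0 normcM; apply: (@le_trans _ _ (m * e)).
      by apply: ler_pM; rewrite ?normc_ge0 //; exact: (hm false).
    by rewrite ler_piMl // ltW.
  have -> : sg k (- beta alpha) * coord v k + sg k (beta alpha) =
      sg k (- beta alpha) * (coord v k - 1).
    by rewrite (sigmaN hconj halpha) //; ring.
  rewrite normcM -eE; apply: ler_pM; rewrite ?normc_ge0 //; first exact: (hm true).
  apply: (le_trans (normcB _ _)); rewrite normc1 addrC lerD2l; exact: vb.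
pose inv b := fwordV [:: b].
have invK b v : tent_map b (inv b v) = v by exact: (fwordVK [:: b]).
have invK' b v : inv b (tent_map b v) = v by exact: (fwordK [:: b]).
(* [E n] is the union of the images of the box under the words of length n, expressed through
   inverse maps so that closedness is a preimage argument. *)
pose E := fix E n : set K :=
  if n is n'.+1 then [set v | E n' (inv false v) \/ E n' (inv true v)] else box e.
have Edec n v : E n.+1 v -> E n v.
  elim: n v => [|n IH] v /=.
    by move=> [|] /boxf h; [have := h false | have := h true]; rewrite invK.
  by move=> [/IH|/IH] h; [left | right].
have Ele n n' v : (n <= n')%N -> E n' v -> E n v.
  by move=> /subnK <-; elim: (n' - n)%N => [//|d IH]; rewrite addSn => /Edec.
have Eclosed n : closed (E n).
  elim: n => [|n IH].
    by apply: compact_closed; [exact: hausdorff_normK | exact: compact_box].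
  have cl b : closed [set v | E n (inv b v)].
    apply/closed_normK => v hv; apply: ((closed_normK (E n)).1 IH) => d d0.
    have [C C0 hC] := affine_lipschitz (zring_kappaV [:: b]) (zG0 [:: b]).
    have [u Eu uv] := hv (d / C) (divr_gt0 d0 C0).
    exists (inv b u) => //; apply: (le_lt_trans (hC _ _)).
    by rewrite mulrC -ltr_pdivlMr.
  have -> : E n.+1 = [set v | E n (inv false v)] `|` [set v | E n (inv true v)] by [].
  exact: closedU.
exists [set v | forall n, E n v]; split.
(* The origin is the fixed point of [f_L]. *)
- exists 0 => n; elim: n => [|n IH] /=.
    by move=> k; rewrite coord0 normc0 ltW.
  left; have -> // : inv false 0 = 0.
  rewrite -[RHS](invK' false); congr inv; apply: coord_inj => k.
  rewrite tent_mapE coord_affine //.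
  by rewrite (sigma0 hconj halpha) coord0 mulr0 addr0.
- apply: (@subclosed_compact _ _ (box e)); last 2 first.
  + exact: compact_box.
  + by move=> v /(_ 0).
  apply/closed_normK => v hv n; apply: ((closed_normK (E n)).1 (Eclosed n)) => d /hv[u Eu uv].
  by exists u.
- apply/seteqP; split=> v.
    (* If the first preimage leaves some [E n0], it is outside all later ones, so the second
       preimage lies in [E n] for arbitrarily large n, hence for all n. *)
    move=> hv; have [h|h] := pselect (forall n, E n (inv false v)).
      by left; exists (inv false v) => //; exact: (invK false).
    right; exists (inv true v); last exact: (invK true).
    have [n0 hn0] : exists n, ~ E n (inv false v) by apply: contrapT => /forallNP h';
      apply: h => n; apply: contrapT; exact: h'.
    move=> n; apply: (Ele n (n + n0)%N); first exact: leq_addr.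
    have [h'|//] := hv (n + n0).+1.
    by case: hn0; apply: Ele h'; exact: leq_addl.
  move=> [[u hu <-]|[u hu <-]] n; apply: Edec => /=.
    by left; rewrite -[f_L _ _ _]/(tent_map false) invK'.
  by right; rewrite -[f_R _ _ _]/(tent_map true) invK'.
Qed.

End words.

(** Translation by one element of T embeds T into D. With [zring_finite] it bounds the number of
    points in a window independently of where the window is. *)
Lemma size_le_differences (R : zmodType) (T D : seq R) :
  uniq T -> (forall x y, x \in T -> y \in T -> x - y \in D) -> (size T <= size D)%N.
Proof.
case: T => [//|x0 T] uT h.
rewrite -(size_map (fun x => x - x0)); apply: uniq_leq_size.
  by rewrite map_inj_uniq // => x y /addIr.
by move=> _ /mapP[x xT ->]; apply: h => //; exact: mem_head.
Qed.

Lemma count_le_classes (T C : eqType) (cls : T -> C) (Q : pred T)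
    (s : seq T) (cs : seq C) (D : nat) :
  {in s, forall x, cls x \in cs} ->
  (forall c, (count [pred x | Q x && (cls x == c)] s <= D)%N) ->
  (count Q s <= size cs * D)%N.
Proof.
move=> clsP hD.
have : (count Q s <= \sum_(c <- cs) count [pred x | Q x && (cls x == c)] s)%N.
  elim: s clsP {hD} => [//|x s IH] clsP /=; rewrite big_split /= leq_add //; last first.
    by apply: IH => y ys; apply: clsP; rewrite inE ys orbT.
  by case: (Q x) => //=; rewrite (big_rem (cls x)) ?clsP ?mem_head //= eqxx.
move=> /leq_trans; apply; rewrite -sum1_size big_distrl /=.
by apply: leq_sum => c _; rewrite mul1n.
Qed.

Lemma sum_le_single (n D : nat) (f : nat -> nat) : (forall k, (f k <= D)%N) ->
  (forall k l, (k < l)%N -> (0 < f k)%N -> (0 < f l)%N -> False) ->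
  (\sum_(k < n) f k <= D)%N.
Proof.
move=> fD f1; have [/existsP[k fk]|] := boolP [exists k : 'I_n, (0 < f k)%N].
  rewrite (bigD1 k) //= big1 => [|l /negP lk]; first by rewrite addn0; exact: fD.
  apply/eqP; rewrite -leqn0 leqNgt; apply/negP => fl; apply: lk; apply/eqP/val_inj => /=.
  by case: (ltngtP l k) => // h; [case: (f1 _ _ h fl fk) | case: (f1 _ _ h fk fl)].
rewrite negb_exists => /forallP h; rewrite big1 // => k _.
by have := h k; rewrite -eqn0Ngt => /eqP.
Qed.

Lemma count_exchange (A B : Type) (n : nat) (V : nat -> seq A) (S : seq B)
    (P : A -> B -> bool) :
  (\sum_(k < n) \sum_(v <- V k) count (P v) S =
   \sum_(z <- S) \sum_(k < n) count (P ^~ z) (V k))%N.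
Proof.
rewrite exchange_big /=; apply: eq_bigr => k _.
under eq_bigr do rewrite -sum1_count big_mkcond /=.
under [RHS]eq_bigr do rewrite -sum1_count big_mkcond /=.
by rewrite exchange_big.
Qed.

(** * The stopping-time code *)

Section prefix_code.
Context (i j : nat).
Hypothesis i0 : (0 < i)%N.
Hypothesis j0 : (0 < j)%N.
Implicit Types (w : seq bool).

Definition weight w : nat := \sum_(b <- w) (if b then j else i).

Lemma weight_cons b w : weight (b :: w) = ((if b then j else i) + weight w)%N.
Proof. by rewrite /weight big_cons. Qed.

(* The stopping-time prefix code: the words whose weight first reaches [m];
   [n] is fuel and has to be at least [m]. *)
Fixpoint code n m : seq (seq bool) :=
  match n, m with
  | n'.+1, m'.+1 => map (cons false) (code n' (m - i)%N) ++ map (cons true) (code n' (m - j)%N)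
  | _, _ => [:: [::]]
  end.

Lemma code0 n : code n 0 = [:: [::]].
Proof. by case: n. Qed.

Lemma code_weight n m w : (m <= n)%N -> w \in code n m ->
  (m <= weight w < m + (i + j))%N.
Proof.
elim: n m w => [|n IH] m w.
  rewrite leqn0 => /eqP-> /=; rewrite inE => /eqP->.
  by rewrite /weight big_nil; lia.
case: m => [|m] mn.
  by rewrite /= inE => /eqP->; rewrite /weight big_nil; lia.
have step e u : (0 < e <= i + j)%N -> u \in code n (m.+1 - e)%N ->
    (m.+1 <= e + weight u < m.+1 + (i + j))%N.
  move=> e0 uc; have [em|em] := leqP e m.
    have /IH/(_ uc) : (m.+1 - e <= n)%N by lia.
    lia.
  move: uc; have -> : (m.+1 - e = 0)%N by lia.
  by rewrite code0 inE => /eqP->; rewrite /weight big_nil; lia.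
rewrite /= mem_cat => /orP[] /mapP[u uc ->]; rewrite weight_cons; apply: step uc; lia.
Qed.

Lemma code_uniq n m : uniq (code n m).
Proof.
elim: n m => [|n IH] [|m] //=.
rewrite cat_uniq !map_inj_uniq ?IH ?andbT //=; try by move=> ? ? [].
by apply/hasPn => w /mapP[u _ ->]; apply/mapP => -[].
Qed.

End prefix_code.

Section codes.
Context (R : realType) (alpha eta : R) (i j : nat).
Hypothesis halpha : special_pisot_unit alpha.
Hypothesis i0 : (0 < i)%N.
Hypothesis j0 : (0 < j)%N.
Hypothesis alphaE : alpha = eta ^+ i.
Hypothesis betaE : beta alpha = eta ^+ j.
Hypothesis eta1 : 1 < eta.
Local Notation weight := (weight i j).
Local Notation code := (code i j).
Implicit Types (w v : seq bool) (x : R).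

Let a1 : 1 < alpha. Proof. exact: special_pisot_unit_gt1. Qed.
Let eta0 : 0 < eta. Proof. exact: lt_trans ltr01 eta1. Qed.

Lemma alphaV_betaV : alpha^-1 + (beta alpha)^-1 = 1.
Proof.
have a0 : alpha != 0 by rewrite gt_eqF // (lt_trans ltr01).
have am1 : alpha - 1 != 0 by rewrite subr_eq0 gt_eqF.
by rewrite /beta; field; rewrite a0 am1.
Qed.

Lemma kappaE w : kappa alpha w = (-1) ^+ odd (count id w) * eta ^+ weight w.
Proof.
elim: w => [|b w IH]; first by rewrite /weight big_nil /= !expr0 mul1r.
rewrite weight_cons exprD /= IH oddD; case: b; rewrite /= ?betaE ?alphaE.
  by rewrite signrN; ring.
by ring.
Qed.

Lemma kappa_norm w : `|kappa alpha w| = eta ^+ weight w.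
Proof. by rewrite kappaE normrM normr_sign mul1r ger0_norm // exprn_ge0 // ltW. Qed.

Lemma Gword_cons b w x :
  Gword alpha (b :: w) x = Gword alpha w (if b then 1 - x / beta alpha else x / alpha).
Proof.
have bne : beta alpha != 0.
  by rewrite gt_eqF // (lt_trans ltr01) // beta_gt1.
have ane : alpha != 0 by rewrite gt_eqF // (lt_trans ltr01).
have kne := kappa_neq0 halpha w.
by case: b; rewrite /Gword /=; field; rewrite ?kne ?ane ?bne.
Qed.

Lemma Gword_nil x : Gword alpha [::] x = x.
Proof. by rewrite /Gword /= subr0 divr1. Qed.

Lemma Gword_rcons b w x :
  Gword alpha (rcons w b) x =
    if b then 1 - Gword alpha w x / beta alpha else Gword alpha w x / alpha.
Proof.
elim: w x => [|b' w IH] x; first by rewrite /= Gword_cons !Gword_nil.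
by rewrite rcons_cons !Gword_cons IH.
Qed.

Lemma kappa_rcons b w : kappa alpha (rcons w b) = kappa alpha w * slope alpha b.
Proof. by elim: w => [|b' w IH] /=; rewrite ?mulr1 ?mul1r // IH mulrA. Qed.

Lemma Gword_itv w x : 0 <= x <= 1 -> 0 <= Gword alpha w x <= 1.
Proof.
elim: w x => [|b w IH] x x01; first by rewrite /Gword /= subr0 divr1.
have a0 : 0 < alpha := lt_trans ltr01 a1.
have b1 := beta_gt1 a1; have b0 : 0 < beta alpha := lt_trans ltr01 b1.
rewrite Gword_cons; apply: IH; case/andP: x01 => x0 x1; case: b.
  rewrite subr_ge0 ler_pdivrMr // mul1r lerBlDr lerDl divr_ge0 ?(ltW b0) //.
  by rewrite (le_trans x1) ?ltW.
by rewrite divr_ge0 ?(ltW a0) // ler_pdivrMr // mul1r (le_trans x1) // ltW.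
Qed.

(** The start 1/2 is interior on purpose: both letters send the endpoint 1 to 1/alpha, where the
    last letter could not be read off. *)
Lemma Gword_half_itv w : 0 < Gword alpha w 2^-1 < 1.
Proof.
have a0 : 0 < alpha := lt_trans ltr01 a1.
have b1 := beta_gt1 a1; have b0 : 0 < beta alpha := lt_trans ltr01 b1.
elim/last_ind: w => [|w b /andP[x0 x1]].
  by rewrite Gword_nil; lra.
rewrite Gword_rcons; case: b.
  rewrite subr_gt0 ltr_pdivrMr // mul1r ltrBlDr ltrDl divr_gt0 //.
  by rewrite (lt_trans x1).
by rewrite divr_gt0 // ltr_pdivrMr // mul1r (lt_trans x1).
Qed.

(* The last letter of [w] is read off the half of [0, 1] that contains the
   image of 1/2 under [Gword alpha w], on either side of 1/alpha. *)
Lemma Gword_inj v w : kappa alpha v = kappa alpha w ->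
  Gword alpha v 2^-1 = Gword alpha w 2^-1 -> v = w.
Proof.
have a0 : 0 < alpha := lt_trans ltr01 a1.
have b1 := beta_gt1 a1; have b0 : 0 < beta alpha := lt_trans ltr01 b1.
have wt0 u b : kappa alpha (rcons u b) = 1 -> False.
  move=> /(congr1 Num.norm); rewrite kappa_norm normr1 => /eqP.
  rewrite pexprn_eq1 ?ltW // => /orP[|]; last by rewrite gt_eqF.
  rewrite /weight -cats1 big_cat big_seq1 /= addn_eq0 => /andP[_].
  by case: b; rewrite eqn0Ngt ?i0 ?j0.
have half (x y : R) : 0 < x < 1 -> 0 < y < 1 -> 1 - x / beta alpha = y / alpha -> False.
  move=> /andP[x0 x1] /andP[y0 y1] E.
  have : x / beta alpha < (beta alpha)^-1 by rewrite ltr_pdivrMr // mulVf // gt_eqF.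
  have : y / alpha < alpha^-1 by rewrite ltr_pdivrMr // mulVf // gt_eqF.
  have := alphaV_betaV; lra.
elim/last_ind: v w => [|v b IH] w; case/lastP: w => [//|w b'].
- by move=> /esym/wt0.
- by move=> /wt0.
rewrite !kappa_rcons !Gword_rcons => hk hG.
have hv := Gword_half_itv v; have hw := Gword_half_itv w.
have bb : b = b'.
  case: b b' hG {hk} => [] [] // hG; first by case: (half _ _ hv hw).
  by case: (half _ _ hw hv).
rewrite -bb in hk hG *; congr rcons; apply: IH.
  by apply: mulIf hk; exact: slope_neq0.
case: b {bb hk} hG; last by apply: mulIf; rewrite invr_eq0 gt_eqF.
by move=> /addrI/oppr_inj; apply: mulIf; rewrite invr_eq0 gt_eqF.
Qed.

(** Splitting off the first letter reproduces the sum, by 1/alpha + 1/beta = 1. In the count this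
    gives every level the same total, whatever its index. *)
Lemma code_sum n m : (m <= n)%N -> \sum_(w <- code n m) (eta ^+ weight w)^-1 = 1.
Proof.
have base : \sum_(w <- [:: [::]]) (eta ^+ weight w)^-1 = 1.
  by rewrite big_seq1 /weight big_nil expr0 invr1.
elim: n m => [|n IH] [|m] // mn.
rewrite /= big_cat /= !big_map.
under eq_bigr do rewrite weight_cons exprD invfM.
under [X in _ + X]eq_bigr do rewrite weight_cons exprD invfM.
rewrite -!mulr_sumr !IH; [|lia|lia].
by rewrite !mulr1 -alphaE -betaE alphaV_betaV.
Qed.

End codes.

(** * The interior of the tile *)

Section tile.
Context (R : realType) (alpha : R) (r s : nat) (a : 'I_r -> R) (c : 'I_s -> R[i]).
Hypothesis hconj : conj_enum alpha a c.
Hypothesis halpha : special_pisot_unit alpha.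
Local Notation K := ('rV[R]_r * 'rV[R[i]]_s)%type.
Local Notation I := ('I_r + 'I_s)%type.
Local Notation sg := (sigma alpha a c).
Local Notation zr := (zring alpha).
Local Notation aff := (affine alpha a c).
Local Notation fw := (fword alpha a c).
Variable F : set K.
Hypothesis hF : is_tent_tile alpha a c F.
Implicit Types (u v y p : K) (k : I) (x t z : R) (w : seq bool).

Lemma affineK x t v : zr x -> zr x^-1 -> zr t -> x != 0 ->
  aff x^-1 (- (x^-1 * t)) (aff x t v) = v.
Proof.
move=> hx hxV ht x0; have zt := zringM hxV ht.
apply: coord_inj => k.
have [xV s0] := sigmaV hconj halpha k hx hxV x0.
rewrite !(coord_affine hconj halpha) //; last exact: zringN.
rewrite (sigmaN hconj halpha) // (sigmaM hconj halpha) // xV.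
by rewrite mulrDr mulKf // addrK.
Qed.

Lemma affineVK x t v : zr x -> zr x^-1 -> zr t -> x != 0 ->
  aff x t (aff x^-1 (- (x^-1 * t)) v) = v.
Proof.
move=> hx hxV ht x0; have zt := zringM hxV ht.
apply: coord_inj => k; have [xV s0] := sigmaV hconj halpha k hx hxV x0.
rewrite !(coord_affine hconj halpha) //; last exact: zringN.
rewrite (sigmaN hconj halpha) // (sigmaM hconj halpha) // xV.
by rewrite mulrDr mulrN !mulVKf // addrNK.
Qed.

Lemma tile_closed : closed F.
Proof. by have [_ cF _] := hF; apply: compact_closed cF; exact: hausdorff_normK. Qed.

Lemma tile_fword w v : F v -> F (fw w v).
Proof.
have [_ _ FE] := hF; move=> Fv; elim: w => [//|b w IH] /=.
by rewrite FE; case: b; [right | left]; exists (fw w v).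
Qed.

Lemma tile_cover i j n m v : F v -> (0 < i)%N -> (0 < j)%N -> (m <= n)%N ->
  exists w u, [/\ w \in code i j n m, F u & v = fw w u].
Proof.
have [_ _ FE] := hF; move=> Fv i0 j0.
elim: n m v Fv => [|n IH] [|m] // v Fv mn; try by exists [::], v; rewrite inE.
have := Fv; rewrite {1}FE => -[] [u Fu <-].
  have [|w [u' [wc Fu' ->]]] := IH (m.+1 - i)%N _ Fu; first by lia.
  exists (false :: w), u'; split=> //.
  by rewrite /= mem_cat map_f.
have [|w [u' [wc Fu' ->]]] := IH (m.+1 - j)%N _ Fu; first by lia.
exists (true :: w), u'; split=> //.
by rewrite /= mem_cat map_f ?orbT.
Qed.

Definition good_pattern (q : R * R) : Prop :=
  [/\ zr q.1, zr q.1^-1, zr q.2 & q.1 != 0].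

(* Baire-type argument: each affine copy of [F] is closed with empty interior. *)
Lemma avoid_copies (l : seq (R * R)) y (e : R) : 0 < e ->
  (forall v (d : R), 0 < d -> exists2 u, normK (u - v) < d & ~ F u) ->
  exists y1 e1, [/\ 0 < e1, normK (y1 - y) + e1 <= e &
    forall q, q \in l -> good_pattern q -> forall p, F p ->
      e1 <= normK (aff q.1 q.2 p - y1)].
Proof.
move=> e0 thin; elim: l => [|[x t] l [y1 [e1 [e10 y1e h1]]]].
  by exists y, e; split=> //; rewrite subrr normK0 add0r.
have [[/= hx hxV ht x0]|bad] := pselect (good_pattern (x, t)); last first.
  exists y1, e1; split=> // q; rewrite inE => /predU1P[->|/h1] //.
have ht' : zr (- (x^-1 * t)) by apply: zringN; exact: zringM.
have [C C0 hC] := affine_lipschitz hconj halpha hx ht.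
have [C' C'0 hC'] := affine_lipschitz hconj halpha hxV ht'.
pose g := aff x^-1 (- (x^-1 * t)).
have [u uy1 nFu] := thin (g y1) (e1 / C) (divr_gt0 e10 C0).
have [d d0 dF] : exists2 d, 0 < d & forall p, F p -> d <= normK (p - u).
  apply: contrapT => nd; apply: nFu; apply: (closed_normK F).1 tile_closed _ _ => d d0.
  apply: contrapT => nu; apply: nd; exists d => // p Fp; rewrite leNgt.
  by apply/negP => pu; apply: nu; exists p.
have y2y1 : normK (aff x t u - y1) < e1.
  rewrite -[y1 in X in X < _](affineVK y1 hx hxV ht x0).
  by apply: le_lt_trans (hC _ _) _; rewrite mulrC -ltr_pdivlMr.
set y2 := aff x t u in y2y1.
(* The first bound stays inside the previous ball and so keeps the copies treated before; the second
   pulls the distance from [u] to F back through the inverse map. *)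
pose e2 := Num.min (e1 - normK (y2 - y1)) (d / C').
exists y2, e2.
have e20 : 0 < e2 by rewrite lt_min subr_gt0 y2y1 divr_gt0.
have e2e1 : normK (y2 - y1) + e2 <= e1 by rewrite -lerBrDl ge_min lexx.
split=> //.
  by have := normK_tri y1 y2 y; lra.
move=> q; rewrite inE => /predU1P[-> _ p Fp /=|ql gq p Fp].
  have : e2 <= d / C' by rewrite ge_min lexx orbT.
  move=> /le_trans; apply; rewrite ler_pdivrMr // mulrC.
  apply: le_trans (dF p Fp) _.
  by have := hC' (aff x t p) y2; rewrite /y2 !affineK.
apply: (@le_trans _ _ (e1 - normK (y2 - y1))); first by rewrite ge_min lexx.
by rewrite lerBlDr (le_trans (h1 _ ql gq p Fp)) // normK_tri.
Qed.

End tile.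

Section unit.
Context (R : realType) (alpha : R) (r s : nat) (a : 'I_r -> R) (c : 'I_s -> R[i]).
Hypothesis hconj : conj_enum alpha a c.
Hypothesis halpha : special_pisot_unit alpha.
Context (eta : R) (i j : nat).
Hypothesis i0 : (0 < i)%N.
Hypothesis j0 : (0 < j)%N.
Hypothesis alphaE : alpha = eta ^+ i.
Hypothesis betaE : beta alpha = eta ^+ j.
Hypothesis eta1 : 1 < eta.
Hypothesis zeta : zring alpha eta.
Hypothesis zetaV : zring alpha eta^-1.
Local Notation K := ('rV[R]_r * 'rV[R[i]]_s)%type.
Local Notation I := ('I_r + 'I_s)%type.
Local Notation sg := (sigma alpha a c).
Local Notation zr := (zring alpha).
Local Notation aff := (affine alpha a c).
Local Notation fw := (fword alpha a c).
Local Notation fwV := (fwordV alpha a c).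
Local Notation kap := (kappa alpha).
Local Notation Fw := (Fword alpha).
Local Notation Gw := (Gword alpha).
Local Notation wt := (weight i j).
Local Notation J := (i + j)%N.
Implicit Types (u y p : K) (k : I) (x t z : R) (v w : seq bool).

Let eta0 : 0 < eta. Proof. exact: lt_trans ltr01 eta1. Qed.
Let etan0 : eta != 0. Proof. by rewrite gt_eqF. Qed.

(** The i-th power of the image of eta is a conjugate of alpha, of modulus below 1. *)
Lemma normc_sigma_unit : exists2 rho, 0 < rho < 1 & forall k, normc (sg k eta) <= rho.
Proof.
apply: (contraction_factor (f := fun k => normc (sg k eta))) => k.
rewrite ltNge; apply/negP => /(exprn_ege1 i).
rewrite -normcX -(sigmaX hconj halpha) // -alphaE leNgt.
by rewrite (normc_sigma_slope_lt1 hconj halpha k false).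
Qed.

Lemma zring_signed_power (b : bool) n : zr ((-1) ^+ b * eta ^+ n).
Proof.
by apply: zringM; apply: zringX => //; apply: zringN; exact: zring1.
Qed.

Lemma zring_signed_powerV (b : bool) n : zr ((-1) ^+ b * eta ^+ n)^-1.
Proof.
rewrite invfM -!exprVn invrN1.
by apply: zringM; apply: zringX => //; apply: zringN; exact: zring1.
Qed.

Lemma normc_sigma_signed_power k (b : bool) n :
  normc (sg k ((-1) ^+ b * eta ^+ n)) = normc (sg k eta) ^+ n.
Proof.
have zX := zringX n zeta; have z1 : zr 1 := zring1 alpha.
case: b; rewrite ?expr1 ?expr0 ?mul1r ?mulN1r ?(sigmaN hconj halpha) ?normcN //.
  by rewrite (sigmaX hconj halpha) // normcX.
by rewrite (sigmaX hconj halpha) // normcX.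
Qed.

(** Here the common unit pays off: words whose weights differ by less than [J] have only finitely
    many ratios. *)
Lemma kappa_ratio v w : (wt v <= wt w)%N ->
  exists b : bool, kap w / kap v = (-1) ^+ b * eta ^+ (wt w - wt v).
Proof.
move=> vw; exists (odd (count id v) (+) odd (count id w)).
rewrite !(kappaE alphaE betaE) invfM -[X in _ / X]invrK.
have -> : ((-1) ^+ odd (count id v))^-1 = (-1) ^+ odd (count id v) :> R.
  by rewrite -exprVn invrN1.
rewrite signr_addb -[in LHS](subnK vw) exprD invrK.
by field; rewrite expf_neq0.
Qed.

Lemma fwordV_fword v w p :
  fwV v (fw w p) = aff (kap w / kap v) (Gw v (Fw w 0)) p.
Proof.
have zF (u : seq bool) : zr (Fw u 0) by apply: zring_Fword => //; exact: zring0.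
have zkk : zr (kap w / kap v).
  by apply: zringM; [exact: zring_kappa | exact: zring_kappaV].
apply: coord_inj => k.
rewrite (coord_affine hconj halpha) //; last by apply: zring_Gword; [exact: halpha|].
rewrite (coord_fwordV hconj halpha) (coord_fword hconj halpha).
have [kV k0] := sigmaV hconj halpha k (zring_kappa halpha v)
  (zring_kappaV halpha v) (kappa_neq0 halpha v).
rewrite /Gword !(sigmaM hconj halpha) ?(sigmaB hconj halpha) ?kV //;
  try exact: zring_kappa; try exact: zring_kappaV; try exact: zringB.
by ring.
Qed.

(** [Gword u 0] lies in [0, 1], which bounds the translation part [Fword u 0] by the multiplier of
    u. *)
Lemma Gword_Fword_bound v w : (wt v <= wt w)%N ->
  `|Gw v (Fw w 0)| <= eta ^+ (wt w - wt v) + 1.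
Proof.
move=> vw; have bound (u : seq bool) : `|Fw u 0| <= eta ^+ wt u.
  have := Gword_itv halpha u (x := 0).
  rewrite lexx ler01 => /(_ isT); rewrite /Gword sub0r -(kappa_norm alphaE betaE eta1).
  move=> /andP[h0 h1].
  have : `|- Fw u 0 / kap u| <= 1 by rewrite ger0_norm.
  by rewrite normrM normrN normfV ler_pdivrMr ?mul1r // normr_gt0 (kappa_neq0 halpha).
rewrite /Gword normrM normfV (kappa_norm alphaE betaE eta1) ler_pdivrMr ?exprn_gt0 //.
rewrite mulrDl mul1r -exprD subnK //.
exact: le_trans (ler_normB _ _) (lerD (bound _) (bound _)).
Qed.

Variable F : set K.
Hypothesis hF : is_tent_tile alpha a c F.
Section thin.
Hypothesis thin : forall y (e : R), 0 < e -> exists2 u, normK (u - y) < e & ~ F u.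

(* In the unit ball the expanded tile [fwordV v @` F] is made of copies of [F]
   from a finite list independent of [v], hence avoids a fixed ball. *)
Lemma avoid_tile : exists (y0 : K) (r0 : R), [/\ 0 < r0, normK y0 + 2 * r0 <= 1 &
  forall v u, F u -> normK (fwV v u) < 1 -> 2 * r0 <= normK (fwV v u - y0)].
Proof.
have [_ cF _] := hF; have [M hM] := compact_normK_bounded cF.
(* Candidates for the translations: eta^J + 1 bounds their real size, and 1 + M their conjugates
   when the copy meets the unit ball. *)
have [T hT] := zring_finite hconj halpha (Num.max (eta ^+ J + 1) (1 + M)).
pose X := [seq (-1) ^+ (b : bool) * eta ^+ e | b <- [:: true; false], e <- iota 0 J].
have [y0 [e1 [e10 y0e1 he1]]] := avoid_copies hconj halpha hF
  [seq (x, t) | x <- X, t <- T] 0 ltr01 thin.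
exists y0, (e1 / 2); have -> : 2 * (e1 / 2) = e1 by rewrite mulrC divfK ?pnatr_eq0.
split; rewrite ?divr_gt0 //.
  by rewrite subr0 in y0e1.
move=> v u Fu; have [v' [p [v'c Fp ->]]] := tile_cover hF Fu i0 j0 (leqnn (wt v)).
have /andP[vv' v'J] := code_weight i0 j0 (leqnn _) v'c.
have [b xE] := kappa_ratio vv'.
set x := kap v' / kap v in xE *; set t := Gw v (Fw v' 0).
have zt : zr t by apply: zring_Gword => //; apply: zring_Fword => //; exact: zring0.
have zx : zr x by rewrite xE; exact: zring_signed_power.
rewrite fwordV_fword -/x -/t => small.
have xt : (x, t) \in [seq (x, t) | x <- X, t <- T].
  apply: allpairs_f.
    by rewrite xE; apply: allpairs_f; rewrite ?mem_iota; [case: (b) | lia].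
  apply: hT => // [|k].
    apply: (@le_trans _ _ (eta ^+ J + 1)); last by rewrite le_max lexx.
    apply: le_trans (Gword_Fword_bound vv') _; rewrite lerD2r.
    by rewrite ler_weXn2l ?ltW //; lia.
  rewrite le_max; apply/orP; right.
  have -> : sg k t = coord (aff x t p) k - sg k x * coord p k.
    by rewrite (coord_affine hconj halpha) // addrAC subrr add0r.
  apply: le_trans (normcB _ _) _; apply: lerD.
    by apply: le_trans (coord_le_normK _ _) (ltW small).
  rewrite normcM -[M]mul1r ler_pM ?normc_ge0 //.
    rewrite xE normc_sigma_signed_power exprn_ile1 ?normc_ge0 //.
    by have [rho /andP[_ r1] hr] := normc_sigma_unit; apply: le_trans (hr k) (ltW r1).
  exact: le_trans (coord_le_normK _ _) (hM p Fp).
apply: (he1 _ xt) => //=; split=> //=; rewrite xE; first exact: zring_signed_powerV.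
by rewrite mulf_neq0 ?signr_eq0 ?expf_neq0.
Qed.

End thin.

Lemma small_power (rho e : R) : 0 < rho < 1 -> 0 < e -> exists n, rho ^+ n < e.
Proof.
move=> /andP[r0 r1] e0.
have : `|rho| < 1 by rewrite ger0_norm // ltW.
move=> /cvg_expr/cvgr0Pnorm_lt/(_ e e0)[n _ /(_ n (leqnn n))/=].
by rewrite ger0_norm ?exprn_ge0 ?ltW // => ?; exists n.
Qed.

(** Approximate a rescaled target within R0, then multiply by eta^N: the conjugates shrink below r0,
    at the price of real gaps of about 2 R0 eta^N. *)
Lemma zring_dense_near (y0 : K) (r0 : R) : 0 < r0 -> exists2 H0 : R, 0 < H0 &
  forall x, exists q, [/\ zr q, x <= q < x + H0 & normK (psi alpha a c q - y0) < r0].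
Proof.
move=> r00; have [R0 hR0] := zring_relatively_dense hconj halpha.
have R00 : 0 <= R0.
  have [|z [_ zx _]] := hR0 0 (fun _ => 0); first by [].
  exact: le_trans (normr_ge0 _) zx.
have [rho rho01 hrho] := normc_sigma_unit.
pose C := #|{: I}|%:R * R0 + 1.
have C0 : 0 < C by rewrite ltr_wpDl // mulr_ge0.
have [N hN] := small_power rho01 (divr_gt0 r00 C0).
have zN : zr (eta ^+ N) := zringX N zeta.
have zNV : zr (eta ^+ N)^-1 by rewrite -exprVn; apply: zringX.
have E0 : 0 < eta ^+ N by rewrite exprn_gt0.
have En0 : eta ^+ N != 0 by rewrite gt_eqF.
have z0 : zr 0 := zring0 alpha.
exists (2 * R0 * eta ^+ N + 1).
  by rewrite ltr_wpDl // !mulr_ge0 // ltW.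
move=> x; have [|z [hz zx zy]] := hR0 (x / eta ^+ N + R0)
  (coord (aff (eta ^+ N)^-1 0 y0)); first by [].
have zq : zr (eta ^+ N * z) by exact: zringM.
exists (eta ^+ N * z); split=> //.
  move: zx; rewrite ler_norml => /andP[h1 h2].
  have h3 : x / eta ^+ N <= z by lra.
  have h4 : z <= x / eta ^+ N + 2 * R0 by lra.
  rewrite ler_pdivrMr // mulrC in h3; rewrite h3 /=.
  move: h4; rewrite -(ler_pM2l E0) mulrDr mulrCA divff // mulr1 => h4.
  by apply: le_lt_trans h4 _; rewrite [2 * R0 * _]mulrC addrA ltrDl.
apply: (@le_lt_trans _ _ (#|{: I}|%:R * (rho ^+ N * R0))).
  apply: normK_le => k; rewrite coordB (coord_psi hconj halpha) //.
  rewrite (sigmaM hconj halpha) //.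
  have [kV k0] := sigmaV hconj halpha k zN zNV En0.
  have -> : sg k (eta ^+ N) * sg k z - coord y0 k =
      sg k (eta ^+ N) * (sg k z - coord (aff (eta ^+ N)^-1 0 y0) k).
    rewrite (coord_affine hconj halpha) // kV (sigma0 hconj halpha) addr0.
    by rewrite mulrBr mulVKf.
  rewrite normcM (sigmaX hconj halpha) // normcX ler_pM ?exprn_ge0 ?normc_ge0 //.
  by rewrite lerXn2r ?nnegrE ?normc_ge0 // ltW; case/andP: rho01.
rewrite mulrCA; move: hN; rewrite ltr_pdivlMr // => /(le_lt_trans _); apply.
rewrite ler_wpM2l ?exprn_ge0 ?lerDl //.
by case/andP: rho01 => /ltW.
Qed.

Lemma psi_Gword v z : zr z -> psi alpha a c (Gw v z) = fwV v (psi alpha a c z).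
Proof.
move=> hz; have zF : zr (Fw v 0) by apply: zring_Fword => //; exact: zring0.
have zk := zring_kappa halpha v; have zkV := zring_kappaV halpha v.
apply: coord_inj => k; rewrite (coord_fwordV hconj halpha).
rewrite !(coord_psi hconj halpha) //; last by apply: zring_Gword.
have [kV _] := sigmaV hconj halpha k zk zkV (kappa_neq0 halpha v).
rewrite /Gword (sigmaM hconj halpha) ?(sigmaB hconj halpha) ?kV //; last exact: zringB.
exact: mulrC.
Qed.

(** Cut [0, E] by integer parts: points of one class have their differences in one finite list, so
    the total is linear in E. *)
Lemma zring_window (B : R) : exists D : nat, forall E : R, 0 <= E -> exists S : seq R,
  [/\ uniq S, {in S, forall z, zr z},
      forall z, zr z -> 0 <= z <= E -> (forall k, normc (sg k z) <= B) -> z \in S &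
      (size S)%:R <= D%:R * (E + 1)].
Proof.
have [T hT] := zring_finite hconj halpha (Num.max 1 (B + B)).
exists (size T) => E E0.
have [l hl] := zring_finite hconj halpha (Num.max E B).
pose P z := `[< [/\ zr z, 0 <= z <= E & forall k, normc (sg k z) <= B] >].
pose S : seq R := undup [seq z <- l | P z].
have SP z : z \in S -> [/\ zr z, 0 <= z <= E & forall k, normc (sg k z) <= B].
  by rewrite mem_undup mem_filter => /andP[/asboolP].
exists S; split; first exact: undup_uniq.
- by move=> z /SP[].
- move=> z hz /andP[z0 zE] hk; rewrite mem_undup mem_filter; apply/andP; split.
    by apply/asboolP; split=> //; rewrite z0.
  apply: hl => // [|k]; first by rewrite ger0_norm // le_max zE.
  by rewrite le_max hk orbT.
have : (count predT S <= size (iota 0 (Num.truncn E).+1) * size T)%N.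
  apply: (count_le_classes (cls := fun z => Num.truncn z)).
    move=> z /SP[_ /andP[z0 zE] _]; rewrite mem_iota /= add0n ltnS.
    exact: le_truncn.
  move=> n; rewrite -size_filter; apply: size_le_differences.
    exact: filter_uniq (undup_uniq _).
  move=> z z'; rewrite !mem_filter /= => /andP[/eqP zn zS] /andP[/eqP zn' zS'].
  have [hz /andP[z0 _] hk] := SP z zS; have [hz' /andP[z0' _] hk'] := SP z' zS'.
  apply: hT; first exact: zringB.
    have := truncn_itv z0; have := truncn_itv z0'; rewrite zn zn' -[n.+1]addn1 natrD.
    move=> /andP[h1 h2] /andP[h3 h4]; rewrite le_max ler_norml.
    by apply/orP; left; apply/andP; split; lra.
  move=> k; rewrite (sigmaB hconj halpha) // le_max; apply/orP; right.
  exact: le_trans (normcB _ _) (lerD (hk k) (hk' k)).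
rewrite count_predT size_iota mulnC -(ler_nat R) natrM => /le_trans; apply.
rewrite ler_wpM2l // -addn1 natrD lerD2r.
by have /andP[] := truncn_itv E0.
Qed.

(** * Counting points of Z[alpha] against words *)

Section counting.
Context (y0 : K) (r0 M : R).
Hypothesis r00 : 0 < r0.
Hypothesis y0r0 : normK y0 + 2 * r0 <= 1.
Hypothesis avoid : forall v u, F u -> normK (fwV v u) < 1 -> 2 * r0 <= normK (fwV v u - y0).
Hypothesis hM : forall u, F u -> normK u <= M.

Definition near v z : bool := normK (psi alpha a c (Gw v z) - y0) < r0.

Lemma near_le1 v z : near v z -> normK (psi alpha a c (Gw v z)) <= 1.
Proof.
move=> h; have := normKD (psi alpha a c (Gw v z) - y0) y0.
rewrite subrK => /le_trans; apply; rewrite addrC; apply: le_trans y0r0.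
by rewrite lerD2l (le_trans (ltW h)) // ler_peMl ?ler1n // ltW.
Qed.

Lemma normc_sigma_le1 k (b : bool) n : normc (sg k ((-1) ^+ b * eta ^+ n)) <= 1.
Proof.
have [rho /andP[_ rho1] hrho] := normc_sigma_unit.
rewrite normc_sigma_signed_power exprn_ile1 ?normc_ge0 //.
exact: le_trans (hrho k) (ltW rho1).
Qed.

(** The point is the image under f_v of some y in the unit ball. As f_v does not expand, it lies
    within 1 + M of f_v(p), which belongs to the tile. *)
Lemma near_bounded v z k : zr z -> near v z -> normc (sg k z) <= 1 + M + M.
Proof.
move=> hz hv; have [[p Fp] _ _] := hF.
rewrite -(coord_psi hconj halpha k hz); apply: le_trans (coord_le_normK _ _) _.
have zE : psi alpha a c z = fw v (psi alpha a c (Gw v z)).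
  by rewrite psi_Gword // (fwordVK hconj halpha).
have -> : psi alpha a c z = (psi alpha a c z - fw v p) + fw v p by rewrite subrK.
apply: le_trans (normKD _ _) _; apply: lerD; last by apply: hM; exact: tile_fword hF _ _ Fp.
rewrite {1}zE; apply: (@le_trans _ _ (1 * normK (psi alpha a c (Gw v z) - p))).
  apply: (normK_scale (l := fun k => sg k (kap v))) => l.
    by rewrite (kappaE alphaE betaE) normc_sigma_le1.
  exact: coord_fword_sub.
rewrite mul1r; apply: le_trans (normKB _ _) _.
by apply: lerD; [exact: near_le1 | exact: hM].
Qed.

(** For w much longer than v, the inverse of f_v makes the piece f_w(F) tiny and close to where v
    sends z. If v counts z, the expanded tile thus enters the ball of radius 2 r0 that it has to
    avoid. *)
Lemma near_levels : exists l : nat, forall v w z, zr z ->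
  (wt v + l <= wt w)%N -> near v z -> near w z -> False.
Proof.
have [[p Fp] _ _] := hF; have M0 : 0 <= M by exact: le_trans (normK_ge0 p) (hM Fp).
have [rho rho01 hrho] := normc_sigma_unit.
have [l hl] := small_power rho01 (divr_gt0 r00 (ltr_wpDl M0 ltr01)).
have [rho0 rho1] := andP rho01.
exists l => v w z hz vw nv nw.
have vw' : (wt v <= wt w)%N by exact: leq_trans (leq_addr _ _) vw.
pose y := psi alpha a c (Gw w z).
have zE : psi alpha a c z = fw w y by rewrite /y psi_Gword // (fwordVK hconj halpha).
have close : normK (fwV v (fw w p) - psi alpha a c (Gw v z)) < r0.
  rewrite psi_Gword // zE !fwordV_fword.
  apply: (@le_lt_trans _ _ (rho ^+ l * normK (p - y))).
    have [b xE] := kappa_ratio vw'; rewrite xE.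
    have zt : zr (Gw v (Fw w 0)).
      by apply: zring_Gword => //; apply: zring_Fword => //; exact: zring0.
    apply: (normK_scale (l := fun k => sg k ((-1) ^+ b * eta ^+ (wt w - wt v)))) => k.
      rewrite normc_sigma_signed_power.
      apply: (@le_trans _ _ (rho ^+ (wt w - wt v))).
        by rewrite lerXn2r ?nnegrE ?normc_ge0 // ltW.
      by apply: ler_wiXn2l; rewrite ?(ltW rho0) ?(ltW rho1) // leq_subRL.
    rewrite !coordB !(coord_affine hconj halpha) //; try exact: zring_signed_power.
    by ring.
  move: hl; rewrite ltr_pdivlMr ?ltr_wpDl // => /(le_lt_trans _); apply.
  rewrite ler_wpM2l ?exprn_ge0 ?(ltW rho0) //; apply: le_trans (normKB _ _) _.
  by apply: lerD; [exact: hM | exact: near_le1].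
have F2 : normK (fwV v (fw w p) - y0) < 2 * r0.
  apply: le_lt_trans (normK_tri (psi alpha a c (Gw v z)) _ _) _.
  by rewrite mulr_natl mulr2n; exact: (ltrD close nv).
have := @avoid v _ (tile_fword hF w Fp); rewrite leNgt F2 => h.
suff /h : normK (fwV v (fw w p)) < 1 by [].
have := normKD (fwV v (fw w p) - y0) y0; rewrite subrK => /le_lt_trans; apply.
by apply: lt_le_trans y0r0; rewrite addrC ltrD2l.
Qed.

(** Group the words by multiplier, of which there are at most 2 J. Within a group
    [Gword v t - Gword w t] does not depend on t: t = 0 bounds its real size and t = z its
    conjugates, so it ranges over a finite list, while t = 1/2 separates the words. *)
Lemma near_multiplicity : exists D : nat, forall z n m, (m <= n)%N -> zr z ->
  (count (near ^~ z) (code i j n m) <= D)%N.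
Proof.
have [T hT] := zring_finite hconj halpha 2.
exists (2 * J * size T)%N => z n m mn hz.
pose cs := [seq (-1) ^+ (b : bool) * eta ^+ (m + e) | b <- [:: true; false], e <- iota 0 J].
have -> : (2 * J = size cs)%N by rewrite size_allpairs size_iota.
apply: (count_le_classes (cls := kap)).
  move=> v vc; rewrite (kappaE alphaE betaE); have /andP[h1 h2] := code_weight i0 j0 mn vc.
  rewrite -(subnKC h1); apply: allpairs_f; rewrite ?mem_iota; first by case: (odd _).
  lia.
move=> x; rewrite -size_filter.
rewrite -(size_map (fun v => Gw v 2^-1)); set s' := seq.filter _ _.
have s'P v : v \in s' -> near v z /\ kap v = x.
  by rewrite mem_filter => /andP[/= /andP[? /eqP ?] _].
apply: size_le_differences.
  rewrite map_inj_in_uniq ?filter_uniq ?code_uniq // => v w /s'P[_ vx] /s'P[_ wx].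
  by apply: (Gword_inj halpha i0 j0 alphaE betaE eta1); rewrite vx.
move=> _ _ /mapP[v /s'P[nv vx] ->] /mapP[w /s'P[nw wx] ->].
have E t : Gw v t - Gw w t = Gw v 0 - Gw w 0.
  by rewrite GwordE [Gw w t]GwordE vx wx; ring.
have z0 : zr 0 := zring0 alpha.
rewrite E; apply: hT.
- by apply: zringB; apply: zring_Gword.
- have := Gword_itv halpha v (x := 0); have := Gword_itv halpha w (x := 0).
  rewrite lexx ler01 => /(_ isT)/andP[h1 h2] /(_ isT)/andP[h3 h4].
  by rewrite ler_norml; apply/andP; split; lra.
move=> k; rewrite -(E z) (sigmaB hconj halpha); try exact: zring_Gword.
apply: le_trans (normcB _ _) _; rewrite -!(coord_psi hconj halpha); try exact: zring_Gword.
rewrite mulr2n; apply: lerD; apply: le_trans (coord_le_normK _ _) _; exact: near_le1.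
Qed.

(** [Fword v] maps the interval between [Gword v 0] and [Gword v E] onto [0, E]; the minimum covers
    both signs of the multiplier. *)
Lemma Fword_itv v (E q : R) : 0 <= E ->
  Num.min (Gw v 0) (Gw v E) <= q <= Num.min (Gw v 0) (Gw v E) + E / eta ^+ wt v ->
  0 <= Fw v q <= E.
Proof.
move=> E0; rewrite -(kappa_norm alphaE betaE eta1) FwordE /Gword sub0r.
have := kappa_neq0 halpha v.
set F0 := Fw v 0; set x := kap v.
case: (ltrgt0P x) => // x0 _ /andP[].
  rewrite minEle ler_pM2r ?invr_gt0 // lerDr E0 => h1 h2.
  have := ler_wpM2l (ltW x0) h1; have := ler_wpM2l (ltW x0) h2.
  have -> : x * (- F0 / x) = - F0 by field; rewrite gt_eqF.
  have -> : x * (- F0 / x + E / x) = E - F0 by field; rewrite gt_eqF.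
  by move=> h3 h4; apply/andP; split; lra.
rewrite minC minEle ler_nM2r ?invr_lt0 // lerDr E0 => h1 h2.
have := ler_wnM2l (ltW x0) h1; have := ler_wnM2l (ltW x0) h2.
have -> : x * ((E - F0) / x) = E - F0 by field; rewrite lt_eqF.
have -> : x * ((E - F0) / x + E / - x) = - F0 by field; rewrite ?oppr_eq0 lt_eqF.
by move=> h3 h4; apply/andP; split; lra.
Qed.

(** Choose one good point in each window of length H0 inside the interval that [Fword v] stretches
    onto [0, E], and carry these points over by [Fword v]. The -1 accounts for the incomplete last
    window. *)
Lemma near_count (H0 : R) v (E : R) (S : seq R) : 0 < H0 ->
  (forall x, exists q, [/\ zr q, x <= q < x + H0 & normK (psi alpha a c q - y0) < r0]) ->
  0 <= E ->
  (forall z, zr z -> 0 <= z <= E -> (forall k, normc (sg k z) <= 1 + M + M) -> z \in S) ->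
  E / eta ^+ wt v / H0 - 1 <= (count (near v) S)%:R.
Proof.
move=> H00 /choice[q hq] E0 hS.
pose l := E / eta ^+ wt v; rewrite -/l.
have l0 : 0 <= l by rewrite divr_ge0 // exprn_ge0 // ltW.
pose x0 := Num.min (Gw v 0) (Gw v E).
pose qt (t : nat) := q (x0 + t%:R * H0).
pose zs := [seq Fw v (qt n) | n <- iota 0 (Num.truncn (l / H0))].
have qt_lt (t t' : nat) : (t < t')%N -> qt t < qt t'.
  move=> tt'; have [_ /andP[_ h1] _] := hq (x0 + t%:R * H0).
  have [_ /andP[h2 _] _] := hq (x0 + t'%:R * H0).
  apply: lt_le_trans h1 _; apply: le_trans h2; rewrite -addrA lerD2l.
  by rewrite -[X in _ + X]mul1r -mulrDl ler_wpM2r ?(ltW H00) // natr1 ler_nat.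
have uzs : uniq zs.
  rewrite map_inj_in_uniq ?iota_uniq // => t t' _ _ /(congr1 (Gw v)).
  rewrite !(FwordK halpha) => qtt'; case: (ltngtP t t') => // /qt_lt.
    by rewrite qtt' ltxx.
  by rewrite qtt' ltxx.
have sub : {subset zs <= [seq z <- S | near v z]}.
  move=> _ /mapP[t tN ->]; have [zq /andP[q1 q2] qy] := hq (x0 + t%:R * H0).
  have nz : near v (Fw v (qt t)) by rewrite /near (FwordK halpha).
  have zz : zr (Fw v (qt t)) by apply: zring_Fword.
  rewrite mem_filter nz /=; apply: hS zz _ _ => [|k]; last by apply: near_bounded nz; exact: zring_Fword.
  apply: (Fword_itv E0); apply/andP; split.
    by apply: le_trans q1; rewrite lerDl mulr_ge0 // ltW.
  apply: le_trans (ltW q2) _; rewrite -addrA lerD2l -/l.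
  rewrite -[X in _ + X]mul1r -mulrDl -ler_pdivlMr // natr1.
  apply: (@le_trans _ _ (Num.truncn (l / H0))%:R).
    by move: tN; rewrite mem_iota ler_nat.
  by have /andP[] := truncn_itv (divr_ge0 l0 (ltW H00)).
have := uniq_leq_size uzs sub; rewrite size_map size_iota size_filter -(ler_nat R).
apply: le_trans; rewrite lerBlDr natr1.
by have /andP[_ /ltW] := truncn_itv (divr_ge0 l0 (ltW H00)).
Qed.

End counting.

Lemma tile_not_thin :
  ~ (forall y (e : R), 0 < e -> exists2 u, normK (u - y) < e & ~ F u).
Proof.
move=> thin; have [y0 [r0 [r00 y0r0 avoid]]] := avoid_tile thin.
have [_ cF _] := hF; have [M hM] := compact_normK_bounded cF.
have [l hl] := near_levels r00 y0r0 avoid hM.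
have [D hD] := near_multiplicity r00 y0r0.
(* The constants chosen below do not depend on E. Levels are spaced by J + l, since a level spreads
   over fewer than J weights and [near_levels] needs a gap l. *)
have [H0 H00 hq] := zring_dense_near y0 r00.
have [D1 hS] := zring_window (1 + M + M).
pose m (k : nat) := (k * (J + l))%N; pose V (k : nat) := code i j (m k) (m k).
(* Makes n / H0 exceed D1 D + 1, so the lower bound grows faster in E than the upper bound D1 D (E +
   1). *)
pose n := (Num.truncn (H0 * ((D1 * D)%:R + 1))).+1.
pose W := (\sum_(k < n) size (V k))%N.
(* The two bounds together give E < W + D1 D, which this choice of L contradicts. *)
have [L hL] : exists L, (W + D1 * D)%:R < eta ^+ L.
  have [||L hL] := @small_power eta^-1 (W + D1 * D).+1%:R^-1.
  - by rewrite invr_gt0 eta0 invf_lt1.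
  - by rewrite invr_gt0.
  exists L; rewrite exprVn ltf_pV2 ?posrE ?exprn_gt0 // in hL.
  by apply: lt_trans hL; rewrite ltr_nat.
pose E := eta ^+ L; have E0 : 0 < E by rewrite exprn_gt0.
have [S [uS zS hSin hSs]] := hS E (ltW E0).
have upper : ((\sum_(k < n) \sum_(v <- V k) count (near y0 r0 v) S)%N <= D * size S)%N.
  rewrite count_exchange -sum1_size big_distrr /= big_seq [X in (_ <= X)%N]big_seq.
  apply: leq_sum => z /zS hz; rewrite muln1.
  apply: (@sum_le_single _ _ (fun k : nat => count (near y0 r0 ^~ z) (V k))) => [k|k k' kk'].
    exact: hD.
  rewrite -!has_count => /hasP[v vV nv] /hasP[w wV nw].
  apply: (hl v w z) => //.
  have := code_weight i0 j0 (leqnn _) vV; have := code_weight i0 j0 (leqnn _) wV.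
  move=> /andP[mw _] /andP[_ mv]; apply: leq_trans mw.
  apply: (@leq_trans (m k.+1)); last by rewrite leq_mul2r kk' orbT.
  by rewrite /m mulSn [(J + l + _)%N]addnAC leq_add2r addnC ltnW.
have lower : n%:R * (E / H0) - W%:R <=
    (\sum_(k < n) \sum_(v <- V k) count (near y0 r0 v) S)%N%:R.
  rewrite natr_sum /W natr_sum -[n in n%:R]card_ord mulr_natl -sumr_const -sumrB.
  apply: ler_sum => k _; rewrite natr_sum.
  apply: (@le_trans _ _ (\sum_(v <- V k) (E / eta ^+ wt v / H0 - 1))).
    rewrite sumrB big_const_seq count_predT iter_addr_0 lerD2r.
    under eq_bigr do rewrite mulrAC.
    by rewrite -mulr_sumr (code_sum halpha i0 j0 alphaE betaE eta1) // mulr1.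
  by apply: ler_sum => v _; apply: (near_count (M := M)) => //; exact: ltW.
have nH : (D1 * D)%:R + 1 < n%:R / H0.
  by rewrite ltr_pdivlMr // mulrC; exact: truncnS_gt.
have : n%:R * (E / H0) - W%:R <= (D1 * D)%:R * (E + 1).
  apply: le_trans lower _; apply: (@le_trans _ _ (D * size S)%:R); first by rewrite ler_nat.
  by rewrite natrM mulnC natrM -mulrA ler_wpM2l.
rewrite mulrA mulrAC => h.
have := ltr_pM2r E0 ((D1 * D)%:R + 1) (n%:R / H0); rewrite nH => h2.
move: hL; rewrite natrD -/E; move: h h2 => h /esym h2; lra.
Qed.

Lemma tile_approx u (e : R) : F u -> 0 < e ->
  exists w, forall p, F p -> normK (fw w p - u) < e.
Proof.
move=> Fu e0; have [_ cF _] := hF; have [M hM] := compact_normK_bounded cF.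
have M0 : 0 <= M by exact: le_trans (normK_ge0 u) (hM u Fu).
have [rho rho01 hrho] := normc_sigma_unit; have [rho0 rho1] := andP rho01.
have [n hn] := small_power rho01 (divr_gt0 e0 (ltr_wpDl (addr_ge0 M0 M0) ltr01)).
have [w [u' [wc Fu' uE]]] := tile_cover hF Fu i0 j0 (leqnn n).
have /andP[nw _] := code_weight i0 j0 (leqnn n) wc.
exists w => p Fp; rewrite uE; apply: (@le_lt_trans _ _ (rho ^+ n * normK (p - u'))).
  apply: (normK_scale (l := fun k => sg k (kap w))) => k; last exact: coord_fword_sub.
  rewrite (kappaE alphaE betaE) normc_sigma_signed_power.
  apply: (@le_trans _ _ (rho ^+ wt w)).
    by rewrite lerXn2r ?nnegrE ?normc_ge0 // ltW.
  by apply: ler_wiXn2l; rewrite ?(ltW rho0) ?(ltW rho1).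
move: hn; rewrite ltr_pdivlMr ?ltr_wpDl ?addr_ge0 // => /(le_lt_trans _); apply.
rewrite ler_wpM2l ?exprn_ge0 ?(ltW rho0) //; apply: le_trans (normKB _ _) _.
by apply: ler_wpDr => //; apply: lerD; exact: hM.
Qed.

Lemma tile_eq_closure_interior : F = closure (interior F).
Proof.
have cF := tile_closed hF; apply/seteqP; split; last first.
  by rewrite [X in _ `<=` X]((closure_id F).1 cF); exact: closureS (@interior_subset _ F).
have [y [d d0 yF]] : exists y, exists2 d : R, 0 < d & forall u, normK (u - y) < d -> F u.
  apply: contrapT => nF; apply: tile_not_thin => y e e0; apply: contrapT => nu.
  apply: nF; exists y, e => // u uy; apply: contrapT => nFu; apply: nu; exists u => //.
move=> u Fu B /nbhs_normK[e e0 eB]; have [w hw] := tile_approx Fu e0.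
have Fy : F y by apply: yF; rewrite subrr normK0.
exists (fw w y); split; last by apply: eB; exact: hw.
(* The inverse of [fword w] is Lipschitz, so [fword w] carries the ball around [y] to a
   neighbourhood of its image. *)
have [C C0 hC] := affine_lipschitz hconj halpha (zring_kappaV halpha w)
  (zring_Gword halpha w (zring0 alpha)).
apply/nbhs_normK; exists (d / C); rewrite ?divr_gt0 // => v vy.
rewrite -[v](fwordVK hconj halpha w); apply: tile_fword hF _ _ _; apply: yF.
rewrite -[y](fwordK hconj halpha w); apply: le_lt_trans (hC _ _) _.
by rewrite mulrC -ltr_pdivlMr.
Qed.

End unit.

Theorem theorem1p1 (R : realType) (alpha : R)
    (halpha : special_pisot_unit alpha)
    (r s : nat) (a : 'I_r -> R) (c : 'I_s -> R[i])
    (hconj : conj_enum alpha a c) :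
  compact (tent_tile alpha a c) /\
  tent_tile alpha a c = closure (interior (tent_tile alpha a c)).
Proof.
have [F0 hF0] := tent_tile_exists hconj halpha.
have hF : is_tent_tile alpha a c (tent_tile alpha a c) by exact: xgetI hF0.
split; first by have [_ cF _] := hF.
have [eta [i [j [[i0 j0 alphaE betaE] [eta1 zeta zetaV]]]]] := special_pisot_unit_powers halpha.
exact: (tile_eq_closure_interior hconj halpha i0 j0 alphaE betaE eta1 zeta zetaV hF).
Qed.
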